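(* Let $m\ge1$ and let $f$ be a non-constant entire function in $\mathbb{C}^m$ such that $\frac{\partial f}{\partial z_i}\not\equiv0$ for all $i\in\{1,\ldots,m\}$. Then $$\max\left\{\rho\left(\frac{\partial f}{\partial z_1}\right),\ldots,\rho\left(\frac{\partial f}{\partial z_m}\right)\right\}=\rho(f).$$
   Context: On $\mathbb{C}^m$ let $\tau_m(z)=\|z\|^2$ (Euclidean norm), $d=\partial+\bar\partial$, $d^c=\frac{\iota}{4\pi}(\bar\partial-\partial)$ with $\iota=\sqrt{-1}$, and on $\mathbb{C}^m\setminus\{0\}$ let $\omega_m=dd^c\log\tau_m$ and $\sigma_m=d^c\log\tau_m\wedge\omega_m^{m-1}$. For $r>0$ let $\mathbb{C}^m\langle r\rangle=\{z\in\mathbb{C}^m:\|z\|=r\}$. For an entire function $g$ in $\mathbb{C}^m$ the Nevanlinna characteristic function is $T(r,g)=m(r,g)=\int_{\mathbb{C}^m\langle r\rangle}\log^+|g|\,\sigma_m$ (the term $N(r,g)$ counting poles vanishes for entire $g$). The order of $g$ is $$\rho(g)=\limsup_{r\to\infty}\frac{\log^+T(r,g)}{\log r},$$ where $\log^+x=\max\{\log x,0\}$ for $x>0$ and $\log^+0=0$. *)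

(* Defs.v *)
(* C is represented by R[i] for R : realType, and C^m by 'rV[R[i]]_m. *)
From mathcomp Require Import all_boot all_order all_fingroup all_algebra.
From mathcomp Require Import all_classical all_reals all_analysis.
From mathcomp.real_closed Require Export complex.

Set Implicit Arguments.
Unset Strict Implicit.
Unset Printing Implicit Defensive.

Import Order.TTheory GRing.Theory Num.Theory.
Import numFieldNormedType.Exports.

Local Open Scope classical_set_scope.
Local Open Scope ring_scope.
Local Open Scope complex_scope.

(* The regular module R[i]^o carries the normed-module structure of R[i]. *)
Definition entire (R : realType) (m : nat) (f : 'rV[R[i]]_m -> R[i]^o) : Prop :=
  forall z, differentiable f z.

Definition cpartial (R : realType) (m : nat) (i : 'I_m)
    (f : 'rV[R[i]]_m -> R[i]^o) : 'rV[R[i]]_m -> R[i]^o :=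
  fun z => 'D_(delta_mx 0 i) f z.

Section Forms.
Context {R : realType} {m : nat}.
Local Notation V := 'rV[R[i]]_m.

Definition tau (z : V) : R :=
  \sum_(j < m) (complex.Re (z 0 j) ^+ 2 + complex.Im (z 0 j) ^+ 2).

(* Derivative of u at z in the real direction v. *)
Definition rderive (u : V -> R) (z v : V) : R :=
  derive1 (fun s : R => u (z + s%:C *: v)) 0.

Definition wirtinger (u : V -> R) (z : V) (j : 'I_m) : R[i] :=
  (rderive u z (delta_mx 0 j))%:C / 2 -
  'i%C * (rderive u z ('i%C *: delta_mx 0 j))%:C / 2.

Definition wirtinger_bar (u : V -> R) (z : V) (j : 'I_m) : R[i] :=
  (rderive u z (delta_mx 0 j))%:C / 2 +
  'i%C * (rderive u z ('i%C *: delta_mx 0 j))%:C / 2.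

Definition del (u : V -> R) (z v : V) : R[i] :=
  \sum_(j < m) wirtinger u z j * v 0 j.

Definition delbar (u : V -> R) (z v : V) : R[i] :=
  \sum_(j < m) wirtinger_bar u z j * conjc (v 0 j).

(* Real differential forms of degree k on (an open subset of) C^m, given by
   their values on k tangent vectors. *)
Definition form (k : nat) : Type := V -> ('I_k -> V) -> R.

(* For real u the value of (i / 4 pi) (delbar - del) u is real, so taking the
   real part loses nothing. *)
Definition dc (u : V -> R) : form 1 := fun z v =>
  complex.Re ('i%C / (4 * pi)%:C * (delbar u z (v ord0) - del u z (v ord0))).

(* Exterior derivative of a 1-form, evaluated on constant vector fields. *)
Definition ext_d (a : form 1) : form 2 := fun z v =>
  rderive (fun w => a w (fun=> v ord_max)) z (v ord0) -
  rderive (fun w => a w (fun=> v ord0)) z (v ord_max).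

(* Normalised so that (dx /\ dy) (e_x, e_y) = 1. *)
Definition wedge (p q : nat) (a : form p) (b : form q) : form (p + q) :=
  fun z v => ((p`! * q`!)%:R)^-1 *
    \sum_(s : {perm 'I_(p + q)})
      (-1) ^+ s * a z (fun i => v (s (lshift q i)))
                * b z (fun i => v (s (rshift p i))).

Fixpoint wedge_pow (a : form 2) (k : nat) : form (k * 2) :=
  if k is k'.+1 then wedge a (@wedge_pow a k') else fun _ _ => 1.

Definition log_tau (z : V) : R := ln (tau z).

Definition omega : form 2 := ext_d (dc log_tau).

Definition sigma : form (1 + m.-1 * 2) := wedge (dc log_tau) (@wedge_pow omega m.-1).

End Forms.

(* Iterated Lebesgue integral over R^k; by Tonelli it is the k-dimensional
   Lebesgue integral for measurable nonnegative f. *)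
Fixpoint iter_integral (R : realType) (k : nat) :
    ('rV[R]_k -> \bar R) -> \bar R :=
  if k is k'.+1 then
    fun f => (\int[lebesgue_measure]_x
      iter_integral (fun y : 'rV[R]_k' => f (row_mx (const_mx x : 'rV[R]_1) y)))%E
  else fun f => f 0.

Section Sphere.
Context {R : realType} {n : nat}.
Local Notation P := 'rV[R]_(1 + n * 2).

(* The sphere of radius r in C^(n+1) is parametrised, up to a null set, by
     z_j = r sqrt(t_j) e^(i theta_j),  0 < theta_j < 2 pi,  0 < t_j,
     t_0 + ... + t_n = 1,
   with parameters p = (theta_0, t_1, theta_1, ..., t_n, theta_n).  In this
   order they are positively oriented for the sphere as boundary of the ball:
   in terms of R = r^2, the form dx_0 /\ dy_0 /\ ... /\ dx_n /\ dy_n is a positive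
   multiple of dR /\ dtheta_0 /\ dt_1 /\ dtheta_1 /\ ... /\ dt_n /\ dtheta_n. *)
Definition sph_theta (p : P) (j : 'I_n.+1) : R := p 0 (inord (j * 2)).

Definition sph_t (p : P) (j : 'I_n.+1) : R :=
  if j == ord0 then 1 - \sum_(k < n) p 0 (inord (k * 2).+1)
  else p 0 (inord (j * 2).-1).

Definition sph_dom : set P :=
  [set p | forall j, 0 < sph_theta p j < 2 * pi /\ 0 < sph_t p j].

Definition sph_chart (r : R) (p : P) : 'rV[R[i]]_n.+1 :=
  \row_j ((r * Num.sqrt (sph_t p j) * cos (sph_theta p j)) +i*
          (r * Num.sqrt (sph_t p j) * sin (sph_theta p j))).

(* k-th coordinate tangent vector of the chart. *)
Definition sph_tangent (r : R) (p : P) (k : 'I_(1 + n * 2)) : 'rV[R[i]]_n.+1 :=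
  \row_j ('D_(delta_mx 0 k) (fun q => complex.Re (sph_chart r q 0 j)) p +i*
          'D_(delta_mx 0 k) (fun q => complex.Im (sph_chart r q 0 j)) p).

(* Integral of the form h a over the sphere of radius r, i.e. the integral over
   the parameter domain of its pullback by the chart. *)
Definition sph_integral (r : R) (h : 'rV[R[i]]_n.+1 -> R)
    (a : @form R n.+1 (1 + n * 2)) : \bar R :=
  iter_integral ((fun p : P =>
    (h (sph_chart r p) * a (sph_chart r p) (sph_tangent r p))%:E) \_ sph_dom).

(* ln vanishes on nonpositive reals, so this is 0 at 0. *)
Definition logp (x : R) : R := Num.max (ln x) 0.

Definition nevanlinna_T (g : 'rV[R[i]]_n.+1 -> R[i]^o) (r : R) : \bar R :=
  sph_integral r (fun z => logp (complex.Re `|g z|)) sigma.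

(* lne 0 = -oo, so log^+ 0 = 0 here too. *)
Definition growth_order (g : 'rV[R[i]]_n.+1 -> R[i]^o) : \bar R :=
  limf_esup (fun r : R =>
    (maxe (lne (nevanlinna_T g r)) 0 * ((ln r)^-1)%:E)%E) +oo%R.

End Sphere.

(* Main.v *)
Require Import Defs.
From mathcomp Require Import all_boot all_order all_fingroup all_algebra.
From mathcomp Require Import all_classical all_reals all_analysis.
From mathcomp Require Import measurable_realfun ring lra.

(** The characteristic T (r, g) turns out to be comparable with the maximum
    modulus.  In the chart of the sphere by t_j = |z_j|^2 / r^2 and the arguments
    theta_j, the form sigma has a constant density c ([sigma_density]), so that
    T (r, g) is c times the Lebesgue integral of log^+ |g| over a simplex times a
    torus.  If c <= 0, all characteristics are nonpositive and all orders are 0.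
    If c > 0, bounding the integrand by its supremum gives
      T (r, g) <= A1 * sup of log^+ |g| on the polydisc of radius r
    ([nevanlinna_upper]).  Conversely,
      A2 * log^+ |g (w)| <= T (K * s, g) for w in the polydisc of radius s
    ([nevanlinna_lower]) whenever log^+ |g| is subharmonic in each variable: one
    keeps only the part of the sphere on which all coordinates are large compared
    with w, and applies a sub-mean value inequality to each angle in turn
    ([submean_disc], [sphere_lower]).

    Both inequalities apply to f and to its partial derivatives.  The Cauchy
    estimate bounds the partial derivatives on a polydisc by f on a larger one,
    and the mean value inequality along the segment from 0 bounds f by its
    partial derivatives.  Hence T (r, d_j f) <= A * (T (C * r, f) + 1) and
    T (r, f) <= A * (max_j T (C * r, d_j f) + log r + 1) up to constants
    ([partial_upper], [function_upper]); constants, the dilation of r and the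
    term log r do not change the order.

    The complex analysis rests on the maximum principle at the centre of a disc
    for functions that are complex differentiable off the centre and continuous
    there ([max_principle]), which comes from Goursat's bisection argument.
    Applied to the difference quotient it gives the Cauchy estimate, and applied
    to a product of rotated copies of G it gives the sub-mean value inequality
    for log^+ |G| at the centre; a Moebius transformation moves the centre.  A
    partial derivative is a locally uniform limit of difference quotients of f,
    which is enough to make its log^+ |.| subharmonic in each variable
    ([partial_subharmonic]). *)

Set Implicit Arguments.
Unset Strict Implicit.
Unset Printing Implicit Defensive.

Import Order.TTheory GRing.Theory Num.Theory.
Import numFieldNormedType.Exports.

Local Open Scope classical_set_scope.
Local Open Scope ring_scope.
Local Open Scope complex_scope.

(** * Primitives and integrals of continuous functions *)

Section Primitives.
Context {R : realType}.
Implicit Types (h g : R -> R) (k l a b c x : R).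

Definition integ h a b : R :=
  fine (\int[lebesgue_measure]_(x in `[a, b]) (h x)%:E)%E.

Lemma is_derive_cont h (x d : R) : is_derive x 1 h d -> {for x, continuous h}.
Proof. by move=> [hd _]; apply: differentiable_continuous; apply/derivable1_diffP. Qed.

Lemma integE h H a b : a <= b -> continuous h ->
  (forall x, a <= x <= b -> is_derive x 1 H (h x)) ->
  (\int[lebesgue_measure]_(x in `[a, b]) (h x)%:E)%E = (H b - H a)%:E.
Proof.
rewrite le_eqVlt => /orP[/eqP <- _ _|ab ch Hd].
  by rewrite set_itv1 integral_set1 subrr.
rewrite (@continuous_FTC2 _ h H a b ab) //.
- exact: continuous_subspaceT.
- split.
  + by move=> x; rewrite in_itv /= => /andP[ax xb]; have [] : is_derive x 1 H (h x) by apply: Hd; rewrite (ltW ax) (ltW xb).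
  + apply: cvg_at_right_filter; apply: is_derive_cont (Hd _ _); by rewrite lexx ltW.
  + apply: cvg_at_left_filter; apply: is_derive_cont (Hd _ _); by rewrite lexx ltW.
- move=> x; rewrite in_itv /= => /andP[ax xb]; rewrite derive1E.
  by have [_ ->] : is_derive x 1 H (h x) by apply: Hd; rewrite (ltW ax) (ltW xb).
Qed.

Lemma primitive_exists h a : continuous h ->
  exists H, forall x, a <= x -> is_derive x 1 H (h x).
Proof.
move=> ch; exists (fun x => \int[lebesgue_measure]_(t in `[a - 1, x]) h t) => x ax.
have ci : lebesgue_measure.-integrable `[a - 1, x + 1] (EFin \o h).
  apply: continuous_compact_integrable; first exact: segment_compact.
  exact: continuous_subspaceT.
have [] := @continuous_FTC1_closed R h (a - 1) x (x + 1) _ ci _ (ch x).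
- by rewrite ltrDl.
- by apply: lt_le_trans ax; rewrite ltrBlDr ltrDl.
by move=> d1 d2; split; [exact: d1|rewrite -derive1E; exact: d2].
Qed.

Lemma integ_prim h a0 H : continuous h ->
  (forall x, a0 <= x -> is_derive x 1 H (h x)) ->
  forall a b, a0 <= a -> a <= b -> integ h a b = H b - H a.
Proof.
move=> ch Hd a b a0a ab; rewrite /integ.
suff -> : (\int[lebesgue_measure]_(x in `[a, b]) (h x)%:E)%E = (H b - H a)%:E by [].
by apply: integE => // x /andP[ax _]; apply: Hd; exact: le_trans ax.
Qed.

Lemma integ_fin h a b : a <= b -> continuous h ->
  (\int[lebesgue_measure]_(x in `[a, b]) (h x)%:E)%E = (integ h a b)%:E.
Proof.
move=> ab ch; have [H Hd] := primitive_exists a ch.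
rewrite (integ_prim ch Hd) //; apply: integE => // x /andP[ax _]; exact: Hd.
Qed.

Lemma integ_cat h a b c : a <= b -> b <= c -> continuous h ->
  integ h a c = integ h a b + integ h b c.
Proof.
move=> ab bc ch; have [H Hd] := primitive_exists a ch.
rewrite !(integ_prim ch Hd) ?(le_trans ab bc) //; ring.
Qed.

Lemma integD k l h g a b : a <= b -> continuous h -> continuous g ->
  integ (fun x => k * h x + l * g x) a b = k * integ h a b + l * integ g a b.
Proof.
move=> ab ch cg; have [H Hd] := primitive_exists a ch.
have [G Gd] := primitive_exists a cg.
have cc : continuous (fun x => k * h x + l * g x).
  by move=> x; apply: cvgD; apply: cvgM; by [exact: cvg_cst|exact: ch|exact: cg].
have Kd x : a <= x -> is_derive x 1 (fun x => k * H x + l * G x) (k * h x + l * g x).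
  move=> ax; have := Hd x ax; have := Gd x ax => ? ?.
  by apply: is_derive_eq; rewrite /GRing.scale /=; ring.
rewrite (integ_prim ch Hd) // (integ_prim cg Gd) // (integ_prim cc Kd) //; ring.
Qed.

Lemma integZ k h a b : a <= b -> continuous h ->
  integ (fun x => k * h x) a b = k * integ h a b.
Proof.
move=> ab ch; rewrite -[RHS]addr0 -(mul0r (integ h a b)) -integD //.
by congr integ; apply/funext => x; ring.
Qed.

Lemma integ_affine k l a b : a <= b ->
  integ (fun x => k + l * x) a b = k * (b - a) + l * (b ^+ 2 - a ^+ 2) / 2.
Proof.
move=> ab.
have cc : continuous (fun x : R => k + l * x).
  by move=> x; apply: cvgD; [exact: cvg_cst|apply: cvgM; by [exact: cvg_cst|exact: cvg_id]].
have Kd x : a <= x -> is_derive x 1 (fun x => k * x + l / 2 * (x * x)) (k + l * x).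
  by move=> _; apply: is_derive_eq; rewrite /GRing.scale /=; field.
by rewrite (integ_prim cc Kd) //; field.
Qed.

Lemma le_integ h g a b : a <= b -> continuous h -> continuous g ->
  (forall x, a <= x <= b -> h x <= g x) -> integ h a b <= integ g a b.
Proof.
rewrite le_eqVlt => /orP[/eqP <- ch cg _|ab ch cg hg].
  by rewrite /integ set_itv1 !integral_set1.
have ab' := ltW ab.
have [H Hd] := primitive_exists a ch.
have [G Gd] := primitive_exists a cg.
rewrite (integ_prim ch Hd) // (integ_prim cg Gd) //.
have D x : a <= x -> is_derive x 1 (fun x => G x - H x) (g x - h x).
  by move=> ax; have := Hd x ax; have := Gd x ax => ? ?; apply: is_derive_eq.
have [||c] := @MVT R (fun x => G x - H x) (fun x => g x - h x) a b ab.
- by move=> x; rewrite in_itv /= => /andP[ax _]; apply: D; exact: ltW.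
- apply: derivable_within_continuous => x; rewrite in_itv /= => /andP[ax _].
  by have [] := D x ax.
rewrite in_itv /= => /andP[ac cb] E.
have : 0 <= (g c - h c) * (b - a).
  by apply: mulr_ge0; rewrite subr_ge0 ?ab' // hg // (ltW ac) ltW.
rewrite -E; lra.
Qed.

Lemma integ_cst k a b : a <= b -> integ (fun=> k) a b = k * (b - a).
Proof.
move=> ab; rewrite -[RHS]addr0 -[X in _ + X](_ : 0 * (b ^+ 2 - a ^+ 2) / 2 = 0); last by ring.
by rewrite -integ_affine //; congr integ; apply/funext => x; ring.
Qed.

End Primitives.

(** * Goursat's theorem on a rectangle *)

Section Goursat.
Context {R : realType}.
Implicit Types (h : R -> R) (k l a b c d e x y : R).

Lemma integ_near_affine h k l e a b : a <= b -> continuous h ->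
  (forall x, a <= x <= b -> `|h x - (k + l * x)| <= e) ->
  `|integ h a b - (k * (b - a) + l * (b ^+ 2 - a ^+ 2) / 2)| <= e * (b - a).
Proof.
move=> ab ch hl.
have cc m : continuous (fun x : R => m + l * x).
  by move=> x; apply: cvgD; [exact: cvg_cst|apply: cvgM; by [exact: cvg_cst|exact: cvg_id]].
have := @le_integ R h (fun x => (k + e) + l * x) a b ab ch (cc _).
have := @le_integ R (fun x => (k - e) + l * x) h a b ab (cc _) ch.
rewrite !integ_affine // => lo hi.
rewrite ler_norml; apply/andP; split.
  have /lo : forall x, a <= x <= b -> (k - e) + l * x <= h x.
    by move=> x /hl; rewrite ler_norml => /andP[]; lra.
  by rewrite mulrBl; lra.
have /hi : forall x, a <= x <= b -> h x <= (k + e) + l * x.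
  by move=> x /hl; rewrite ler_norml => /andP[]; lra.
by rewrite mulrDl; lra.
Qed.

Variables (P Q : R -> R -> R).
Hypothesis cP : forall x, continuous (P x).
Hypothesis cQ : forall y, continuous (Q^~ y).

(** The integral of P dy - Q dx around the boundary of the rectangle
    a <= x <= b, c <= y <= d. *)
Definition flux a b c d :=
  integ (P b) c d - integ (P a) c d + integ (Q^~ d) a b - integ (Q^~ c) a b.

Lemma flux_split a m b c n d : a <= m -> m <= b -> c <= n -> n <= d ->
  flux a b c d = flux a m c n + flux m b c n + flux a m n d + flux m b n d.
Proof.
move=> am mb cn nd; rewrite /flux.
rewrite !(integ_cat cn nd) // !(integ_cat am mb) //; ring.
Qed.

(** An affine field with divergence p1 + q2 = 0 has zero flux, so only its
    distance e to the field (P, Q) counts. *)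
Lemma flux_small a b c d x y p p1 p2 q q1 q2 e :
  a <= b -> c <= d -> p1 + q2 = 0 ->
  (forall x' y', a <= x' <= b -> c <= y' <= d ->
    `|P x' y' - (p + p1 * (x' - x) + p2 * (y' - y))| <= e /\
    `|Q x' y' - (q + q1 * (x' - x) + q2 * (y' - y))| <= e) ->
  `|flux a b c d| <= 2 * e * ((b - a) + (d - c)).
Proof.
move=> ab cd pq H.
have HP x' : a <= x' <= b -> `|integ (P x') c d -
   ((p + p1 * (x' - x) - p2 * y) * (d - c) + p2 * (d ^+ 2 - c ^+ 2) / 2)| <= e * (d - c).
  move=> hx; apply: integ_near_affine => // y' hy.
  by have [+ _] := H _ _ hx hy; congr (`|_| <= _); ring.
have HQ y' : c <= y' <= d -> `|integ (Q^~ y') a b -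
   ((q + q2 * (y' - y) - q1 * x) * (b - a) + q1 * (b ^+ 2 - a ^+ 2) / 2)| <= e * (b - a).
  move=> hy; apply: integ_near_affine => // x' hx.
  by have [_] := H _ _ hx hy; congr (`|_| <= _); ring.
have := HP a; have := HP b; have := HQ c; have := HQ d; rewrite !lexx ab cd /=.
move=> /(_ isT) + /(_ isT) + /(_ isT) + /(_ isT).
rewrite !ler_norml => /andP[d1 d2] /andP[c1 c2] /andP[b1 b2] /andP[a1 a2].
have {}pq : q2 = - p1 by rewrite -[RHS]addr0 -pq; ring.
rewrite /flux; subst q2.
apply/andP; split; nra.
Qed.

Variables (A B C D : R).
Hypothesis AB : A < B.
Hypothesis CD : C < D.

(** Total differentiability at one point, with zero divergence p1 + q2, tested only
    within the rectangle: the points of its boundary are included. *)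
Definition divfree_at x y := exists p1 p2 q1 q2, p1 + q2 = 0 /\
  forall e, 0 < e -> exists2 dl, 0 < dl &
  forall x' y', A <= x' <= B -> C <= y' <= D -> `|x' - x| < dl -> `|y' - y| < dl ->
    `|P x' y' - (P x y + p1 * (x' - x) + p2 * (y' - y))| <= e * (`|x' - x| + `|y' - y|) /\
    `|Q x' y' - (Q x y + q1 * (x' - x) + q2 * (y' - y))| <= e * (`|x' - x| + `|y' - y|).

Hypothesis HD : forall x y, A <= x <= B -> C <= y <= D -> divfree_at x y.

Let lx n := (B - A) / 2 ^+ n.
Let ly n := (D - C) / 2 ^+ n.

Let lxS n : lx n = lx n.+1 + lx n.+1.
Proof. rewrite /lx exprS; field. by rewrite expf_neq0. Qed.
Let lyS n : ly n = ly n.+1 + ly n.+1.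
Proof. rewrite /ly exprS; field. by rewrite expf_neq0. Qed.
Let lx_gt0 n : 0 < lx n. Proof. by rewrite divr_gt0 ?subr_gt0 ?exprn_gt0. Qed.
Let ly_gt0 n : 0 < ly n. Proof. by rewrite divr_gt0 ?subr_gt0 ?exprn_gt0. Qed.

Let big (n : nat) (z : R * R) := [/\ A <= z.1, z.1 + lx n <= B, C <= z.2, z.2 + ly n <= D &
  `|flux A B C D| / 4 ^+ n <= `|flux z.1 (z.1 + lx n) z.2 (z.2 + ly n)|].
Let inside n (z z' : R * R) := [/\ z.1 <= z'.1, z'.1 <= z.1 + lx n.+1, z.2 <= z'.2 & z'.2 <= z.2 + ly n.+1].

Let bisect n z : big n z -> exists z', inside n z z' /\ big n.+1 z'.
Proof.
case: z => a c [/= Aa aB Cc cD F].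
have l0 := lx_gt0 n.+1; have w0 := ly_gt0 n.+1.
rewrite lxS in aB F; rewrite lyS in cD F.
rewrite addrA in aB F; rewrite addrA in cD F.
set l := lx n.+1 in aB F l0 *; set w := ly n.+1 in cD F w0 *.
rewrite (@flux_split a (a + l) (a + l + l) c (c + w) (c + w + w)) ?lerDl ?(ltW l0) ?(ltW w0) // in F.
set K := `|flux A B C D| / 4 ^+ n.+1.
have E : `|flux A B C D| / 4 ^+ n = 4 * K.
  by rewrite /K exprS; field; rewrite expf_neq0.
rewrite E in F.
set f1 := flux a _ c _ in F; set f2 := flux (a + l) _ c _ in F.
set f3 := flux a _ (c + w) _ in F; set f4 := flux (a + l) _ (c + w) _ in F.
have Hz u v f : f = flux u (u + l) v (v + w) -> a <= u <= a + l -> c <= v <= c + w -> K <= `|f| ->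
   exists z', inside n (a, c) z' /\ big n.+1 z'.
  move=> -> /andP[u1 u2] /andP[v1 v2] Kf; exists (u, v); split; first by split.
  split => //=; rewrite -/l -/w; lra.
have [k1|k1] := leP K `|f1|; first by apply: (Hz a c f1) => //; lra.
have [k2|k2] := leP K `|f2|; first by apply: (Hz (a + l) c f2) => //; lra.
have [k3|k3] := leP K `|f3|; first by apply: (Hz a (c + w) f3) => //; lra.
have [k4|k4] := leP K `|f4|; first by apply: (Hz (a + l) (c + w) f4) => //; lra.
exfalso; have := ler_normD (f1 + f2 + f3) f4; have := ler_normD (f1 + f2) f3.
have := ler_normD f1 f2; lra.
Qed.

Let zs := fix zs n := if n is n'.+1 then
   xget (zs n') [set z' | inside n' (zs n') z' /\ big n'.+1 z'] else (A, C).

Let big_zs n : big n (zs n) /\ inside n (zs n) (zs n.+1).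
Proof.
suff h : big n (zs n).
  by split => //=; case: xgetP => [z _ []//|]; have [z hz] := bisect h => /(_ z) [].
elim: n => [|n IH] /=.
  have -> : big 0 (A, C) = [/\ A <= A, A + lx 0 <= B, C <= C, C + ly 0 <= D &
     `|flux A B C D| / 4 ^+ 0 <= `|flux A (A + lx 0) C (C + ly 0)|] by [].
  have -> : A + lx 0 = B by rewrite /lx expr0 divr1; ring.
  have -> : C + ly 0 = D by rewrite /ly expr0 divr1; ring.
  by rewrite expr0 divr1; split.
by case: xgetP => [z _ []//|]; have [z hz] := bisect IH => /(_ z) [].
Qed.

Let zs_le n m : (n <= m)%N -> [/\ (zs n).1 <= (zs m).1, (zs m).1 + lx m <= (zs n).1 + lx n,
   (zs n).2 <= (zs m).2 & (zs m).2 + ly m <= (zs n).2 + ly n].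
Proof.
elim: m => [|m IH]; first by rewrite leqn0 => /eqP ->.
rewrite leq_eqVlt => /orP[/eqP -> //|]; rewrite ltnS => /IH [h1 h2 h3 h4].
have [_ [i1 i2 i3 i4]] := big_zs m; rewrite (lxS m) in h2; rewrite (lyS m) in h4.
by split; lra.
Qed.

(** Nested rectangles obtained by bisection each keep a quarter of the previous
    flux, while near their common point the flux is o of the squared diameter. *)
Lemma goursat : flux A B C D = 0.
Proof.
apply/eqP/negP => /negP F0.
have zle n m : (zs n).1 <= (zs m).1 + lx m /\ (zs n).2 <= (zs m).2 + ly m.
  have := zs_le (leq_maxl n m); have := zs_le (leq_maxr n m).
  move=> [_ a1 _ a2] [b1 _ b2 _]; have := lx_gt0 (maxn n m); have := ly_gt0 (maxn n m); lra.
pose sx := [set (zs n).1 | n in [set: nat]]; pose sy := [set (zs n).2 | n in [set: nat]].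
pose x := sup sx; pose y := sup sy.
have hx n : (zs n).1 <= x <= (zs n).1 + lx n.
  apply/andP; split.
    by apply: ub_le_sup; [exists ((zs 0%N).1 + lx 0) => _ [m _ <-]; exact: (zle m 0%N).1|exists n].
  by apply: ge_sup; [exists (zs 0%N).1; exists 0%N|move=> _ [m _ <-]; exact: (zle m n).1].
have hy n : (zs n).2 <= y <= (zs n).2 + ly n.
  apply/andP; split.
    by apply: ub_le_sup; [exists ((zs 0%N).2 + ly 0) => _ [m _ <-]; exact: (zle m 0%N).2|exists n].
  by apply: ge_sup; [exists (zs 0%N).2; exists 0%N|move=> _ [m _ <-]; exact: (zle m n).2].
have [[_ xB _ yD _] _] := big_zs 0; have hx0 := hx 0%N; have hy0 := hy 0%N.
have xAB : A <= x <= B by move: hx0 xB => /=; lra.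
have yCD : C <= y <= D by move: hy0 yD => /=; lra.
have [p1 [p2 [q1 [q2 [pq H]]]]] := HD xAB yCD.
pose S := (B - A) + (D - C).
have S0 : 0 < S by rewrite addr_gt0 ?subr_gt0.
have F1 : 0 < `|flux A B C D| by rewrite normr_gt0.
(* With this e the bound of [flux_small] is half of the flux kept by bisection. *)
pose e := `|flux A B C D| / (4 * S ^+ 2).
have e0 : 0 < e by rewrite divr_gt0 // mulr_gt0 // exprn_gt0.
have [dl dl0 Hdl] := H e e0.
have [n Hn] : exists n, S / 2 ^+ n < dl.
  have [n _ Hn] := near_infty_natSinv_expn_lt (PosNum (divr_gt0 dl0 S0)).
  exists n; have /= := Hn n (leqnn n).
  by rewrite ltr_pdivlMr // div1r mulrC.
have [[/= Aa aB Cc cD Fn] _] := big_zs n.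
have lw : lx n + ly n = S / 2 ^+ n by rewrite -mulrDl.
have hxn := hx n; have hyn := hy n; have l0 := lx_gt0 n; have w0 := ly_gt0 n.
have E1 : (zs n).1 + lx n - (zs n).1 + ((zs n).2 + ly n - (zs n).2) = S / 2 ^+ n by rewrite -lw; ring.
have : `|flux (zs n).1 ((zs n).1 + lx n) (zs n).2 ((zs n).2 + ly n)| <=
    2 * (e * (S / 2 ^+ n)) * (S / 2 ^+ n).
  rewrite -{2}E1; apply: (@flux_small _ _ _ _ x y (P x y) p1 p2 (Q x y) q1 q2) => //; try lra.
  move=> x' y' hx' hy'.
  have dx : `|x' - x| <= lx n by rewrite ler_norml; lra.
  have dy : `|y' - y| <= ly n by rewrite ler_norml; lra.
  have [|||| h1 h2] := Hdl x' y'; try lra.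
  have h3 : e * (`|x' - x| + `|y' - y|) <= e * (S / 2 ^+ n) by rewrite ler_pM2l // -lw lerD.
  by split; [apply: le_trans h1 h3|apply: le_trans h2 h3].
move=> Hs; have := le_trans Fn Hs; rewrite leNgt => /negP; apply.
have -> : 2 * (e * (S / 2 ^+ n)) * (S / 2 ^+ n) = (`|flux A B C D| / 4 ^+ n) / 2.
  rewrite /e (_ : 4 ^+ n = 2 ^+ n * 2 ^+ n :> R); last by rewrite -exprMn -natrM.
  by field; rewrite expf_neq0 //= gt_eqF.
have : 0 < `|flux A B C D| / 4 ^+ n by rewrite divr_gt0 // exprn_gt0.
lra.
Qed.

End Goursat.

Notation modc := (@Normc.normc _).

(** * The modulus and complex differentiability *)

Section Modulus.
Context {R : realType}.
Implicit Types z w : R[i].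

Lemma modc_sqr z : modc z ^+ 2 = complex.Re z ^+ 2 + complex.Im z ^+ 2.
Proof. by case: z => a b /=; rewrite sqr_sqrtr // addr_ge0 // sqr_ge0. Qed.

Lemma modc_ge0 z : 0 <= modc z.
Proof. by case: z => a b /=; exact: sqrtr_ge0. Qed.

Lemma modcD z w : modc (z + w) <= modc z + modc w.
Proof. exact: le_normcD. Qed.

Lemma modcN z : modc (- z) = modc z.
Proof. exact: normcN. Qed.

Lemma modcB z w : modc (z - w) <= modc z + modc w.
Proof. by rewrite -(modcN w); exact: modcD. Qed.

Lemma modc_sub z w : modc z - modc w <= modc (z - w).
Proof. by have := modcD (z - w) w; rewrite subrK; lra. Qed.

Lemma modcM z w : modc (z * w) = modc z * modc w.
Proof. exact: Normc.normcM. Qed.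

Lemma modcV z : modc z^-1 = (modc z)^-1.
Proof. exact: Normc.normcV. Qed.

Lemma modc1 : modc (1 : R[i]) = 1 :> R.
Proof. exact: Normc.normc1. Qed.

Lemma modc0 : modc (0 : R[i]) = 0 :> R.
Proof. exact: Normc.normc0. Qed.

Lemma modc_real (x : R) : modc x%:C = `|x|.
Proof. by rewrite /= expr0n addr0 sqrtr_sqr. Qed.

Lemma modc_eq0 z : (modc z == 0) = (z == 0).
Proof. by apply/eqP/eqP => [/Normc.eq0_normc|->]; rewrite ?modc0. Qed.

Lemma modc_gt0 z : (0 < modc z) = (z != 0).
Proof. by rewrite lt_neqAle modc_ge0 andbT eq_sym modc_eq0. Qed.

Lemma Re_le_modc z : `|complex.Re z| <= modc z.
Proof.
by rewrite -sqrtr_sqr -(ger0_norm (modc_ge0 z)) -sqrtr_sqr ler_wsqrtr // modc_sqr lerDl sqr_ge0.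
Qed.

Lemma Im_le_modc z : `|complex.Im z| <= modc z.
Proof.
by rewrite -sqrtr_sqr -(ger0_norm (modc_ge0 z)) -sqrtr_sqr ler_wsqrtr // modc_sqr lerDr sqr_ge0.
Qed.

Lemma modc_le z : modc z <= `|complex.Re z| + `|complex.Im z|.
Proof.
have h := modc_ge0 z.
rewrite -(@ler_pXn2r _ 2) ?nnegrE ?addr_ge0 // modc_sqr sqrrD !real_normK ?num_real //.
by rewrite lerD2r lerDl mulrn_wge0 // mulr_ge0.
Qed.

Lemma cReM z w : complex.Re (z * w) = complex.Re z * complex.Re w - complex.Im z * complex.Im w.
Proof. by case: z => a b; case: w => c d. Qed.

Lemma cImM z w : complex.Im (z * w) = complex.Re z * complex.Im w + complex.Im z * complex.Re w.
Proof. by case: z => a b; case: w => c d. Qed.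

Lemma cReD z w : complex.Re (z + w) = complex.Re z + complex.Re w.
Proof. by case: z => a b; case: w => c d. Qed.

Lemma cImD z w : complex.Im (z + w) = complex.Im z + complex.Im w.
Proof. by case: z => a b; case: w => c d. Qed.

Lemma cReN z : complex.Re (- z) = - complex.Re z.
Proof. by case: z. Qed.

Lemma cImN z : complex.Im (- z) = - complex.Im z.
Proof. by case: z. Qed.

Lemma complex_eq z w : complex.Re z = complex.Re w -> complex.Im z = complex.Im w -> z = w.
Proof. by case: z => a b; case: w => c d /= -> ->. Qed.

Lemma modc_prod (I : Type) (s : seq I) (F : I -> R[i]) :
  modc (\prod_(i <- s) F i) = \prod_(i <- s) modc (F i).
Proof. by apply: big_morph; [exact: modcM|exact: modc1]. Qed.

End Modulus.

Section ComplexDerivative.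
Context {R : realType}.
Implicit Types (F G : R[i] -> R[i]) (z w h d : R[i]) (e : R).

(** Differentiability of F at z with derivative d, with real error bounds. *)
Definition cdiff F z d := forall e, 0 < e -> exists2 dl : R, 0 < dl &
  forall h, modc h < dl -> modc (F (z + h) - F z - d * h) <= e * modc h.

Definition ccont F z := forall e, 0 < e -> exists2 dl : R, 0 < dl &
  forall h, modc h < dl -> modc (F (z + h) - F z) <= e.

Definition hol F z := exists d, cdiff F z d.

(** Chooses e' so small that a bound by e' times a fixed quantity K becomes a bound by e. *)
Lemma small_factor (K e : R) : 0 <= K -> 0 < e -> exists2 e', 0 < e' & e' * K <= e /\ e' <= e.
Proof.
move=> K0 e0; have K1 : 0 < K + 1 by rewrite ltr_wpDl.
exists (e / (K + 1)); first by rewrite divr_gt0.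
split; first by rewrite mulrAC ler_pdivrMr // ler_pM2l // lerDl.
by rewrite ler_pdivrMr // ler_peMr ?(ltW e0) // lerDr.
Qed.

Lemma cdiff_cst c z : cdiff (fun=> c) z 0.
Proof. by move=> e e0; exists 1 => // h _; rewrite subrr mul0r subr0 modc0 mulr_ge0 ?modc_ge0 // ltW. Qed.

Lemma cdiff_id z : cdiff id z 1.
Proof.
move=> e e0; exists 1 => // h _.
by rewrite [z + h]addrC addrK mul1r subrr modc0 mulr_ge0 ?modc_ge0 // ltW.
Qed.

Lemma cdiff_lip F z d : cdiff F z d -> exists2 dl : R, 0 < dl &
  forall h, modc h < dl -> modc (F (z + h) - F z) <= (modc d + 1) * modc h.
Proof.
move=> /(_ _ ltr01)[dl dl0 H]; exists dl => // h /H H'.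
have := modcD (F (z + h) - F z - d * h) (d * h); rewrite subrK modcM => /le_trans; apply.
by rewrite mulrDl addrC lerD2l.
Qed.

Lemma hol_cont F z : hol F z -> ccont F z.
Proof.
move=> [d /cdiff_lip [dl dl0 H]] e e0.
have [e' e'0 [He' _]] := small_factor (addr_ge0 (modc_ge0 d) ler01) e0.
exists (Num.min dl e'); first by rewrite lt_min dl0.
move=> h; rewrite lt_min => /andP[h1 h2]; apply: le_trans (H _ h1) _.
apply: le_trans He'; rewrite mulrC ler_wpM2r // ?addr_ge0 ?modc_ge0 //; exact: ltW.
Qed.

Lemma cdiffD F G z d d' : cdiff F z d -> cdiff G z d' -> cdiff (fun z => F z + G z) z (d + d').
Proof.
move=> HF HG e e0; have e2 : 0 < e / 2 by rewrite divr_gt0.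
have [a a0 Ha] := HF _ e2; have [b b0 Hb] := HG _ e2.
exists (Num.min a b); first by rewrite lt_min a0.
move=> h; rewrite lt_min => /andP[/Ha ha /Hb hb].
rewrite (_ : _ - _ = (F (z + h) - F z - d * h) + (G (z + h) - G z - d' * h)); last by ring.
by apply: le_trans (modcD _ _) _; rewrite [e]splitr mulrDl; apply: lerD.
Qed.

Lemma cdiffM F G z d d' : cdiff F z d -> cdiff G z d' ->
  cdiff (fun z => F z * G z) z (d * G z + F z * d').
Proof.
move=> HF HG e e0; have e3 : 0 < e / 3 by rewrite divr_gt0.
have [e1 e10 [He1 _]] := small_factor (addr_ge0 (modc_ge0 (G z)) ler01) e3.
have [e2 e20 [He2 _]] := small_factor (modc_ge0 d) e3.
have [e4 e40 [He4 _]] := small_factor (modc_ge0 (F z)) e3.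
have cG := hol_cont (ex_intro _ _ HG).
have [a a0 Ha] := HF _ e10; have [b b0 Hb] := HG _ e40.
have [a' a'0 Ha'] := cG _ e20; have [b' b'0 Hb'] := cG _ ltr01.
exists (Num.min (Num.min a b) (Num.min a' b')); first by rewrite !lt_min a0 b0 a'0.
move=> h; rewrite !lt_min => /andP[/andP[/Ha ha /Hb hb] /andP[/Ha' ha' /Hb' hb']].
rewrite (_ : _ - _ = (F (z + h) - F z - d * h) * G (z + h) + d * h * (G (z + h) - G z)
  + F z * (G (z + h) - G z - d' * h)); last by ring.
apply: le_trans (modcD _ _) _; apply: le_trans (lerD (modcD _ _) (lexx _)) _.
rewrite !modcM.
have h0 := modc_ge0 h.
have -> : e * modc h = e / 3 * modc h + e / 3 * modc h + e / 3 * modc h by field.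
have Gb : modc (G (z + h)) <= modc (G z) + 1 by have := modc_sub (G (z + h)) (G z); lra.
apply: lerD; first apply: lerD.
- apply: le_trans (ler_pM (modc_ge0 _) (modc_ge0 _) ha Gb) _.
  by rewrite mulrAC ler_wpM2r.
- by rewrite mulrAC ler_wpM2r // mulrC (le_trans _ He2) // ler_wpM2r ?modc_ge0.
- apply: le_trans (ler_wpM2l (modc_ge0 _) hb) _.
  by rewrite mulrA ler_wpM2r // mulrC.
Qed.

Lemma cdiff_comp F G z d d' : cdiff G z d' -> cdiff F (G z) d -> cdiff (F \o G) z (d * d').
Proof.
move=> HG HF e e0; have e2 : 0 < e / 2 by rewrite divr_gt0.
have K0 : 0 <= modc d' + 1 by rewrite addr_ge0 ?modc_ge0.
have [e1 e10 [He1 _]] := small_factor K0 e2.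
have [e3 e30 [He3 _]] := small_factor (modc_ge0 d) e2.
have [a a0 Ha] := HF _ e10; have [b b0 Hb] := HG _ e30.
have [c c0 Hc] := cdiff_lip HG.
have [t t0 [Ht _]] := small_factor K0 (divr_gt0 a0 (ltr0Sn _ 1)).
exists (Num.min (Num.min b c) t); first by rewrite !lt_min b0 c0.
move=> h; rewrite !lt_min => /andP[/andP[/Hb hb /Hc hc] ht] /=.
set k := G (z + h) - G z in hb hc.
have -> : G (z + h) = G z + k by rewrite /k; ring.
have ka : modc k < a.
  apply: le_lt_trans hc _; apply: (@le_lt_trans _ _ (a / 2)); last by rewrite ltr_pdivrMr // ltr_pMr // ltr1n.
  by apply: le_trans Ht; rewrite mulrC ler_wpM2r // ltW.
rewrite (_ : _ - _ = (F (G z + k) - F (G z) - d * k) + d * (k - d' * h)); last by ring.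
apply: le_trans (modcD _ _) _; rewrite modcM [e]splitr mulrDl.
have h0 := modc_ge0 h.
apply: lerD.
  apply: le_trans (Ha _ ka) _; apply: le_trans (ler_wpM2l (ltW e10) hc) _.
  by rewrite mulrA ler_wpM2r.
apply: le_trans (ler_wpM2l (modc_ge0 _) hb) _.
by rewrite mulrA ler_wpM2r // mulrC.
Qed.

Lemma cdiff_inv z : z != 0 -> cdiff (fun z => z^-1) z (- (z ^- 2)).
Proof.
move=> z0 e e0; have n0 : 0 < modc z by rewrite modc_gt0.
have n2 : 0 < modc z / 2 by rewrite divr_gt0.
have K0 : 0 < modc z ^+ 2 * (modc z / 2) by rewrite mulr_gt0 // exprn_gt0.
exists (Num.min (modc z / 2) (e * (modc z ^+ 2 * (modc z / 2)))).
  by rewrite lt_min n2 mulr_gt0.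
move=> h; rewrite lt_min => /andP[h1 h2].
have zh : modc z / 2 <= modc (z + h).
  by have := modc_sub z (- h); rewrite opprK modcN; lra.
have zh0 : z + h != 0 by rewrite -modc_gt0 (lt_le_trans n2).
rewrite (_ : _ - _ = h * h * (z ^+ 2 * (z + h))^-1); last by field; rewrite zh0.
rewrite !modcM modcV modcM -mulrA mulrC ler_wpM2r ?modc_ge0 //.
rewrite (_ : modc (z ^+ 2) = modc z ^+ 2); last by rewrite !expr2 modcM.
have K1 : 0 < modc z ^+ 2 * modc (z + h) by rewrite mulr_gt0 ?exprn_gt0 ?modc_gt0.
rewrite ler_pdivrMr //; apply: le_trans (ltW h2) _.
by rewrite ler_pM2l // ler_pM2l ?exprn_gt0.
Qed.

Lemma cdiff_eq F z d d' : cdiff F z d -> d = d' -> cdiff F z d'.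
Proof. by move=> H <-. Qed.

Lemma hol_prod (I : Type) (s : seq I) (F : I -> R[i] -> R[i]) z :
  (forall i, hol (F i) z) -> hol (fun z => \prod_(i <- s) F i z) z.
Proof.
move=> HF; elim: s => [|i s [d IH]].
  exists 0 => e e0; have [dl dl0 H] := cdiff_cst 1 z e0; exists dl => // h hd.
  by rewrite !big_nil; exact: H.
have [d' Hd'] := HF i; eexists => e e0.
have [dl dl0 H] := cdiffM Hd' IH e0; exists dl => // h hd.
by rewrite !big_cons; exact: H.
Qed.

End ComplexDerivative.

Section RealEps.
Context {R : realType}.
Implicit Types (f : R -> R) (x d : R).

Lemma is_derive_eps f x d : is_derive x 1 f d -> forall e, 0 < e ->
  exists2 dl : R, 0 < dl & forall h, `|h| < dl -> `|f (x + h) - f x - d * h| <= e * `|h|.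
Proof.
move=> [fd fE] e e0.
have : (fun h : R => h^-1 *: (f (h *: 1 + x) - f x)) @ 0^' --> d by rewrite -fE; exact: fd.
move=> /cvgrPdist_le /(_ e e0) [dl /= dl0 H]; exists dl => // h hd.
have [->|h0] := eqVneq h 0; first by rewrite addr0 mulr0 !subrr normr0 mulr0.
have /(_ h) := H; rewrite /= sub0r normrN => /(_ hd h0).
rewrite /GRing.scale /= mulr1 => H'.
have -> : f (x + h) - f x - d * h = - (d - h^-1 * (f (h + x) - f x)) * h.
  by rewrite (addrC h x); field.
by rewrite normrM normrN ler_wpM2r.
Qed.

Lemma eps_is_derive (f : R -> R) x d : (forall e, 0 < e ->
  exists2 dl : R, 0 < dl & forall h, `|h| < dl -> `|f (x + h) - f x - d * h| <= e * `|h|) ->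
  is_derive x 1 f d.
Proof.
move=> H.
have cv : (fun h : R => h^-1 *: (f (h *: 1 + x) - f x)) @ 0^' --> d.
  apply/cvgrPdist_le => e e0; have [dl dl0 Hd] := H e e0; exists dl => // h /=.
  rewrite sub0r normrN => hd h0; rewrite /GRing.scale /= mulr1.
  rewrite (_ : d - _ = - ((f (x + h) - f x - d * h) * h^-1)); last by rewrite (addrC h x); field.
  by rewrite normrN normrM normfV ler_pdivrMr ?normr_gt0 //; exact: Hd.
by split; [apply/cvg_ex; exists d|exact/cvg_lim].
Qed.

Lemma continuous_eps f x :
  (forall e, 0 < e -> exists2 dl : R, 0 < dl & forall y, `|y - x| < dl -> `|f y - f x| <= e) ->
  {for x, continuous f}.
Proof.
move=> H; apply/cvgrPdist_le => e e0; have [dl dl0 Hd] := H e e0.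
exists dl => // y /= yx; rewrite distrC; apply: Hd; by rewrite distrC.
Qed.

Lemma eps_continuous f x : {for x, continuous f} ->
  forall e, 0 < e -> exists2 dl : R, 0 < dl & forall y, `|y - x| < dl -> `|f y - f x| <= e.
Proof.
move=> /cvgrPdist_le H e e0; have [dl /= dl0 Hd] := H e e0.
exists dl => // y yx; rewrite distrC; apply: Hd => /=; by rewrite distrC.
Qed.

End RealEps.

(** * The complex exponential and the maximum principle *)

Section ComplexExponential.
Context {R : realType}.
Implicit Types (F : R[i] -> R[i]) (z w h : R[i]) (x y : R).

Definition cis y : R[i] := cos y +i* sin y.
Definition cexp z : R[i] := (expR (complex.Re z))%:C * cis (complex.Im z).

Lemma modc_cis y : modc (cis y) = 1.
Proof. by rewrite /= cos2Dsin2 sqrtr1. Qed.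

Lemma cisD x y : cis (x + y) = cis x * cis y.
Proof. by rewrite /cis cosD sinD; apply: complex_eq; rewrite ?cReM ?cImM /=; ring. Qed.

Lemma cis0 : cis 0 = 1.
Proof. by rewrite /cis cos0 sin0. Qed.

Lemma cis2pi : cis (2 * pi) = 1.
Proof. by rewrite /cis mulr_natl cos2pi sin2pi. Qed.

Lemma cexpD z w : cexp (z + w) = cexp z * cexp w.
Proof.
rewrite /cexp cReD cImD expRD cisD rmorphM /=; ring.
Qed.

Lemma modc_cexp z : modc (cexp z) = expR (complex.Re z).
Proof. by rewrite modcM modc_real modc_cis mulr1 ger0_norm ?expR_ge0. Qed.

Lemma cdiff_cexp0 : cdiff cexp 0 1.
Proof.
move=> e e0; pose e1 := Num.min 1 (e / 5).
have e10 : 0 < e1 by rewrite lt_min ltr01 divr_gt0.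
have e1e : 5 * e1 <= e by rewrite mulrC -ler_pdivlMr // ge_min lexx orbT.
have e11 : e1 <= 1 by rewrite ge_min lexx.
have [a a0 Ha] := is_derive_eps (is_derive_expR 0) e10.
have [b b0 Hb] := is_derive_eps (is_derive_cos 0) e10.
have [c c0 Hc] := is_derive_eps (is_derive_sin 0) e10.
exists (Num.min (Num.min a b) (Num.min c (e1 / 4))).
  by rewrite !lt_min a0 b0 c0 divr_gt0.
move=> h; rewrite !lt_min => /andP[/andP[h1 h2] /andP[h3 h4]].
rewrite add0r mul1r.
have hr := Re_le_modc h; have hi := Im_le_modc h.
set x := complex.Re h in hr *; set y := complex.Im h in hi *.
have {}Ha := Ha _ (le_lt_trans hr h1).
have {}Hb := Hb _ (le_lt_trans hi h2); have {}Hc := Hc _ (le_lt_trans hi h3).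
rewrite !add0r expR0 mul1r in Ha.
rewrite !add0r ?cos0 ?sin0 ?oppr0 ?mul0r ?mul1r ?subr0 ?addr0 in Hb Hc.
have k0 := modc_ge0 h; set k := modc h in hr hi h4 k0 *.
have {}Ha : `|expR x - 1 - x| <= e1 * k by apply: le_trans Ha _; rewrite ler_pM2l.
have {}Hb : `|cos y - 1| <= e1 * k by apply: le_trans Hb _; rewrite ler_pM2l.
have {}Hc : `|sin y - y| <= e1 * k by apply: le_trans Hc _; rewrite ler_pM2l.
have e1k : e1 * k <= k by rewrite ler_piMl.
apply: le_trans (modc_le _) _.
rewrite /cexp /cis !(cReD, cImD, cReM, cImM, cReN, cImN) /= -/x -/y expR0 cos0 sin0.
rewrite !(mul0r, mulr0, mulr1, mul1r, subr0, addr0, oppr0).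
have cy : `|cos y| <= 1 by rewrite ler_norml cos_geN1 cos_le1.
have sy : `|sin y| <= 2 * k by move: Hc hi; rewrite !ler_norml; lra.
have ex1 : `|expR x - 1| <= 2 * k by move: Ha hr; rewrite !ler_norml; lra.
have x1 : `|1 + x| <= 2 by move: hr; rewrite !ler_norml; lra.
have A1 : `|expR x * cos y - 1 - x| <= e1 * k + e1 * k * 2.
  have -> : expR x * cos y - 1 - x = (expR x - 1 - x) * cos y + (cos y - 1) * (1 + x) by ring.
  apply: le_trans (ler_normD _ _) _; rewrite !normrM; apply: lerD.
    by apply: le_trans Ha; rewrite ler_piMr.
  by apply: ler_pM.
have A2 : `|expR x * sin y - y| <= 2 * k * (2 * k) + e1 * k.
  have -> : expR x * sin y - y = (expR x - 1) * sin y + (sin y - y) by ring.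
  apply: le_trans (ler_normD _ _) _; rewrite normrM; apply: lerD => //.
  by apply: ler_pM.
have A3 : 2 * k * (2 * k) <= e1 * k.
  by rewrite (_ : 2 * k * (2 * k) = k * 4 * k) ?ler_wpM2r // -?ler_pdivlMr ?ltW //; ring.
have A4 : 5 * (e1 * k) <= e * k by rewrite mulrA ler_wpM2r.
move: A1 A2; lra.
Qed.

Lemma cdiff_cexp z : cdiff cexp z (cexp z).
Proof.
move=> e e0; have [e1 e10 [He1 _]] := small_factor (modc_ge0 (cexp z)) e0.
have [dl dl0 H] := cdiff_cexp0 e10; exists dl => // h /H.
rewrite add0r mul1r (_ : cexp 0 = 1); last by rewrite /cexp /= expR0 cis0 mulr1.
move=> H'; rewrite cexpD (_ : _ - _ = cexp z * (cexp h - 1 - h)); last by ring.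
rewrite modcM; apply: le_trans (ler_wpM2l (modc_ge0 _) H') _.
by rewrite mulrA ler_wpM2r ?modc_ge0 // mulrC.
Qed.

(** The mean value property along circles only needs continuity at the centre:
    in the coordinate log z the circles become horizontal shifts of one period
    segment, and the centre recedes to infinity. *)
Lemma max_principle F (M : R) : (forall z, 0 < modc z <= 1 -> hol F z) ->
  ccont F 0 -> (forall y, 0 <= y <= 2 * pi -> modc (F (cis y)) <= M) -> modc (F 0) <= M.
Proof.
move=> HF F0 FM; apply/ler_addgt0Pr => e e0.
have M0 : 0 <= M.
  by apply: le_trans (FM 0 _); rewrite ?modc_ge0 // lexx mulr_ge0 ?pi_ge0.
have [->|Fn0] := eqVneq (F 0) 0; first by rewrite modc0 addr_ge0 // ltW.
have mF : 0 < modc (F 0) by rewrite modc_gt0.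
(* The phase c turns F 0 into a positive real, so that real parts suffice. *)
pose c : R[i] := (F 0)^* / (modc (F 0))%:C.
have cF : c * F 0 = (modc (F 0))%:C.
  have -> : c * F 0 = (F 0 * (F 0)^*) / (modc (F 0))%:C by rewrite /c; ring.
  rewrite -sqr_normc expr2 mulfK //.
  by rewrite eq_complex /= negb_and gt_eqF.
have mc : modc c = 1.
  have := congr1 modc cF; rewrite modcM modc_real gtr0_norm // => /eqP.
  by rewrite -subr_eq0 -{2}[modc (F 0)]mul1r -mulrBl mulf_eq0 (gt_eqF mF) orbF subr_eq0 => /eqP.
pose W (x y : R) : R[i] := cexp (x +i* y).
have WE x y : W x y = (expR x)%:C * cis y by [].
have HG x y : x <= 0 -> exists d, cdiff (fun w => c * F (cexp w)) (x +i* y) d.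
  move=> x0; have [|d Hd] := HF (W x y).
    by rewrite modc_cexp /= expR_gt0 -expR0 ler_expR.
  exists (0 * F (cexp (x +i* y)) + c * (d * cexp (x +i* y))).
  by apply: (cdiffM (cdiff_cst c _)); exact: cdiff_comp (cdiff_cexp _) Hd.
(* Truncation at x = 0 only makes G defined and continuous on the whole plane. *)
pose G (x y : R) := c * F (W (Num.min x 0) y).
have Gc (x y : R) : x <= 0 -> forall e, 0 < e -> exists2 dl : R, 0 < dl &
    forall x' y', x' <= 0 -> `|x' - x| + `|y' - y| < dl -> modc (G x' y' - G x y) <= e.
  move=> x0 e' e'0; have [dl dl0 H] := hol_cont (HG x y x0) e'0.
  exists dl => // x' y' x'0 hd; rewrite /G !min_l //.
  have := H ((x' - x) +i* (y' - y)); rewrite /W.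
  have -> : (x +i* y) + ((x' - x) +i* (y' - y)) = x' +i* y' by apply: complex_eq => /=; ring.
  have hh := modc_le ((x' - x) +i* (y' - y)).
  by move=> /(_ (le_lt_trans hh hd)).
have minn x x' : `|Num.min x' 0 - Num.min x 0| <= `|x' - x|.
  rewrite !minEle; case: (lerP x' 0) => h1; case: (lerP x 0) => h2; rewrite ler_norml;
    have := ler_norm (x' - x); have := ler_norm (x - x'); rewrite distrC; lra.
have hmin (u : R) : Num.min u 0 <= 0 by rewrite ge_min lexx orbT.
have cG (p : R[i] -> R) : (forall z w, `|p z - p w| <= modc (z - w)) ->
    (forall x, continuous (fun y => p (G x y))) /\ (forall y, continuous (fun x => p (G x y))).
  move=> hp; split=> u v; apply: continuous_eps => e' e'0.
    have [dl dl0 H] := Gc (Num.min u 0) v (hmin _) e' e'0.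
    exists dl => // y' hy; apply: le_trans (hp _ _) _.
    have := H (Num.min u 0) y' (hmin _); rewrite /G !(min_l (hmin _)); apply.
    by rewrite subrr normr0 add0r.
  have [dl dl0 H] := Gc (Num.min v 0) u (hmin _) e' e'0.
  exists dl => // x' hy; apply: le_trans (hp _ _) _.
  have := H (Num.min x' 0) u (hmin _).
  rewrite /G !(min_l (hmin _)); apply.
  by rewrite subrr normr0 addr0; apply: le_lt_trans (minn _ _) hy.
have hRe z w : `|complex.Re z - complex.Re w| <= modc (z - w).
  by rewrite -cReN -cReD; exact: Re_le_modc.
have hIm z w : `|- complex.Im z - - complex.Im w| <= modc (z - w).
  by rewrite -opprD normrN -cImN -cImD; exact: Im_le_modc.
pose P x y := complex.Re (G x y); pose Q x y := - complex.Im (G x y).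
have [cP _] := cG _ hRe; have [_ cQ] := cG (fun z => - complex.Im z) hIm.
have [dl dl0 Hdl] := F0 e e0.
have [x x0 xdl] : exists2 x : R, x < 0 & expR x < dl.
  exists (ln (Num.min (dl / 2) (1 / 2))).
    apply: ln_lt0; rewrite lt_min divr_gt0 //= divr_gt0 //= gt_min; apply/orP; right; lra.
  rewrite lnK ?posrE ?lt_min ?divr_gt0 // gt_min; apply/orP; left.
  lra.
have pi2 : 0 < 2 * pi :> R by rewrite mulr_gt0 // pi_gt0.
(* The horizontal sides lie a period apart and cancel, so the mean over the circle
   of radius e^x equals the mean over the unit circle. *)
have fl : flux P Q x 0 0 (2 * pi) = 0.
  apply: goursat => // x1 y1 /andP[_ x10] _.
  have [d Hd] := HG x1 y1 x10.
  exists (complex.Re d), (- complex.Im d), (- complex.Im d), (- complex.Re d).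
  split; first by rewrite subrr.
  move=> e' e'0; have [dd dd0 H] := Hd _ e'0; exists (dd / 2); first by rewrite divr_gt0.
  move=> x' y' /andP[_ x'0] _ hx hy.
  have := H ((x' - x1) +i* (y' - y1)).
  have -> : (x1 +i* y1) + ((x' - x1) +i* (y' - y1)) = x' +i* y' by apply: complex_eq => /=; ring.
  have hh := modc_le ((x' - x1) +i* (y' - y1)).
  move=> /(_ (le_lt_trans hh _)) H'.
  have {}H' : modc (G x' y' - G x1 y1 - d * ((x' - x1) +i* (y' - y1))) <= e' * (`|x' - x1| + `|y' - y1|).
    rewrite /G !min_l //; apply: le_trans (H' _) _; last by rewrite ler_pM2l.
    by rewrite /=; lra.
  rewrite /P /Q; move: (G x' y') (G x1 y1) H' => g1 g2 H'; split.
    move: (le_trans (Re_le_modc _) H'); rewrite !cReD !cReN cReM /=.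
    by congr (`|_| <= _); ring.
  move: (le_trans (Im_le_modc _) H'); rewrite -normrN !cImD !cImN cImM /=.
  by congr (`|_| <= _); ring.
have QQ : Q^~ (2 * pi) = Q^~ 0.
  by apply/funext => u; rewrite /Q /G !WE cis2pi cis0.
move: fl; rewrite /flux QQ addrK => /eqP; rewrite subr_eq0 => /eqP PP.
have h1 : integ (P 0) 0 (2 * pi) <= integ (fun=> M) 0 (2 * pi).
  apply: (le_integ (ltW pi2)); first exact: (cP 0).
  - by move=> ?; exact: cvg_cst.
  - move=> y hy; rewrite /P /G min_l // WE expR0 mul1r.
    apply: le_trans (ler_norm _) _; apply: le_trans (Re_le_modc _) _.
    by rewrite modcM mc mul1r; exact: FM.
have h2 : integ (fun=> modc (F 0) - e) 0 (2 * pi) <= integ (P x) 0 (2 * pi).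
  apply: (le_integ (ltW pi2)); first by move=> ?; exact: cvg_cst.
  - exact: (cP x).
  - move=> y _; rewrite /P /G (min_l (ltW x0)) WE.
    set w := _%:C * _.
    have hw : modc w < dl by rewrite modcM modc_cis mulr1 modc_real ger0_norm ?expR_ge0.
    have := Hdl _ hw; rewrite add0r => H.
    have -> : c * F w = (modc (F 0))%:C + c * (F w - F 0) by rewrite -cF; ring.
    rewrite cReD (_ : complex.Re (modc (F 0))%:C = modc (F 0)) //.
    have := Re_le_modc (c * (F w - F 0)).
    rewrite modcM mc mul1r => /le_trans/(_ H).
    by rewrite ler_norml => /andP[]; clear; lra.
rewrite PP in h1; have := le_trans h2 h1; clear - pi2.
by rewrite !integ_cst ?(ltW pi2) // subr0 ler_pM2r //; lra.
Qed.

End ComplexExponential.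

(** * Cauchy estimates *)

Section CauchyEstimates.
Context {R : realType}.
Implicit Types (F G : R[i] -> R[i]) (a z h d : R[i]) (B : R).

Lemma cdiff_local F G z d : (exists2 dl : R, 0 < dl & forall h, modc h < dl -> F (z + h) = G (z + h)) ->
  cdiff F z d -> cdiff G z d.
Proof.
move=> [a a0 FG] HF e e0; have [b b0 H] := HF e e0.
exists (Num.min a b); rewrite ?lt_min ?a0 // => h; rewrite lt_min => /andP[ha hb].
by rewrite -FG // -[X in G X]addr0 -FG ?modc0 // addr0; exact: H.
Qed.

Lemma cdiff_shift F a z d : cdiff F (a + z) d -> cdiff (fun z => F (a + z)) z d.
Proof. by move=> HF e e0; have [dl dl0 H] := HF e e0; exists dl => // h /H; rewrite addrA. Qed.

(** The difference quotient at a, completed by the value d at a, satisfies the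
    hypotheses of the maximum principle. *)
Lemma cauchy_estimate F a d B : (forall z, hol F z) -> cdiff F a d ->
  (forall z, modc (z - a) <= 1 -> modc (F z) <= B) -> modc d <= 2 * B.
Proof.
move=> HF Fd FB.
pose q z := if z == 0 then d else (F (a + z) - F a) * z^-1.
have -> : d = q 0 by rewrite /q eqxx.
apply: max_principle.
- move=> z /andP[z0 _]; have z1 := z0; rewrite modc_gt0 in z1.
  have [d' Fd'] := HF (a + z).
  have := cdiffM (cdiffD (cdiff_shift Fd') (cdiff_cst (- F a) z)) (cdiff_inv z1).
  move=> /(cdiff_local _) H; eexists; apply: H.
  exists (modc z) => // h hz; rewrite /q ifF //; apply/negbTE.
  by rewrite -modc_gt0; have := modc_sub z (- h); rewrite opprK modcN; lra.
- move=> e e0; have [dl dl0 H] := Fd e e0; exists dl => // h hd.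
  rewrite /q add0r eqxx; case: eqVneq => [|h0]; first by rewrite subrr modc0 ltW.
  rewrite (_ : _ - _ = (F (a + h) - F a - d * h) * h^-1); last by field.
  by rewrite modcM modcV ler_pdivrMr ?modc_gt0 //; exact: H.
- move=> y _; rewrite /q; case: eqVneq => [E|_].
    by have := modc_cis y; rewrite E modc0 => /esym/eqP; rewrite oner_eq0.
  rewrite modcM modcV modc_cis invr1 mulr1; apply: le_trans (modcB _ _) _.
  have h1 : modc (F (a + cis y)) <= B by apply: FB; rewrite addrC addKr modc_cis.
  have h2 : modc (F a) <= B by apply: FB; rewrite subrr modc0.
  lra.
Qed.

(** The real mean value theorem for s |-> Re (c * G (s h)), where c is the conjugate
    of G h - G 0: at the ends this function differs by |G h - G 0|^2. *)
Lemma mean_value_bound G (G' : R[i] -> R[i]) h B :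
  (forall s : R, 0 <= s <= 1 -> cdiff G (s%:C * h) (G' (s%:C * h)) /\ modc (G' (s%:C * h)) <= B) ->
  modc (G h - G 0) <= B * modc h.
Proof.
move=> H; have B0 : 0 <= B.
  by have [|_ hB] := H 0; [rewrite lexx ler01|exact: le_trans (modc_ge0 _) hB].
set D := G h - G 0.
have [D0|Dn0] := eqVneq D 0; first by rewrite D0 modc0 mulr_ge0 // modc_ge0.
pose c : R[i] := D^*.
have cD : c * D = (modc D ^+ 2)%:C.
  by rewrite /c mulrC -sqr_normc rmorphXn.
have mc : modc c = modc D.
  by rewrite /c; case: (D) => u v /=; rewrite sqrrN.
pose f (s : R) := complex.Re (c * G (s%:C * h)).
pose df (s : R) := complex.Re (c * (G' (s%:C * h) * h)).
have fd (s : R) : 0 <= s <= 1 -> is_derive s 1 f (df s).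
  move=> hs; have [Gd _] := H s hs.
  have {}Gd : cdiff (fun w => c * G (w * h)) s%:C (0 * G (s%:C * h) + c * (G' (s%:C * h) * (1 * h + s%:C * 0))).
    apply: (cdiffM (cdiff_cst c _)).
    exact: (cdiff_comp (cdiffM (cdiff_id _) (cdiff_cst h _)) Gd).
  apply: eps_is_derive => e e0; have [dl dl0 Hd] := Gd e e0.
  exists dl => // t ht; have := Hd t%:C; rewrite modc_real => /(_ ht).
  rewrite -rmorphD => H1; apply: le_trans H1.
  apply: le_trans (Re_le_modc _); rewrite !cReD !cReN /f /df.
  rewrite le_eqVlt; apply/orP; left; apply/eqP; congr (`|_ - _ - _|).
  rewrite (_ : 0 * _ + _ = c * (G' (s%:C * h) * h)); last by ring.
  by rewrite [RHS]cReM /= mulr0 subr0.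
have [||s] := @MVT R f df 0 1 ltr01.
- by move=> s; rewrite in_itv /= => /andP[s0 s1]; apply: fd; rewrite !ltW.
- by apply: derivable_within_continuous => s; rewrite in_itv /= => /fd [].
rewrite in_itv /= subr0 mulr1 => /andP[s0 s1] E.
have fE : f 1 - f 0 = modc D ^+ 2.
  rewrite /f mul1r mul0r -cReN -cReD -mulrBr -/D cD //.
have : modc D ^+ 2 <= modc D * (B * modc h).
  rewrite -fE E; apply: le_trans (ler_norm _) _; apply: le_trans (Re_le_modc _) _.
  rewrite modcM mc modcM ler_wpM2l ?modc_ge0 // ler_wpM2r ?modc_ge0 //.
  by have [] := H s; rewrite ?(ltW s0) ?(ltW s1).
by rewrite expr2 ler_pM2l ?modc_gt0.
Qed.

Lemma mean_value_bound_at F (F' : R[i] -> R[i]) a h B :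
  (forall s : R, 0 <= s <= 1 -> cdiff F (a + s%:C * h) (F' (a + s%:C * h)) /\
     modc (F' (a + s%:C * h)) <= B) ->
  modc (F (a + h) - F a) <= B * modc h.
Proof.
move=> H; have := @mean_value_bound (fun z => F (a + z)) (fun z => F' (a + z)) h B.
by rewrite addr0; apply => s /H[H1 H2]; split => //; exact: cdiff_shift.
Qed.

(** A quadratic Taylor remainder without second derivatives: the Cauchy
    estimate applied to differences F (z + k) - F z makes F' Lipschitz. *)
Lemma taylor1 F (F' : R[i] -> R[i]) a h B :
  (forall z, cdiff F z (F' z)) -> modc h <= 1 ->
  (forall z, modc (z - a) <= 3 -> modc (F z) <= B) ->
  modc (F (a + h) - F a - F' a * h) <= 4 * B * modc h ^+ 2.
Proof.
move=> Fd h1 FB.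
have holF z : hol F z by exists (F' z).
have B0 : 0 <= B by apply: le_trans (FB a _); rewrite ?modc_ge0 // subrr modc0.
have C1 z : modc (z - a) <= 2 -> modc (F' z) <= 2 * B.
  move=> hz; apply: (cauchy_estimate holF (Fd z)) => w hw; apply: FB.
  by rewrite -(subrKA z); have := modcD (w - z) (z - a); lra.
have C2 k : modc k <= 1 -> modc (F' (a + k) - F' a) <= 4 * B * modc k.
  move=> hk.
  have -> : 4 * B * modc k = 2 * (2 * B * modc k) by ring.
  apply: (@cauchy_estimate (fun z => F (k + z) + -1 * F z) a).
  - move=> z; eexists; apply: cdiffD; first exact: (cdiff_shift (Fd _)).
    exact: (cdiffM (cdiff_cst (-1) _) (Fd z)).
  - have := cdiffD (cdiff_shift (Fd (k + a))) (cdiffM (cdiff_cst (-1) a) (Fd a)).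
    by move/cdiff_eq; apply; rewrite (addrC a k); ring.
  - move=> z hz; rewrite mulN1r (addrC k z).
    apply: (@mean_value_bound_at F F' z k (2 * B)) => s /andP[s0 s1]; split; first exact: Fd.
    apply: C1; rewrite (_ : _ - _ = (z - a) + s%:C * k); last by ring.
    apply: le_trans (modcD _ _) _; rewrite modcM modc_real ger0_norm //.
    have : s * modc k <= 1 by apply: mulr_ile1 => //; exact: modc_ge0.
    by move: hz; lra.
pose G z := F (a + z) + z * (- F' a).
have Gd z : cdiff G z (F' (a + z) - F' a).
  have := cdiffD (cdiff_shift (Fd (a + z))) (cdiffM (cdiff_id z) (cdiff_cst (- F' a) z)).
  by move/cdiff_eq; apply; ring.
have := @mean_value_bound G (fun z => F' (a + z) - F' a) h (4 * B * modc h).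
rewrite /G addr0 mul0r addr0 (_ : 4 * B * modc h * modc h = 4 * B * modc h ^+ 2); last by ring.
rewrite (_ : F (a + h) - F a - F' a * h = F (a + h) + h * - F' a - F a); last by ring.
apply=> s /andP[s0 s1]; split; first exact: Gd.
have sh : modc (s%:C * h) <= modc h by rewrite modcM modc_real ger0_norm // ler_piMl ?modc_ge0.
apply: le_trans (C2 _ (le_trans sh h1)) _.
by rewrite ler_wpM2l // mulr_ge0.
Qed.

End CauchyEstimates.

(** * The function log^+ and integrals of periodic functions *)

Section LogPlus.
Context {R : realType}.
Implicit Types x y : R.

Lemma logp_ge0 x : 0 <= logp x.
Proof. by rewrite /logp le_max lexx orbT. Qed.

Lemma le_expR_logp x : 0 <= x -> x <= expR (logp x).
Proof.
rewrite le_eqVlt => /orP[/eqP <-|x0]; first exact: expR_ge0.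
by rewrite -[X in X <= _]lnK ?posrE // ler_expR /logp le_max lexx.
Qed.

Lemma logp_le x y : 0 <= y -> x <= expR y -> logp x <= y.
Proof.
move=> y0 xy; rewrite /logp ge_max y0 andbT.
have [x0|x0] := leP x 0; first by rewrite ln0.
by rewrite -ler_expR lnK.
Qed.

(** log^+ is 1-Lipschitz because its derivative 1 / x is at most 1 where it is
    not constant; in terms of exponentials, u <= v + |u - v| <= e^(log^+ v) * (1 + |u - v|). *)
Lemma logp_lip x y : 0 <= x -> 0 <= y -> `|logp x - logp y| <= `|x - y|.
Proof.
suff H (u v : R) : 0 <= u -> 0 <= v -> logp u <= logp v + `|u - v|.
  move=> x0 y0; have := H x y x0 y0; have := H y x y0 x0.
  by rewrite (distrC y x) ler_norml; lra.
move=> u0 v0; apply: logp_le; first by rewrite addr_ge0 ?logp_ge0.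
rewrite expRD.
have h1 := le_expR_logp v0; have h2 : 1 <= expR (logp v) by rewrite -expR0 ler_expR logp_ge0.
have h3 : 1 + `|u - v| <= expR `|u - v| by exact: expR_ge1Dx.
apply: (@le_trans _ _ (expR (logp v) * (1 + `|u - v|))); last first.
  by rewrite ler_wpM2l ?expR_ge0.
have : `|u - v| <= expR (logp v) * `|u - v| by rewrite ler_peMl.
by have := ler_norm (u - v); lra.
Qed.

End LogPlus.

Section PeriodicMeans.
Context {R : realType}.
Implicit Types (h : R -> R) (a b c x y e u v p t : R).

Lemma unif_cont_segment h a b e : continuous h -> 0 < e ->
  exists2 dl : R, 0 < dl & forall x t, a <= x <= b -> `|t| < dl -> `|h (x + t) - h x| <= e.
Proof.
move=> ch e0; have /compact_near_coveringP/(_ R (nbhs (0 : R)) (fun t x => `|h (x + t) - h x| <= e)) := segment_compact (a := a) (b := b).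
case=> [x _|dl /= dl0 H].
  have e2 : 0 < e / 2 by rewrite divr_gt0.
  have [dl dl0 H] := eps_continuous (ch x) e2.
  exists (ball x (dl / 2), ball 0 (dl / 2)) => /=; first by split; apply: nbhsx_ballx; rewrite divr_gt0.
  move=> [x' t] /= [hx ht]; rewrite /ball /= in hx ht; rewrite sub0r normrN in ht.
  have h1 : `|h (x' + t) - h x| <= e / 2.
    apply: H; rewrite (_ : _ - _ = t - (x - x')); last by ring.
    by apply: le_lt_trans (ler_normB _ _) _; lra.
  have h2 : `|h x' - h x| <= e / 2 by apply: H; rewrite distrC; lra.
  rewrite (_ : _ - _ = (h (x' + t) - h x) - (h x' - h x)); last by ring.
  by apply: le_trans (ler_normB _ _) _; lra.
exists dl => // x t xab ht; apply: (H t) => /=; first by rewrite sub0r normrN.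
by rewrite in_itv.
Qed.

Lemma integ_shift h a b c : a <= b -> continuous h ->
  integ (fun x => h (x + c)) a b = integ h (a + c) (b + c).
Proof.
move=> ab ch; have [H Hd] := primitive_exists (a + c) ch.
have cc : continuous (fun x => h (x + c)).
  move=> x; apply: (@continuous_comp _ _ _ (fun x => x + c) h); last exact: ch.
  by apply: cvgD; [exact: cvg_id|exact: cvg_cst].
have Kd x : a <= x -> is_derive x 1 (fun x => H (x + c)) (h (x + c)).
  move=> ax; have := Hd (x + c); rewrite lerD2r => /(_ ax) d1.
  have d2 : is_derive x 1 (fun x => x + c) (1 + 0) by apply: is_deriveD.
  by have := @is_derive1_comp _ H (fun x => x + c) x _ _ d1 d2; rewrite addr0 mulr1.
by rewrite (integ_prim cc Kd) // (integ_prim ch Hd) // lerD2r.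
Qed.

Lemma integ_period h p c : 0 < p -> continuous h -> (forall x, h (x + p) = h x) ->
  - p <= c <= p -> integ h c (c + p) = integ h 0 p.
Proof.
move=> p0 ch hp.
have per a b : a <= b -> integ h (a + p) (b + p) = integ h a b.
  by move=> ab; rewrite -integ_shift //; congr integ; apply/funext.
have pos u : 0 <= u <= p -> integ h u (u + p) = integ h 0 p.
  move=> /andP[u0 up].
  rewrite (@integ_cat _ h u p (u + p)) // ?lerDr //.
  have := per 0 u u0; rewrite add0r => ->.
  by rewrite (@integ_cat _ h 0 u p) // addrC.
move=> /andP[c0 cp]; have [c1|c1] := leP 0 c; first by apply: pos; rewrite c1.
have := pos (c + p); rewrite per ?lerDl ?(ltW p0) // => -> //; lra.
Qed.

(** Sampling a periodic function at equally spaced points. *)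
Lemma riemann_sum h e : continuous h -> (forall x, h (x + 2 * pi) = h x) -> 0 < e ->
  exists2 N, (0 < N)%N & forall x, 0 <= x <= 2 * pi ->
    (2 * pi / N%:R) * (\sum_(k < N) h (x + k%:R * (2 * pi / N%:R))) <= integ h 0 (2 * pi) + e * (2 * pi).
Proof.
move=> ch hp e0; have pi2 : 0 < 2 * pi :> R by rewrite mulr_gt0 // pi_gt0.
have [dl dl0 H] := unif_cont_segment 0 (2 * pi + 2 * pi) ch e0.
pose N := (Num.truncn (2 * pi / dl)).+1.
exists N => // x /andP[x0 x2].
set t := 2 * pi / N%:R.
have N0 : 0 < N%:R :> R by rewrite ltr0n.
have t0 : 0 < t by rewrite divr_gt0.
have tdl : t < dl.
  by rewrite /t ltr_pdivrMr // -ltr_pdivrMl // [X in X < _]mulrC; exact: truncnS_gt.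
have Nt : N%:R * t = 2 * pi by rewrite /t mulrC divfK // gt_eqF.
have step k : (k < N)%N -> t * h (x + k%:R * t) <= integ h (x + k%:R * t) (x + k.+1%:R * t) + e * t.
  move=> kN; have E : x + k.+1%:R * t = x + k%:R * t + t by rewrite -natr1; ring.
  have kt : 0 <= k%:R * t by rewrite mulr_ge0 // ltW.
  have kt2 : k%:R * t <= 2 * pi by rewrite -Nt ler_pM2r // ler_nat ltnW.
  have := @le_integ _ (fun=> h (x + k%:R * t) - e) h (x + k%:R * t) (x + k.+1%:R * t).
  rewrite integ_cst E ?lerDl ?(ltW t0) // => /(_ isT _ ch) le.
  suff : (h (x + k%:R * t) - e) * t <= integ h (x + k%:R * t) (x + k%:R * t + t).
    by rewrite mulrBl; lra.
  rewrite [X in _ * X <= _](_ : t = x + k%:R * t + t - (x + k%:R * t)); last by ring.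
  apply: le; first by move=> ?; exact: cvg_cst.
  move=> u /andP[u1 u2].
  have := H (x + k%:R * t) (u - (x + k%:R * t)); rewrite addrCA subrr addr0.
  rewrite ler_norml => hu.
  suff : - e <= h u - h (x + k%:R * t) <= e by lra.
  apply: hu; first by lra.
  by rewrite ger0_norm; lra.
have sum m : (m <= N)%N -> t * (\sum_(k < m) h (x + k%:R * t)) <= integ h x (x + m%:R * t) + e * (m%:R * t).
  elim: m => [|m IH] mN.
    by rewrite big_ord0 !mul0r !mulr0 !addr0 /integ set_itv1 integral_set1.
  rewrite big_ord_recr /= mulrDr.
  have mt : 0 <= m%:R * t by rewrite mulr_ge0 // ltW.
  have E : m.+1%:R * t = m%:R * t + t by rewrite -natr1; ring.
  rewrite (@integ_cat _ h x (x + m%:R * t)) // ?lerDl //; last by rewrite E; lra.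
  have := IH (ltnW mN); have := step m mN; rewrite E mulrDr; lra.
have := sum N (leqnn N); rewrite Nt integ_period //; lra.
Qed.

End PeriodicMeans.

(** * Sub-mean value inequalities for log^+ |G| *)

Section SubMeanValue.
Context {R : realType}.
Implicit Types (F G : R[i] -> R[i]) (a z w : R[i]) (x y : R).

Definition logp_mod G z : R := logp (modc (G z)).

Lemma dist_modc z w : `|modc z - modc w| <= modc (z - w).
Proof.
have h1 := modc_sub z w; have := modc_sub w z; rewrite -(modcN (w - z)) opprB => h2.
by rewrite ler_norml; lra.
Qed.

Lemma circle_continuous G (r : R) : (forall y, hol G (r%:C * cis y)) ->
  continuous (fun y => logp_mod G (r%:C * cis y)).
Proof.
move=> HG y; apply: continuous_eps => e e0.
have W t : cexp (0 +i* t) = cis t by rewrite /cexp /= expR0 mul1r.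
have [d Gd] := HG y; rewrite -W in Gd.
have Hd := cdiff_comp (cdiffM (cdiff_cst r%:C _) (cdiff_cexp (0 +i* y))) Gd.
have [dl dl0 H] := hol_cont (ex_intro _ _ Hd) e0.
exists dl => // y' hy.
have := H (0 +i* (y' - y)).
have -> : modc (0 +i* (y' - y)) = `|y' - y| by rewrite /= expr0n add0r sqrtr_sqr.
rewrite (_ : (0 +i* y) + _ = 0 +i* y'); last by apply: complex_eq => /=; ring.
rewrite /= !W => /(_ hy); apply: le_trans.
by apply: le_trans (logp_lip _ _) (dist_modc _ _); exact: modc_ge0.
Qed.

Lemma cis_period y : cis (y + 2 * pi) = cis y.
Proof. by rewrite cisD cis2pi mulr1. Qed.

(** log |G| at the centre is at most its mean on the unit circle: the
    product of G over N equally spaced rotations is holomorphic, and the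
    maximum principle for it compares |G 0| ^ N with a Riemann sum. *)
Lemma submean_center G : (forall z, modc z <= 1 -> hol G z) ->
  logp_mod G 0 * (2 * pi) <= integ (fun y => logp_mod G (cis y)) 0 (2 * pi).
Proof.
move=> HG; pose h y := logp_mod G (cis y).
have pi2 : 0 < 2 * pi :> R by rewrite mulr_gt0 // pi_gt0.
have ch : continuous h.
  have := @circle_continuous G 1; rewrite (_ : (fun y => _) = h); last first.
    by apply/funext => y; rewrite mul1r.
  by apply=> y; apply: HG; rewrite mul1r modc_cis.
have hp y : h (y + 2 * pi) = h y by rewrite /h cis_period.
have h0 y : 0 <= h y by exact: logp_ge0.
set S := integ h 0 (2 * pi).
have S0 : 0 <= S.
  have := @le_integ _ (fun=> 0) h 0 (2 * pi) (ltW pi2) _ ch; rewrite integ_cst ?(ltW pi2) // mul0r.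
  by apply=> // ?; exact: cvg_cst.
apply/ler_addgt0Pr => e e0.
have e1 : 0 < e / (2 * pi) by rewrite divr_gt0.
have [N N0 HN] := riemann_sum ch hp e1.
rewrite divfK ?gt_eqF // -/S in HN.
set t := 2 * pi / N%:R in HN.
have N0' : 0 < N%:R :> R by rewrite ltr0n.
have t0 : 0 < t by rewrite divr_gt0.
pose H z := \prod_(k < N) G (cis (k%:R * t) * z).
have mrot (k : nat) z : modc (cis (k%:R * t) * z) = modc z by rewrite modcM modc_cis mul1r.
have HH z : modc z <= 1 -> hol H z.
  move=> z1; apply: hol_prod => k; have [|d Gd] := HG (cis (k%:R * t) * z).
    by rewrite mrot.
  eexists; exact: cdiff_comp (cdiffM (cdiff_cst _ _) (cdiff_id z)) Gd.
have H0 : modc (H 0) = modc (G 0) ^+ N.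
  rewrite /H modc_prod (eq_bigr (fun=> modc (G 0))) => [|k _]; last by rewrite mulr0.
  by rewrite prodr_const card_ord.
have MP : modc (H 0) <= expR ((S + e) / t).
  apply: max_principle => [z /andP[_ z1]| |y hy].
  - exact: HH.
  - by apply: hol_cont; apply: HH; rewrite modc0 ler01.
  - apply: (@le_trans _ _ (expR (\sum_(k < N) h (y + k%:R * t)))).
      rewrite expR_sum /H modc_prod; apply: ler_prod => k _; rewrite modc_ge0 /=.
      rewrite /h /logp_mod addrC cisD; apply: le_expR_logp; exact: modc_ge0.
    by rewrite ler_expR ler_pdivlMr // mulrC; exact: HN.
rewrite H0 in MP.
have {}MP : modc (G 0) <= expR ((S + e) / (2 * pi)).
  rewrite -(@ler_pXn2r _ N) ?nnegrE ?modc_ge0 ?expR_ge0 //.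
  apply: le_trans MP _; rewrite -expRM_natl ler_expR /t invf_div le_eqVlt; apply/orP; left.
  by rewrite mulrCA.
rewrite -ler_pdivlMr //; apply: logp_le MP.
by rewrite divr_ge0 ?(ltW pi2) // addr_ge0 // ltW.
Qed.

End SubMeanValue.

Section Moebius.
Context {R : realType}.
Implicit Types (G : R[i] -> R[i]) (z w : R[i]) (x y : R).

Section Angle.
Variable a : R[i].
Hypothesis a3 : modc a <= 1 / 3.
Let al := complex.Re a.
Let be := complex.Im a.

Definition moebius_den_re x : R := 1 + (al * cos x + be * sin x).
Definition moebius_den_im x : R := al * sin x - be * cos x.
Local Notation p := moebius_den_re.
Local Notation q := moebius_den_im.

(** The argument of (e^{ix} + a) / (1 + a^* e^{ix}), as a function on the line. *)
Definition moebius_angle x : R := x - 2 * atan (q x / p x).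

Lemma moebius_denE x : 1 + a^* * cis x = p x +i* q x.
Proof. by rewrite /p /q /al /be; case: a => u v; apply: complex_eq => /=; ring. Qed.

Lemma moebius_den_bound x : 2 / 3 <= p x /\ p x ^+ 2 + q x ^+ 2 <= 16 / 9.
Proof.
have m : modc (a^* * cis x) <= 1 / 3.
  by rewrite modcM modc_cis mulr1; move: a3; case: (a) => u v /=; rewrite sqrrN.
split.
  have := le_trans (Re_le_modc _) m; rewrite ler_norml => /andP[h _].
  rewrite (_ : p x = 1 + complex.Re (a^* * cis x)); first by lra.
  by rewrite /p /al /be; case: a => u v /=; ring.
have : modc (1 + a^* * cis x) <= 4 / 3.
  by apply: le_trans (modcD _ _) _; rewrite modc1; lra.
have h0 := modc_ge0 (1 + a^* * cis x).
move=> h; have := ler_pM h0 h0 h h; rewrite -!expr2 modc_sqr moebius_denE /=; lra.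
Qed.

Lemma moebius_angle_deriv x :
  is_derive x 1 moebius_angle ((1 - (al ^+ 2 + be ^+ 2)) / (p x ^+ 2 + q x ^+ 2)).
Proof.
have [p3 _] := moebius_den_bound x.
have p0 : p x != 0 by rewrite gt_eqF //; lra.
have pd : is_derive x 1 p (- q x).
  have := is_derive_sin x; have := is_derive_cos x => d1 d2.
  by apply: is_derive_eq; rewrite /GRing.scale /= /q; ring.
have qd : is_derive x 1 q (p x - 1).
  have := is_derive_sin x; have := is_derive_cos x => d1 d2.
  by apply: is_derive_eq; rewrite /GRing.scale /= /p; ring.
have pVd := is_deriveV p0 pd.
have td : is_derive x 1 (fun x => q x * (p x)^-1) (q x * (- p x ^- 2 * - q x) + (p x)^-1 * (p x - 1)).
  exact: is_deriveM.
have ad := @is_derive1_comp _ atan (fun x => q x * (p x)^-1) x _ _ (is_derive1_atan _) td.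
have := is_deriveB (is_derive_id x 1) (is_deriveZ 2 ad).
move=> H; apply: (@is_derive_eq _ _ _ _ _ _ _ _ H).
have s0 : p x ^+ 2 + q x ^+ 2 != 0.
  by rewrite gt_eqF // ltr_pwDl ?sqr_ge0 // exprn_even_gt0.
have AE : al ^+ 2 + be ^+ 2 = p x ^+ 2 + q x ^+ 2 - 2 * p x + 1.
  have cs := cos2Dsin2 x.
  have -> : al ^+ 2 + be ^+ 2 = (al ^+ 2 + be ^+ 2) * (cos x ^+ 2 + sin x ^+ 2) by rewrite cs mulr1.
  by rewrite /p /q; ring.
rewrite AE /GRing.scale /=; field.
by rewrite p0 s0.
Qed.

Lemma moebius_angleE x : cis (moebius_angle x) = (cis x + a) / (1 + a^* * cis x).
Proof.
have [p3 _] := moebius_den_bound x.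
have p0 : p x != 0 by rewrite gt_eqF //; lra.
have w0 : 1 + a^* * cis x != 0.
  by rewrite moebius_denE eq_complex /= negb_and p0.
apply: (mulIf w0); rewrite divfK //.
have -> : cis x + a = cis x * (p x -i* q x).
  have cs := cos2Dsin2 x.
  rewrite /p /q /cis [a in LHS]complexE -/al -/be; apply: complex_eq => /=.
    rewrite !(mul0r, mulr0, subr0, add0r, addr0, mul1r).
    have : al * (cos x ^+ 2 + sin x ^+ 2) = al by rewrite cs mulr1.
    lra.
  rewrite !(mul0r, mulr0, subr0, add0r, addr0, mul1r).
  have : be * (cos x ^+ 2 + sin x ^+ 2) = be by rewrite cs mulr1.
  lra.
rewrite moebius_denE /moebius_angle cisD -mulrA; congr (_ * _).
set t := q x / p x; have -> : q x = t * p x by rewrite /t divfK.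
set u := atan t.
have c0 : cos u != 0 by rewrite cos_atan invr_eq0 gt_eqF // sqrtr_gt0 ltr_pwDl // sqr_ge0.
have st : sin u = t * cos u.
  by have := atanK t; rewrite -/u /tan => <-; rewrite divfK.
have cs := cos2Dsin2 u; rewrite st in cs.
have -> : - (2 * u) = - (u + u) by ring.
rewrite /cis cosN sinN cosD sinD st; apply: complex_eq => /=.
  by rewrite -[RHS]mulr1 -cs; ring.
by rewrite -[RHS]mulr1 -cs; ring.
Qed.

Lemma moebius_angle_shift : moebius_angle (0 + 2 * pi) = moebius_angle 0 + 2 * pi.
Proof.
rewrite /moebius_angle /moebius_den_re /moebius_den_im add0r.
by rewrite mulr_natl cos2pi sin2pi cos0 sin0; ring.
Qed.

Lemma moebius_angle_ge x : x - pi <= moebius_angle x.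
Proof. by rewrite /moebius_angle; have := atan_ltpi2 (q x / p x); lra. Qed.

Lemma moebius_angle_le x : moebius_angle x <= x + pi.
Proof. by rewrite /moebius_angle; have := atan_gtNpi2 (q x / p x); lra. Qed.

Lemma moebius_angle_speed x : 1 / 2 <= (1 - (al ^+ 2 + be ^+ 2)) / (p x ^+ 2 + q x ^+ 2).
Proof.
have [p3 pq] := moebius_den_bound x.
have s0 : 0 < p x ^+ 2 + q x ^+ 2 by rewrite ltr_pwDl ?sqr_ge0 // exprn_gt0 //; lra.
rewrite ler_pdivlMr //.
have : modc a ^+ 2 <= (1 / 3) * (1 / 3) by rewrite expr2; apply: ler_pM; rewrite ?modc_ge0.
by rewrite modc_sqr -/al -/be; lra.
Qed.

(** Change of variables: the angle runs through one period at speed at least 1 / 2. *)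
Lemma integ_moebius_le (h : R -> R) : continuous h -> (forall x, h (x + 2 * pi) = h x) -> (forall x, 0 <= h x) ->
  integ (fun x => h (moebius_angle x)) 0 (2 * pi) <= 2 * integ h 0 (2 * pi).
Proof.
move=> ch hp h0.
have pi2 : 0 < 2 * pi :> R by rewrite mulr_gt0 // pi_gt0.
have pi0 : 0 < pi :> R by exact: pi_gt0.
have [H Hd] := primitive_exists (- pi) ch.
pose sp x := (1 - (al ^+ 2 + be ^+ 2)) / (p x ^+ 2 + q x ^+ 2).
have csp : continuous sp.
  move=> x; have [p3 _] := moebius_den_bound x.
  have cp : {for x, continuous p}.
    by apply: cvgD; [exact: cvg_cst|apply: cvgD; apply: cvgM; by [exact: cvg_cst|exact: continuous_cos|exact: continuous_sin]].
  have cq : {for x, continuous q}.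
    by apply: cvgB; apply: cvgM; by [exact: cvg_cst|exact: continuous_cos|exact: continuous_sin].
  apply: cvgM; first exact: cvg_cst.
  apply: cvgV; last by apply: cvgD; apply: cvgM.
  by rewrite gt_eqF // ltr_pwDl ?sqr_ge0 // exprn_gt0 //; lra.
have cang : continuous moebius_angle by move=> x; exact: is_derive_cont (moebius_angle_deriv x).
have chang : continuous (fun x => h (moebius_angle x)).
  by move=> x; apply: (@continuous_comp _ _ _ moebius_angle h); [exact: cang|exact: ch].
have cg : continuous (fun x => 2 * (h (moebius_angle x) * sp x)).
  by move=> x; apply: cvgM; [exact: cvg_cst|apply: cvgM; [exact: chang|exact: csp]].
have gd x : 0 <= x -> is_derive x 1 (fun x => 2 * H (moebius_angle x)) (2 * (h (moebius_angle x) * sp x)).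
  move=> x0; have hx : - pi <= moebius_angle x by have := moebius_angle_ge x; lra.
  have := is_derive1_comp (Hd _ hx) (moebius_angle_deriv x) => dd.
  exact: is_deriveZ.
apply: (@le_trans _ _ (integ (fun x => 2 * (h (moebius_angle x) * sp x)) 0 (2 * pi))).
  apply: le_integ => //; first exact: ltW.
  move=> x _; have := moebius_angle_speed x; rewrite -/(sp x) => spx.
  rewrite mulrCA ler_peMr //; lra.
rewrite (integ_prim cg gd) ?(ltW pi2) // -mulrBr.
rewrite -[2 * pi]add0r moebius_angle_shift add0r.
have lo := moebius_angle_ge 0; have hi := moebius_angle_le 0.
rewrite -(integ_prim ch Hd) ?lerDl ?(ltW pi2) //; last by lra.
rewrite integ_period //; lra.
Qed.

End Angle.

(** The inequality at the centre for G composed with the automorphism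
    (z + a) / (1 + a^* z) of the disc, which maps 0 to a. *)
Lemma submean_unit G a : (forall z, hol G z) -> modc a <= 1 / 3 ->
  logp_mod G a * pi <= integ (fun y => logp_mod G (cis y)) 0 (2 * pi).
Proof.
move=> HG a3.
pose B z := (z + a) * (1 + a^* * z)^-1.
have ma : modc a^* = modc a by case: (a) => u v /=; rewrite sqrrN.
have HB z : modc z <= 1 -> hol (fun z => G (B z)) z.
  move=> z1.
  have w0 : 1 + a^* * z != 0.
    rewrite -modc_gt0; have := modc_sub 1 (- (a^* * z)); rewrite opprK modcN modc1 modcM ma.
    have : modc a * modc z <= 1 / 3 by rewrite -[1 / 3]mulr1; apply: ler_pM => //; exact: modc_ge0.
    lra.
  have D1 := cdiffD (cdiff_cst 1 z) (cdiffM (cdiff_cst a^* z) (cdiff_id z)).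
  have D2 := cdiff_comp D1 (cdiff_inv w0).
  have D3 := cdiffM (cdiffD (cdiff_id z) (cdiff_cst a z)) D2.
  have [d Gd] := HG (B z).
  by eexists; exact: cdiff_comp D3 Gd.
have := submean_center HB.
rewrite (_ : logp_mod _ 0 = logp_mod G a); last by rewrite /logp_mod /B add0r mulr0 addr0 invr1 mulr1.
pose h y := logp_mod G (cis y).
rewrite (_ : (fun y => logp_mod (fun z => G (B z)) (cis y)) = (fun x => h (moebius_angle a x))); last first.
  by apply/funext => y; rewrite /h moebius_angleE.
have ch : continuous h.
  have := @circle_continuous R G 1; rewrite (_ : (fun y => _) = h); last first.
    by apply/funext => y; rewrite mul1r.
  by apply=> y; exact: HG.
have := @integ_moebius_le a a3 h ch _ _.
rewrite /h => /(_ (fun y => _) (fun y => _)) H1 H2.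
have {}H1 : integ (fun x => h (moebius_angle a x)) 0 (2 * pi) <= 2 * integ h 0 (2 * pi).
  by apply: H1 => y; rewrite ?cis_period //; exact: logp_ge0.
have := le_trans H2 H1; rewrite -/h; lra.
Qed.

(** The form in which subharmonicity is used: an off-centre point costs only
    half of the total angle 2 pi. *)
Lemma submean_disc G (r : R) w : (forall z, hol G z) -> 0 < r -> modc w <= r / 3 ->
  logp_mod G w * pi <= integ (fun y => logp_mod G (r%:C * cis y)) 0 (2 * pi).
Proof.
move=> HG r0 wr.
have rC : r%:C != 0 :> R[i] by rewrite -modc_gt0 modc_real gtr0_norm.
have HGr z : hol (fun z => G (r%:C * z)) z.
  have [d Gd] := HG (r%:C * z).
  by eexists; exact: cdiff_comp (cdiffM (cdiff_cst _ _) (cdiff_id z)) Gd.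
have := @submean_unit _ (w / r%:C) HGr.
rewrite {1}/logp_mod mulrCA divff // mulr1; apply.
rewrite modcM modcV modc_real gtr0_norm // ler_pdivrMr //; lra.
Qed.

End Moebius.

(** * Entire functions of several variables *)

Section SeveralVariables.
Context {R : realType} {m : nat}.
Local Notation V := 'rV[R[i]]_m.+1.
Implicit Types (f g : V -> R[i]) (z v : V) (j k : 'I_m.+1) (w h : R[i]) (u : V -> R).

Definition polydisc (s : R) : set V := [set z | forall j, modc (z 0 j) <= s].

Definition set_coord z j w : V := \row_k (if k == j then w else z 0 k).

(** Continuity in the maximum norm of C^m, with real error bounds. *)
Definition cvec_cont f := forall z e, 0 < e -> exists2 dl : R, 0 < dl &
  forall z', (forall j, modc (z' 0 j - z 0 j) < dl) -> modc (f z' - f z) <= e.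

Definition sep_holo f := cvec_cont f /\ forall z j w, hol (fun w => f (set_coord z j w)) w.

Lemma entire_line f z v w : entire (f : V -> R[i]^o) ->
  cdiff (fun s => f (z + s *: v)) w ('D_v (f : V -> R[i]^o) (z + w *: v)).
Proof.
move=> fe e e0; set a := z + w *: v.
have := diff_derivable (v := v) (fe a); rewrite /derivable => /cvgrPdist_le fd.
have e0' : 0 < e%:C :> R[i] by rewrite ltcR.
have [dl /= dl0 H] := fd e%:C e0'.
exists (complex.Re dl); first by move: dl0; rewrite ltcE => /andP[].
move=> h hd; have [->|h0] := eqVneq h 0.
  by rewrite addr0 subrr mulr0 subr0 modc0 mulr0.
have /H/(_ h0) : ball_ Num.norm 0 dl h.
  rewrite /= sub0r normrN; move: dl0; rewrite !ltcE /= => /andP[/eqP -> _]; rewrite eqxx /=; exact: hd.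
rewrite -/('D_v (f : V -> R[i]^o) a) /=.
have -> : z + (w + h) *: v = h *: v + a by rewrite /a scalerDl addrA addrC.
set D := 'D_v _ _; rewrite -/a.
rewrite lecE /= eqxx /= => H1.
have -> : f (h *: v + a) - f a - D * h = - (D - h^-1 * (f (h *: v + a) - f a)) * h.
  by field.
rewrite modcM modcN ler_wpM2r ?modc_ge0 //.
Qed.

Lemma entire_cvec_cont f : entire (f : V -> R[i]^o) -> cvec_cont f.
Proof.
move=> fe z e e0; have /cvgrPdist_le fc := differentiable_continuous (fe z).
have e0' : 0 < e%:C :> R[i] by rewrite ltcR.
have /nbhs_ballP [dl /= dl0 H] := fc e%:C e0'.
exists (complex.Re dl); first by move: dl0; rewrite ltcE => /andP[].
move=> z' hz; have : `|f z - f z'| <= e%:C.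
  apply: H; split=> // i j; rewrite /ball /= ord1; have := hz j; rewrite -modcN opprB => hj.
  by move: dl0; rewrite !ltcE /= => /andP[/eqP -> _]; rewrite eqxx.
by rewrite lecE /= eqxx /= => H1; rewrite -modcN opprB.
Qed.

Lemma set_coordE z j w : set_coord z j w = z + (w - z 0 j) *: delta_mx 0 j.
Proof.
apply/rowP => k; rewrite !mxE eqxx /=; case: eqVneq => [->|_].
  by rewrite mulr1; ring.
by rewrite mulr0 addr0.
Qed.

Lemma entire_sep_holo f : entire (f : V -> R[i]^o) -> sep_holo f.
Proof.
move=> fe; split; first exact: entire_cvec_cont.
move=> z j w; have H := @entire_line f z (delta_mx 0 j) (- z 0 j + w) fe.
eexists => e e0; have [dl dl0 Hd] := cdiff_shift H e0.
exists dl => // h /Hd; rewrite !set_coordE.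
rewrite (_ : - z 0 j + (w + h) = w + h - z 0 j); last by ring.
rewrite (_ : - z 0 j + w = w - z 0 j); last by ring.
exact.
Qed.

(** R[i] seen as a numeric field, the structure that carries its topology. *)
Definition Cnum : numFieldType := R[i].

Lemma square_compact (s : R) : compact [set w : Cnum | `|complex.Re w| <= s /\ `|complex.Im w| <= s].
Proof.
have -> : [set w : Cnum | `|complex.Re w| <= s /\ `|complex.Im w| <= s] =
  (fun p : R * R => p.1 +i* p.2 : Cnum) @` (`[- s, s] `*` `[- s, s]).
  apply/seteqP; split=> [[x y] /= [hx hy]|_ [[x y] /= [hx hy] <-]].
    by exists (x, y) => //=; rewrite !in_itv /= -!ler_norml.
  by move: hx hy; rewrite !in_itv /= -!ler_norml.
apply: continuous_compact; last by apply: compact_setX; exact: segment_compact.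
apply: continuous_subspaceT => -[x y]; apply/cvgrPdist_le => e; rewrite ltcE => /andP[/eqP /= ei er].
have e2 : 0 < complex.Re e / 2 by rewrite divr_gt0.
exists (ball x (complex.Re e / 2), ball y (complex.Re e / 2)) => /=.
  by split; apply: nbhsx_ballx.
move=> [x' y'] /= [hx hy]; rewrite lecE /= ei eqxx /=.
have := @modc_le R ((x - x') +i* (y - y')); rewrite /= => /le_trans; apply.
by rewrite /ball /= in hx hy; lra.
Qed.

Lemma cvec_cont_bounded f (s : R) : cvec_cont f -> exists2 B : R, 0 <= B & forall z, polydisc s z -> modc (f z) <= B.
Proof.
move=> fc.
have := @rV_compact Cnum m.+1 (fun=> [set w : Cnum | `|complex.Re w| <= s /\ `|complex.Im w| <= s]) (fun=> @square_compact s).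
move=> /compact_near_coveringP /(_ R +oo (fun B z => modc (f z) <= B)) []; last first.
  move=> M [_ HM]; exists (Num.max (M + 1) 0); first by rewrite le_max lexx orbT.
  move=> z zs; apply: (HM (Num.max (M + 1) 0)); first by rewrite lt_max ltrDl ltr01.
  by move=> j; split; apply: le_trans (zs j); [exact: Re_le_modc|exact: Im_le_modc].
move=> z _; have [dl dl0 H] := fc z 1 ltr01.
exists ([set z' : V | forall j, modc (z' 0 j - z 0 j) < dl], [set B | modc (f z) + 1 < B]) => /=.
  split.
    exists (fun i j => ball (z i j) (dl%:C : Cnum)) => /=.
      by move=> i j; apply: (@nbhsx_ballx Cnum Cnum (z i j) (dl%:C : Cnum)); rewrite ltcR.
    move=> z' /= hz j; have := hz 0 j; rewrite /ball /= ltcE /= eqxx /= -modcN opprB.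
    exact.
  by exists (modc (f z) + 1); split => //; exact: num_real.
move=> [z' B] /= [hz hB].
have h := H z' hz; by have := modc_sub (f z') (f z); lra.
Qed.

End SeveralVariables.

(** * Separate subharmonicity of log^+ |f| and log^+ |d_j f| *)

Section LogSubharmonic.
Context {R : realType} {m : nat}.
Local Notation V := 'rV[R[i]]_m.+1.
Implicit Types (f g : V -> R[i]) (z v : V) (i j k : 'I_m.+1) (w h : R[i]) (u : V -> R).

Definition rvec_cont u := forall z e, 0 < e -> exists2 dl : R, 0 < dl &
  forall z', (forall j, modc (z' 0 j - z 0 j) < dl) -> `|u z' - u z| <= e.

(** The properties of u = log^+ |f|, for f separately holomorphic, that bound u by its
    integrals over spheres.  Unlike holomorphy of f, they visibly pass to locally
    uniform limits of u. *)
Record sep_subharmonic u : Prop := SepSubharmonic {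
  submean_ge0 : forall z, 0 <= u z;
  submean_cont : rvec_cont u;
  submean_circle : forall z j w (r : R), 0 < r -> modc w <= r / 3 ->
    u (set_coord z j w) * pi <= integ (fun y => u (set_coord z j (r%:C * cis y))) 0 (2 * pi) }.

Lemma cis_close (y e : R) : 0 < e -> exists2 dl : R, 0 < dl &
  forall y', `|y' - y| < dl -> modc (cis y' - cis y) <= e.
Proof.
move=> e0; have W t : cexp (0 +i* t) = cis t :> R[i] by rewrite /cexp /= expR0 mul1r.
have [dl dl0 H] := hol_cont (ex_intro _ _ (cdiff_cexp (0 +i* y))) e0.
exists dl => // y' hy; have := H (0 +i* (y' - y)).
have -> : modc (0 +i* (y' - y)) = `|y' - y| by rewrite /= expr0n add0r sqrtr_sqr.
rewrite (_ : (0 +i* y) + _ = 0 +i* y'); last by apply: complex_eq => /=; ring.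
by rewrite !W; exact.
Qed.

Lemma rvec_cont_circle u z j (r : R) : rvec_cont u -> continuous (fun y => u (set_coord z j (r%:C * cis y))).
Proof.
move=> uc y; apply: continuous_eps => e e0.
have [dl dl0 H] := uc (set_coord z j (r%:C * cis y)) e e0.
have dl2 : 0 < dl / 2 by rewrite divr_gt0.
have [e' e'0 [He _]] := small_factor (normr_ge0 r) dl2.
have [dl' dl'0 H'] := cis_close y e'0.
exists dl' => // y' /H' hy; apply: H => k; rewrite !mxE; case: eqVneq => _.
  rewrite -mulrBr modcM modc_real.
  have : `|r| * modc (cis y' - cis y) <= dl / 2.
    by apply: le_trans He; rewrite mulrC ler_wpM2r.
  lra.
by rewrite subrr modc0.
Qed.

Lemma sep_holo_subharmonic f : sep_holo f -> sep_subharmonic (fun z => logp (modc (f z))).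
Proof.
move=> [fc fh]; split.
- by move=> z; exact: logp_ge0.
- move=> z e e0; have [dl dl0 H] := fc z e e0; exists dl => // z' /H; apply: le_trans.
  by apply: le_trans (logp_lip _ _) (dist_modc _ _); exact: modc_ge0.
- move=> z j w r r0 wr.
  exact: (@submean_disc _ (fun w => f (set_coord z j w)) r w (fh z j) r0 wr).
Qed.

Lemma modc_le_sum z k : modc (z 0 k) <= \sum_j modc (z 0 j).
Proof. by rewrite (bigD1 k) //= lerDl sumr_ge0 // => j _; exact: modc_ge0. Qed.

Lemma polydisc_set_coord z j w (r : R) : modc w <= r -> polydisc (\sum_j modc (z 0 j) + r) (set_coord z j w).
Proof.
move=> wr k; rewrite mxE; have := modc_ge0 w; case: eqVneq => _ w0.
  by rewrite ler_wpDl // sumr_ge0 // => ? _; exact: modc_ge0.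
by apply: le_trans (modc_le_sum z k) _; rewrite lerDl; lra.
Qed.

Lemma sep_subharmonic_limit u : (forall z, 0 <= u z) ->
  (forall s e, 0 < e -> exists2 v, sep_subharmonic v & forall z, polydisc s z -> `|u z - v z| <= e) ->
  sep_subharmonic u.
Proof.
move=> u0 uv.
have uc : rvec_cont u.
  move=> z e e0; have e3 : 0 < e / 3 by rewrite divr_gt0.
  have [v vg H] := uv (\sum_j modc (z 0 j) + 1) _ e3.
  have [dl dl0 Hd] := submean_cont vg z e3.
  exists (Num.min dl 1); first by rewrite lt_min dl0 ltr01.
  move=> z' hz.
  have h1 : `|v z' - v z| <= e / 3 by apply: Hd => j; have := hz j; rewrite lt_min => /andP[].
  have h2 : `|u z - v z| <= e / 3.
    by apply: H => k; apply: le_trans (modc_le_sum z k) _; rewrite lerDl.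
  have h3 : `|u z' - v z'| <= e / 3.
    apply: H => k; have := hz k; rewrite lt_min => /andP[_ hk].
    have := modc_le_sum z k; have := modc_sub (z' 0 k) (z 0 k); lra.
  by move: h1 h2 h3; rewrite !ler_norml; lra.
split=> // z j w r r0 wr; apply/ler_addgt0Pr => e e0.
have pi0 := pi_gt0 R.
have pi2 : 0 <= 2 * pi :> R by lra.
have e3 : 0 < e / (3 * pi) by rewrite divr_gt0 // mulr_gt0.
have E3 : e / (3 * pi) * pi * 3 = e.
  by rewrite -mulrA (mulrC pi) divfK // gt_eqF // mulr_gt0.
set e' := e / (3 * pi) in e3 E3.
have [v vg H] := uv (\sum_j modc (z 0 j) + r) _ e3.
have h1 : `|u (set_coord z j w) - v (set_coord z j w)| <= e'.
  by apply: H; apply: polydisc_set_coord; lra.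
have := submean_circle vg z j r0 wr.
have := @le_integ _ (fun y => v (set_coord z j (r%:C * cis y)))
  (fun y => 1 * u (set_coord z j (r%:C * cis y)) + e' * 1) 0 (2 * pi) pi2.
have cc := @rvec_cont_circle u z j r uc.
have c1 : continuous (fun _ : R => 1 : R) by move=> ?; exact: cvg_cst.
have ci : continuous (fun y => 1 * u (set_coord z j (r%:C * cis y)) + e' * 1).
  move=> y; apply: cvgD; last exact: cvg_cst.
  by apply: cvgM; [exact: cvg_cst|exact: cc].
move=> /(_ (@rvec_cont_circle v z j r (submean_cont vg)) ci).
rewrite integD // integ_cst // => h2 h3.
have {}h2 : integ (fun y => v (set_coord z j (r%:C * cis y))) 0 (2 * pi) <=
    1 * integ (fun y => u (set_coord z j (r%:C * cis y))) 0 (2 * pi) + e' * (1 * (2 * pi - 0)).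
  apply: h2 => y _; have /ler_normlP[]: `|u (set_coord z j (r%:C * cis y)) - v (set_coord z j (r%:C * cis y))| <= e'.
    by apply: H; apply: polydisc_set_coord; rewrite modcM modc_cis mulr1 modc_real gtr0_norm.
  lra.
move: h1; rewrite ler_norml => /andP[_ h1].
have h4 : u (set_coord z j w) * pi <= (v (set_coord z j w) + e') * pi by rewrite ler_pM2r //; lra.
move: h4; rewrite mulrDl; lra.
Qed.

Lemma sep_holo_shift f v : sep_holo f -> sep_holo (fun z => f (z + v)).
Proof.
move=> [fc fh]; split.
  move=> z e e0; have [dl dl0 H] := fc (z + v) e e0; exists dl => // z' hz.
  by apply: H => j; rewrite !mxE opprD addrACA subrr addr0.
move=> z j w; have [d Hd] := fh (z + v) j (v 0 j + w).
exists d; apply: cdiff_local (cdiff_shift Hd); exists 1 => // h _.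
congr f; apply/rowP => k; rewrite !mxE; case: eqVneq => [->|//]; exact: addrC.
Qed.

Lemma sep_holo_lin f g (a : R[i]) : sep_holo f -> sep_holo g -> sep_holo (fun z => (f z + -1 * g z) * a).
Proof.
move=> [fc fh] [gc gh]; split.
  move=> z e e0; have e2 : 0 < e / 2 by rewrite divr_gt0.
  have [e' e'0 [He _]] := small_factor (modc_ge0 a) e2.
  have [dl dl0 H] := fc z e' e'0; have [dl' dl'0 H'] := gc z e' e'0.
  exists (Num.min dl dl'); first by rewrite lt_min dl0.
  move=> z' hz.
  have h1 : modc (f z' - f z) <= e' by apply: H => j; have := hz j; rewrite lt_min => /andP[].
  have h2 : modc (g z' - g z) <= e' by apply: H' => j; have := hz j; rewrite lt_min => /andP[].
  rewrite (_ : _ - _ = (f z' - f z - (g z' - g z)) * a); last by ring.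
  rewrite modcM; apply: le_trans (ler_wpM2r (modc_ge0 a) (modcB _ _)) _.
  apply: (@le_trans _ _ ((e' + e') * modc a)); first by rewrite ler_wpM2r ?modc_ge0 // lerD.
  rewrite mulrDl; lra.
move=> z j w; have [d Hd] := fh z j w; have [d' Hd'] := gh z j w.
eexists; exact: (cdiffM (cdiffD Hd (cdiffM (cdiff_cst (-1) _) Hd')) (cdiff_cst a _)).
Qed.

Definition diff_quot f j h z := (f (z + h *: delta_mx 0 j) + -1 * f z) * h^-1.

(** A locally uniform approximation: the quadratic Taylor remainder is bounded by
    4 B h^2 with B a bound of f on a larger polydisc. *)
Lemma diff_quot_close f j (s e : R) : entire (f : V -> R[i]^o) -> 0 < e ->
  exists h, forall z, polydisc s z -> modc (cpartial j (f : V -> R[i]^o) z - diff_quot f j h z) <= e.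
Proof.
move=> fe e0; have fc := entire_cvec_cont fe.
have [B B0 HB] := cvec_cont_bounded (s + 3) fc.
have e1 : 0 < Num.min e 1 by rewrite lt_min e0 ltr01.
have [t t0 [Ht t1]] := small_factor (mulr_ge0 (ler0n R 4) B0) e1.
move: Ht t1; rewrite !le_min => /andP[Ht _] /andP[_ t1].
have tC : t%:C != 0 :> R[i] by rewrite -modc_gt0 modc_real gtr0_norm.
exists t%:C => z zs.
pose F w := f (z + w *: delta_mx 0 j).
have Fd w : cdiff F w (cpartial j (f : V -> R[i]^o) (z + w *: delta_mx 0 j)) by exact: entire_line.
have := @taylor1 _ F _ 0 t%:C B Fd.
rewrite modc_real gtr0_norm // => /(_ t1); rewrite add0r /F scale0r addr0 => H.
have {}H : modc (f (z + t%:C *: delta_mx 0 j) - f z - cpartial j (f : V -> R[i]^o) z * t%:C) <= 4 * B * t ^+ 2.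
  apply: H => w; rewrite subr0 => hw; apply: HB => k; rewrite !mxE eqxx /=.
  apply: le_trans (modcD _ _) _; apply: lerD; first exact: zs.
  rewrite modcM; case: eqVneq => _; rewrite ?modc1 ?modc0 ?mulr1 ?mulr0 //.
rewrite (_ : _ - _ = - ((f (z + t%:C *: delta_mx 0 j) - f z - cpartial j (f : V -> R[i]^o) z * t%:C) * t%:C^-1)).
  rewrite modcN modcM modcV modc_real gtr0_norm // ler_pdivrMr //.
  apply: le_trans H _; rewrite expr2 mulrA ler_pM2r //; lra.
by rewrite /diff_quot; field.
Qed.

Lemma partial_subharmonic f j : entire (f : V -> R[i]^o) ->
  sep_subharmonic (fun z => logp (modc (cpartial j (f : V -> R[i]^o) z))).
Proof.
move=> fe; apply: sep_subharmonic_limit => [z|s e e0]; first exact: logp_ge0.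
have [h H] := diff_quot_close j s fe e0.
exists (fun z => logp (modc (diff_quot f j h z))).
  apply: sep_holo_subharmonic; have fs := entire_sep_holo fe.
  exact: (sep_holo_lin h^-1 (sep_holo_shift (h *: delta_mx 0 j) fs) fs).
move=> z /H; apply: le_trans.
by apply: le_trans (logp_lip _ _) (dist_modc _ _); exact: modc_ge0.
Qed.

End LogSubharmonic.

(** * Iterated integrals over sequences of parameters *)

Section IteratedIntegral.
Context {R : realType}.
Local Open Scope ereal_scope.
Implicit Types (Psi : seq R -> \bar R) (k : nat).

Local Notation leb := (@lebesgue_measure R).

(** Monotonicity without measurability: the integral of a nonnegative function
    is a supremum over simple functions below it. *)
Lemma le_integralT (f g : R -> \bar R) :
  (forall x, 0 <= f x) -> (forall x, f x <= g x) -> \int[leb]_x f x <= \int[leb]_x g x.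
Proof.
move=> f0 fg; rewrite !ge0_integralTE //; last by move=> x; exact: le_trans (fg x).
by apply: ereal_sup_le => _ [h hf <-]; exists h => // x; exact: le_trans (hf x) (fg x).
Qed.

(** The iterated integral with parameters collected in a sequence, so that peeling
    off a parameter is consing instead of splitting a row vector. *)
Fixpoint iter_seq k Psi : \bar R :=
  if k is k'.+1 then \int[leb]_x iter_seq k' (fun l => Psi (x :: l)) else Psi [::].

Definition row_seq k (p : 'rV[R]_k) : seq R := [seq p ord0 i | i <- enum 'I_k].

Lemma row_seq_cons k (x : R) (y : 'rV[R]_k) :
  row_seq (row_mx (const_mx x : 'rV_1) y) = x :: row_seq y.
Proof.
rewrite /row_seq enum_ordSl /=; congr cons.
  by rewrite mxE; case: splitP => [j _|j /= E]; rewrite ?mxE.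
rewrite -map_comp; apply: eq_map => i /=; rewrite mxE.
case: splitP => [j /= E|j /= E]; first by have := ltn_ord j; rewrite -E ltnS leqn0.
by congr (y _ _); apply: val_inj; move: E; rewrite /bump leq0n !add1n => -[].
Qed.

Lemma iter_integral_seq k Psi : iter_integral (fun p : 'rV[R]_k => Psi (row_seq p)) = iter_seq k Psi.
Proof.
elim: k Psi => [|k IH] Psi /=; first by rewrite /row_seq enum_ord0.
apply: eq_integral => x _; rewrite -IH; congr iter_integral.
by apply/funext => y; rewrite row_seq_cons.
Qed.

Lemma row_seq_nth k (p : 'rV[R]_k.+1) i : (i <= k)%N -> nth 0%R (row_seq p) i = p ord0 (inord i).
Proof.
move=> ik; rewrite /row_seq (nth_map ord0) ?size_enum_ord // ; congr (p _ _).
by apply: val_inj; rewrite /= nth_enum_ord // inordK.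
Qed.

Lemma iter_seq_ge0 k Psi : (forall l, 0 <= Psi l) -> 0 <= iter_seq k Psi.
Proof. by elim: k Psi => [|k IH] Psi H //=; apply: integral_ge0 => x _; exact: IH. Qed.

Lemma le_iter_seq k Psi Psi' : (forall l, 0 <= Psi l) ->
  (forall l, size l = k -> Psi l <= Psi' l) -> iter_seq k Psi <= iter_seq k Psi'.
Proof.
elim: k Psi Psi' => [|k IH] Psi Psi' H0 H /=; first exact: H.
apply: le_integralT => x; first exact: iter_seq_ge0.
by apply: IH => // l lk; apply: H; rewrite /= lk.
Qed.

Lemma eq_iter_seq k Psi Psi' : (forall l, size l = k -> Psi l = Psi' l) ->
  iter_seq k Psi = iter_seq k Psi'.
Proof.
elim: k Psi Psi' => [|k IH] Psi Psi' H /=; first exact: H.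
by apply: eq_integral => x _; apply: IH => l lk; apply: H; rewrite /= lk.
Qed.

(** The domain of integration lies in a cube of volume L^k. *)
Lemma iter_seq_bounded k Psi (B L : R) : (0 <= B)%R -> (0 <= L)%R -> (forall l, 0 <= Psi l) ->
  (forall l, size l = k -> Psi l <= if all (fun x => (0 <= x <= L)%R) l then B%:E else 0) ->
  iter_seq k Psi <= (B * L ^+ k)%:E.
Proof.
elim: k Psi B => [|k IH] Psi B B0 L0 P0 H /=; first by rewrite expr0 mulr1; exact: H [::] erefl.
apply: (@le_trans _ _ (\int[leb]_x ((cst (B * L ^+ k)%:E) \_ `[0%R, L]%classic) x)); last first.
  have mE : leb `[0%R, L]%classic <= L%:E.
    rewrite lebesgue_measure_itv /= lte_fin; case: ifP => _; last by rewrite lee_fin.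
    by rewrite oppr0 adde0.
  rewrite -integral_mkcond integral_cst //; apply: le_trans (lee_wpmul2l _ mE) _.
    by rewrite lee_fin mulr_ge0 // exprn_ge0.
  by rewrite -EFinM lee_fin exprSr mulrA.
apply: le_integralT => x; first exact: iter_seq_ge0.
rewrite patchE mem_setE in_itv /=; case: ifP => hx.
  apply: IH => // l lk; apply: le_trans (H (x :: l) _) _; first by rewrite /= lk.
  by rewrite /= hx.
have := IH (fun l => Psi (x :: l)) 0%R (lexx _) L0; rewrite mul0r; apply=> // l lk.
by apply: le_trans (H (x :: l) _) _; rewrite /= ?lk // hx /=; case: ifP.
Qed.

(** Joint measurability in a parameter and the entries of a sequence, tested on
    measurable families; this form is stable under fixing or adding entries. *)
Definition seq_measurable d (T : measurableType d) k (Phi : T -> seq R -> \bar R) : Prop :=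
  forall d' (T' : measurableType d') (b : T' -> T) (a : nat -> T' -> R),
    measurable_fun setT b -> (forall i, measurable_fun setT (a i)) ->
    measurable_fun setT (fun t => Phi (b t) (mkseq (a^~ t) k)).

Lemma mkseq_cons (A : Type) (f : nat -> A) k : mkseq f k.+1 = f 0%N :: mkseq (fun i => f i.+1) k.
Proof. by rewrite /mkseq /= -[1%N]addn0 iotaDl -map_comp. Qed.

Lemma measurable_iter_seq k d (T : measurableType d) (Phi : T -> seq R -> \bar R) :
  (forall t l, 0 <= Phi t l) -> seq_measurable k Phi ->
  measurable_fun setT (fun t => iter_seq k (Phi t)).
Proof.
elim: k d T Phi => [|k IH] d T Phi P0 H /=.
  by apply: (H d T id (fun _ _ => 0%R)).
pose f (tx : T * R) := iter_seq k (fun l => Phi tx.1 (tx.2 :: l)).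
have mf : measurable_fun setT f.
  apply: (IH _ _ (fun (tx : T * R) l => Phi tx.1 (tx.2 :: l))) => // d' T' b a mb ma.
  have := H d' T' (fst \o b) (fun i => if i is i'.+1 then a i' else snd \o b).
  rewrite (_ : (fun t => _) = (fun t => Phi (b t).1 ((b t).2 :: mkseq (a^~ t) k))).
    by apply; [exact: measurableT_comp measurable_fst mb|case=> // ; exact: measurableT_comp measurable_snd mb].
  by apply/funext => t; rewrite mkseq_cons.
have f0 tx : 0 <= f tx by exact: iter_seq_ge0.
have := @measurable_fun_fubini_tonelli_F _ _ _ _ R leb f mf f0.
exact.
Qed.

(** Tonelli: the outermost variable may be integrated first. *)
Lemma iter_seq_swap k (Phi : R -> seq R -> \bar R) :
  (forall t l, 0 <= Phi t l) -> seq_measurable k Phi ->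
  \int[leb]_x iter_seq k (Phi x) = iter_seq k (fun l => \int[leb]_x Phi x l).
Proof.
elim: k Phi => [|k IH] Phi P0 H //=.
pose f (xy : R * R) := iter_seq k (fun l => Phi xy.1 (xy.2 :: l)).
have mf : measurable_fun setT f.
  apply: (@measurable_iter_seq k _ (R * R)%type (fun xy l => Phi xy.1 (xy.2 :: l))) => // d' T' b a mb ma.
  have := H d' T' (fst \o b) (fun i => if i is i'.+1 then a i' else snd \o b).
  rewrite (_ : (fun t => _) = (fun t => Phi (b t).1 ((b t).2 :: mkseq (a^~ t) k))).
    by apply; [exact: measurableT_comp measurable_fst mb|case=> // ; exact: measurableT_comp measurable_snd mb].
  by apply/funext => t; rewrite mkseq_cons.
have := @fubini_tonelli _ _ _ _ R leb leb f mf (fun xy => iter_seq_ge0 _ (fun l => P0 _ _)).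
rewrite /f /= => ->; apply: eq_integral => y _; apply: IH => // d' T' b a mb ma.
have := H d' T' b (fun i => if i is i'.+1 then a i' else cst y).
rewrite (_ : (fun t => _) = (fun t => Phi (b t) (y :: mkseq (a^~ t) k))).
  by apply => //; case=> // ; exact: measurable_cst.
by apply/funext => t; rewrite mkseq_cons.
Qed.

End IteratedIntegral.

Section ContinuousOfMeasurable.
Context {R : realType} {m : nat} d (T : measurableType d).
Local Notation V := 'rV[R[i]]_m.+1.
Variables (u : V -> R) (x y : 'I_m.+1 -> T -> R).
Hypothesis uc : rvec_cont u.
Hypothesis mx : forall j, measurable_fun setT (x j).
Hypothesis my : forall j, measurable_fun setT (y j).

Let K := {ffun 'I_m.+1 -> int * int}.
Let code N t : K := [ffun j => (Num.floor (x j t * N.+1%:R), Num.floor (y j t * N.+1%:R))].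
Let dec N (c : K) : V := \row_j (((c j).1%:~R / N.+1%:R) +i* ((c j).2%:~R / N.+1%:R)).

Let measurable_floor_eq (f : T -> R) (N : nat) (k : int) : measurable_fun setT f ->
  measurable [set t | Num.floor (f t * N.+1%:R) = k].
Proof.
move=> mf.
have mg : measurable_fun setT (fun t => f t * N.+1%:R).
  by apply: measurable_funM => //; exact: measurable_cst.
have := mg measurableT `[k%:~R, (k + 1)%:~R[%classic (measurable_itv _).
rewrite setTI; congr (measurable _); apply/seteqP; split => t /=.
  by rewrite in_itv /= => h; apply: floor_def.
by move=> <-; rewrite in_itv /=; exact: floor_itv.
Qed.

Let measurable_code N (c : K) : measurable [set t | code N t = c].
Proof.
rewrite (_ : [set t | code N t = c] = \bigcap_(j in [set: 'I_m.+1])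
   ([set t | Num.floor (x j t * N.+1%:R) = (c j).1] `&` [set t | Num.floor (y j t * N.+1%:R) = (c j).2])).
  apply: fin_bigcap_measurable => [|j _]; first exact: finite_finset.
  by apply: measurableI; exact: measurable_floor_eq.
apply/seteqP; split => t /=.
  by move=> <- j _; rewrite ffunE.
by move=> H; apply/ffunP => j; rewrite ffunE; have [-> ->] := H j I; case: (c j).
Qed.

Let measurable_step N : measurable_fun setT (fun t => u (dec N (code N t))).
Proof.
move=> _ Y mY; rewrite setTI.
rewrite (_ : _ @^-1` Y = \bigcup_(c in [set: K]) [set t | code N t = c /\ Y (u (dec N c))]).
  apply: countable_bigcupT_measurable => [|c]; first exact: countableP.
  have [h|h] := pselect (Y (u (dec N c))).
    rewrite (_ : [set t | _] = [set t | code N t = c]); first exact: measurable_code.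
    by apply/seteqP; split => t /= [].
  rewrite (_ : [set t | _] = set0); first exact: measurable0.
  by apply/seteqP; split => t //= [].
apply/seteqP; split => t /= => [h|[c _ [<-]]//].
by exists (code N t).
Qed.

(** Rounding the coordinates to a grid of mesh 1 / N.+1 makes the function
    countably valued. *)
Lemma measurable_rvec_cont : measurable_fun setT (fun t => u (\row_j (x j t +i* y j t))).
Proof.
apply: (measurable_fun_cvg measurable_step) => t _.
apply/cvgrPdist_le => e e0; have [dl dl0 H] := uc (\row_j (x j t +i* y j t)) e0.
have dl2 : 0 < dl / 2 by rewrite divr_gt0.
have := near_infty_natSinv_lt (PosNum dl2); apply: filterS => N /= hN.
rewrite distrC; apply: H => j; rewrite !mxE ffunE /=.
have fl (r : R) : `|(Num.floor (r * N.+1%:R))%:~R / N.+1%:R - r| < dl / 2.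
  have N0 : 0 < N.+1%:R :> R by [].
  apply: le_lt_trans hN.
  rewrite -(ler_pM2r N0) mulVf ?gt_eqF //.
  rewrite -[X in _ * X](gtr0_norm N0) -normrM mulrBl divfK ?gt_eqF //.
  have /andP[h1 h2] := floor_itv (r * N.+1%:R); rewrite intrD in h2.
  rewrite ler_norml; apply/andP; split; lra.
have := modc_le (((Num.floor (x j t * N.+1%:R))%:~R / N.+1%:R - x j t) +i* ((Num.floor (y j t * N.+1%:R))%:~R / N.+1%:R - y j t)).
by move=> /le_lt_trans; apply; have := fl (x j t); have := fl (y j t); rewrite /=; lra.
Qed.

End ContinuousOfMeasurable.

(** * Boxes of polar coordinates *)

Section PolarBox.
Context {R : realType} {n : nat}.
Local Notation V := 'rV[R[i]]_n.+1.
Local Notation leb := (@lebesgue_measure R).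
Implicit Types (u : V -> R) (l : seq R) (s c ws : seq R[i]) (r t th dl : R).

Definition polar r t th : R[i] := (r * Num.sqrt t)%:C * cis th.
Definition vec s : V := \row_j nth 0 s j.

(** The parameters come in pairs (t, theta), one for each coordinate after the first. *)
Fixpoint polar_pairs r l : seq R[i] :=
  if l is t :: th :: l' then polar r t th :: polar_pairs r l' else [::].

Fixpoint in_box dl l : bool :=
  if l is t :: th :: l' then [&& dl < t < 2 * dl, 0 < th < 2 * pi & in_box dl l'] else true.

Lemma integral_open (h : R -> R) a b : a <= b -> continuous h ->
  (\int[leb]_x (if (a < x < b)%R then (h x)%:E else 0) = (integ h a b)%:E)%E.
Proof.
move=> ab ch.
rewrite -integ_fin // (@integral_itv_bndoo R a b (EFin \o h) true false); last first.
  apply/measurable_EFinP; apply: measurable_funTS; exact: continuous_measurable_fun.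
rewrite [RHS]integral_mkcond; apply: eq_integral => x _.
by rewrite patchE mem_setE in_itv.
Qed.

Lemma vec_set_coord c w ws (z : R[i]) (cn : (size c < n.+1)%N) :
  vec (c ++ z :: ws) = set_coord (vec (c ++ w :: ws)) (Ordinal cn) z.
Proof.
apply/rowP => k; rewrite !mxE !nth_cat.
have -> : (k == Ordinal cn) = (k == size c :> nat) by [].
case: ltngtP => //= [kc|-> ]; last by rewrite subnn.
by rewrite -(subnKC kc) addSn -addnS addKn.
Qed.

Lemma subharmonic_polar u (su : sep_subharmonic u) c w ws r t : (size c < n.+1)%N ->
  0 < r * Num.sqrt t -> 3 * modc w <= r * Num.sqrt t ->
  u (vec (c ++ w :: ws)) * pi <= integ (fun th => u (vec (c ++ polar r t th :: ws))) 0 (2 * pi)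
  /\ continuous (fun th => u (vec (c ++ polar r t th :: ws))).
Proof.
move=> cn r0 hw; rewrite (vec_set_coord w ws w cn).
rewrite (_ : (fun th => _) = (fun th => u (set_coord (vec (c ++ w :: ws)) (Ordinal cn) ((r * Num.sqrt t)%:C * cis th)))).
  split; last by apply: rvec_cont_circle; exact: submean_cont.
  by apply: (submean_circle su) => //; lra.
by apply/funext => th; rewrite (vec_set_coord w).
Qed.

(** Induction on the number k of coordinates that still have to be averaged: c lists
    the coordinates already moved to circles, ws the given values of the others.
    Each one contributes 2 pi / 2 = pi from its angle and the length dl of the
    range of its t. *)
Lemma box_lower u (su : sep_subharmonic u) r dl k c ws (K : R) : 0 < r -> 0 < dl -> 0 <= K ->
  (size c + k = n.+1)%N -> size ws = k -> (forall w, w \in ws -> 3 * modc w <= r * Num.sqrt dl) ->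
  ((K * (pi * dl) ^+ k * u (vec (c ++ ws)))%:E <=
  iter_seq (k * 2) (fun l => if in_box dl l then (K * u (vec (c ++ polar_pairs r l)))%:E else 0))%E.
Proof.
move=> r0 dl0; elim: k c ws K => [|k IH] c ws K K0 ck wk hw.
  by rewrite (size0nil wk) /= expr0 mulr1.
case: ws wk hw => // w ws [wk] hw.
have pd : 0 <= pi * dl by rewrite mulr_ge0 ?pi_ge0 // ltW.
have P0 : 0 <= (pi * dl) ^+ k by rewrite exprn_ge0.
have cn : (size c < n.+1)%N by rewrite -ck addnS ltnS leq_addr.
have u0 := submean_ge0 su.
pose M := K * (pi * dl) ^+ k.
have M0 : 0 <= M by rewrite mulr_ge0.
rewrite mulSn /=.
pose z := vec (c ++ w :: ws).
apply: (@le_trans _ _ (\int[leb]_t (if (dl < t < 2 * dl)%R then (M * (u z * pi))%:E else 0))%E).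
  rewrite integral_open //; last 2 first.
  - lra.
  - by move=> ?; exact: cvg_cst.
  rewrite integ_cst; last by lra.
  by rewrite lee_fin -/z exprS /M le_eqVlt; apply/orP; left; apply/eqP; ring.
apply: le_integralT => t.
  by case: ifP => // _; rewrite lee_fin !mulr_ge0 // ?pi_ge0.
case: ifP => [/andP[t1 t2]|_]; last first.
  by apply: integral_ge0 => th _; apply: iter_seq_ge0.
have rt : r * Num.sqrt dl <= r * Num.sqrt t by rewrite ler_pM2l // ler_wsqrtr // ltW.
have rd : 0 < r * Num.sqrt dl by rewrite mulr_gt0 // sqrtr_gt0.
have [sm cont] := @subharmonic_polar u su c w ws r t cn (lt_le_trans rd rt) (le_trans (hw w (mem_head _ _)) rt).
have pi2 : 0 <= 2 * pi :> R by rewrite mulr_ge0 // pi_ge0.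
apply: (@le_trans _ _ (\int[leb]_th (if (0 < th < 2 * pi)%R then (M * u (vec (c ++ polar r t th :: ws)))%:E else 0))%E).
  rewrite (@integral_open (fun th => M * u (vec (c ++ polar r t th :: ws)))) //; last first.
    by move=> th; apply: cvgM; [exact: cvg_cst|exact: cont].
  by rewrite integZ // lee_fin ler_wpM2l.
apply: le_integralT => th.
  by case: ifP => // _; rewrite lee_fin mulr_ge0.
case: ifP => hth; last first.
  by apply: iter_seq_ge0.
have ck' : (size (rcons c (polar r t th)) + k = n.+1)%N by rewrite size_rcons addSn -addnS.
have hw' v : v \in ws -> 3 * modc v <= r * Num.sqrt dl by move=> hv; apply: hw; rewrite inE hv orbT.
have := IH (rcons c (polar r t th)) ws K K0 ck' wk hw'; rewrite cat_rcons -/M => H; apply: (le_trans H).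
rewrite le_eqVlt; apply/orP; left; apply/eqP; apply: eq_iter_seq => l _.
by rewrite cat_rcons.
Qed.

End PolarBox.

(** * Integrals over the sphere *)

Section SphereIntegral.
Context {R : realType} {n : nat}.
Local Notation V := 'rV[R[i]]_n.+1.
Local Notation leb := (@lebesgue_measure R).
Implicit Types (u h : V -> R) (l : seq R) (r t th dl : R) (j : 'I_n.+1).

Definition seq_theta l j : R := nth 0 l (j * 2).
Definition seq_t l j : R :=
  if j == ord0 then 1 - \sum_(k < n) nth 0 l (k * 2).+1 else nth 0 l (j * 2).-1.
Definition seq_point r l : V := \row_j polar r (seq_t l j) (seq_theta l j).
Definition seq_dom l : bool := [forall j, (0 < seq_theta l j < 2 * pi) && (0 < seq_t l j)].

Lemma sph_theta_seq (p : 'rV[R]_(1 + n * 2)) j : sph_theta p j = seq_theta (row_seq p) j.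
Proof. by rewrite /sph_theta /seq_theta row_seq_nth // leq_mul2r /= -ltnS. Qed.

Lemma sph_t_seq (p : 'rV[R]_(1 + n * 2)) j : sph_t p j = seq_t (row_seq p) j.
Proof.
rewrite /sph_t /seq_t; case: eqVneq => [_|j0].
  congr (_ - _); apply: eq_bigr => k _; rewrite row_seq_nth //.
  by have := ltn_ord k; rewrite -(ltn_pmul2r (ltn0Sn 1)).
rewrite row_seq_nth //; apply: (leq_trans (leq_pred _)).
by rewrite leq_mul2r /= -ltnS.
Qed.

Lemma sph_chart_seq r (p : 'rV[R]_(1 + n * 2)) : sph_chart r p = seq_point r (row_seq p).
Proof.
apply/rowP => j; rewrite !mxE sph_theta_seq sph_t_seq.
by apply: complex_eq; rewrite /polar /=; ring.
Qed.

Lemma sph_dom_seq (p : 'rV[R]_(1 + n * 2)) : sph_dom p <-> seq_dom (row_seq p).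
Proof.
split=> [H|/forallP H j].
  by apply/forallP => j; have [h1 h2] := H j; rewrite -sph_theta_seq -sph_t_seq h1 h2.
by have /andP[] := H j; rewrite -sph_theta_seq -sph_t_seq.
Qed.

Lemma sph_integral_seq r h (a : @Defs.form R n.+1 (1 + n * 2)) (c : R) :
  (forall p, sph_dom p -> a (sph_chart r p) (sph_tangent r p) = c) ->
  sph_integral r h a =
  iter_seq (1 + n * 2) (fun l => if seq_dom l then (h (seq_point r l) * c)%:E else 0%E).
Proof.
move=> H; rewrite /sph_integral -iter_integral_seq; congr iter_integral.
apply/funext => p; rewrite patchE; case: ifPn => [|/negP].
  by rewrite inE => hp; rewrite H // sph_chart_seq; move/sph_dom_seq: hp => ->.
by move=> hp; case: ifP => // /sph_dom_seq hp'; case: hp; rewrite inE.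
Qed.

Lemma seq_t_le1 l j : seq_dom l -> seq_t l j <= 1.
Proof.
move=> /forallP H.
have t0 k : 0 < seq_t l k by have /andP[] := H k.
have S : \sum_k seq_t l k = 1.
  rewrite big_ord_recl /seq_t eqxx (eq_bigr (fun k : 'I_n => nth 0 l (k * 2).+1)) ?subrK //.
rewrite -S (bigD1 j) //= lerDl sumr_ge0 // => k _; exact: ltW.
Qed.

Lemma modc_polar r t th : 0 <= r -> modc (polar r t th) = r * Num.sqrt t.
Proof. by move=> r0; rewrite modcM modc_cis mulr1 modc_real ger0_norm // mulr_ge0. Qed.

Lemma sphere_upper r h (B c : R) : 0 <= r -> 0 <= c -> 0 <= B -> (forall z, 0 <= h z) ->
  (forall z, polydisc r z -> h z <= B) ->
  (iter_seq (1 + n * 2) (fun l => if seq_dom l then (h (seq_point r l) * c)%:E else 0%E)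
   <= (B * c * (2 * pi) ^+ (1 + n * 2))%:E)%E.
Proof.
move=> r0 c0 B0 h0 hB; have p2 := pi_ge2 R.
apply: iter_seq_bounded => [||l|l sl]; first by rewrite mulr_ge0.
- by rewrite mulr_ge0 // pi_ge0.
- by case: ifP => // _; rewrite lee_fin mulr_ge0.
case: ifP => hl; last by case: ifP => // _; rewrite lee_fin mulr_ge0.
rewrite ifT.
  rewrite lee_fin ler_wpM2r //; apply: hB => j; rewrite mxE modc_polar //.
  by rewrite ler_piMr // -sqrtr1 ler_wsqrtr // seq_t_le1.
have /forallP H := hl.
apply/(all_nthP 0) => i; rewrite sl => il.
have il2 : (i./2 < n.+1)%N by rewrite ltn_half_double -muln2 mulSn; apply: leq_trans il _.
have Ei := odd_double_half i; move: (i./2) il2 Ei => q il2.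
case: (boolP (odd i)) => oi /= Ei; rewrite -muln2 in Ei.
  have k1 : (q.+1 < n.+1)%N by move: il; rewrite -Ei !add1n !ltnS ltn_pmul2r.
  have E : seq_t l (Ordinal k1) = nth 0 l i by rewrite /seq_t -val_eqE /= -Ei.
  have /andP[_ h2] := H (Ordinal k1); have := seq_t_le1 (Ordinal k1) hl.
  move: h2; rewrite E; lra.
have E : seq_theta l (Ordinal il2) = nth 0 l i by rewrite /seq_theta /= -Ei.
by have /andP[] := H (Ordinal il2); rewrite E; lra.
Qed.

Lemma nth_polar_pairs r l k i : size l = (k * 2)%N -> (i < k)%N ->
  nth 0 (polar_pairs r l) i = polar r (nth 0 l (i * 2)) (nth 0 l (i * 2).+1).
Proof.
elim: k l i => // k IH [|t [|th l]] // [|i] //= [sl] ik.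
exact: IH.
Qed.

Lemma in_box_nth dl l k i : size l = (k * 2)%N -> in_box dl l -> (i < k)%N ->
  dl < nth 0 l (i * 2) < 2 * dl /\ 0 < nth 0 l (i * 2).+1 < 2 * pi.
Proof.
elim: k l i => // k IH [|t [|th l]] // [|i] //= [sl] /and3P[h1 h2 h3] ik //.
exact: IH.
Qed.

(** The value of t_0 on the simplex. *)
Definition rest_t l : R := 1 - \sum_(k < n) nth 0 l (k * 2).

Lemma seq_point_cons r th l : size l = (n * 2)%N ->
  seq_point r (th :: l) = vec (polar r (rest_t l) th :: polar_pairs r l).
Proof.
move=> sl; apply/rowP => j; rewrite !mxE /seq_t /seq_theta.
case: (unliftP ord0 j) => [k ->|->]; last by rewrite eqxx.
by rewrite -val_eqE /= (nth_polar_pairs r sl) ?add0n.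
Qed.

(** The integrand of the spherical integral restricted to the box, with the
    argument theta_0 of the first coordinate split off. *)
Definition slice_fun u r dl (K : R) th l : \bar R :=
  if (0 < th < 2 * pi) && in_box dl l
  then (K * u (vec (polar r (rest_t l) th :: polar_pairs r l)))%:E else 0%E.

Lemma in_box_measurable k dl d (T : measurableType d) (a : nat -> T -> R) :
  (forall i, measurable_fun setT (a i)) ->
  measurable_fun setT (fun t : T => in_box dl (mkseq (a^~ t) (k * 2))).
Proof.
elim: k a => [|k IH] a ma; first exact: measurable_cst.
rewrite (_ : (fun t : T => _) = (fun t : T => (dl < a 0%N t < 2 * dl) && ((0 < a 1%N t < 2 * pi) &&
   in_box dl (mkseq (fun i => a i.+2 t) (k * 2))))); last first.
  by apply/funext => t; rewrite (_ : (k.+1 * 2)%N = (k * 2).+2) // !mkseq_cons.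
have mc (c : R) : measurable_fun setT (fun _ : T => c) by exact: measurable_cst.
apply: measurable_and; first by apply: measurable_and; apply: measurable_fun_ltr.
apply: measurable_and; first by apply: measurable_and; apply: measurable_fun_ltr.
by apply: IH.
Qed.

Lemma slice_fun_measurable u r dl (K : R) : rvec_cont u -> seq_measurable (n * 2) (slice_fun u r dl K).
Proof.
move=> uc d T b a mb ma.
have mc (c : R) : measurable_fun setT (fun _ : T => c) by exact: measurable_cst.
rewrite /slice_fun; apply: measurable_fun_ifT.
- apply: measurable_and; last exact: in_box_measurable.
  by apply: measurable_and; apply: measurable_fun_ltr.
- apply/measurable_EFinP; apply: measurable_funM => //.
  (* The squared radii and arguments of the coordinates; index 0 is the split off one. *)
  pose tt (t : T) j := if unlift ord0 j is Some k then a (k * 2)%N t else 1 - \sum_(k < n) a (k * 2)%N t.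
  pose hh (t : T) j := if unlift ord0 j is Some k then a (k * 2).+1 t else b t.
  pose xx j (t : T) := r * Num.sqrt (tt t j) * cos (hh t j).
  pose yy j (t : T) := r * Num.sqrt (tt t j) * sin (hh t j).
  rewrite (_ : (fun t : T => u _) = (fun t : T => u (\row_j (xx j t +i* yy j t)))); last first.
    apply/funext => t.
    have sz : size (mkseq (a^~ t) (n * 2)) = (n * 2)%N by rewrite size_mkseq.
    have nl i : (i < n * 2)%N -> nth 0 (mkseq (a^~ t) (n * 2)) i = a i t by exact: nth_mkseq.
    move: (mkseq _ _) sz nl => l sz nl.
    congr u; apply/rowP => j; rewrite !mxE /xx /yy /tt /hh.
    case: unliftP => [k ->|->].
      have kn : ((k * 2).+1 < n * 2)%N.
        by rewrite -addn2 -{2}[2%N]mul1n -mulnDl addn1 leq_pmul2r.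
      rewrite [nth _ _ _](_ : _ = nth 0 (polar_pairs r l) k) // (nth_polar_pairs r sz) //.
      rewrite !nl ?(ltnW kn) //.
      by apply: complex_eq; rewrite /polar /=; ring.
    rewrite [nth _ _ _](_ : _ = polar r (rest_t l) (b t)) //.
    rewrite (_ : rest_t l = 1 - \sum_(k < n) a (k * 2)%N t).
      by apply: complex_eq; rewrite /polar /=; ring.
    by congr (_ - _); apply: eq_bigr => k _; rewrite nl // ltn_pmul2r.
  have msqrt (f : T -> R) : measurable_fun setT f -> measurable_fun setT (fun t : T => Num.sqrt (f t)).
    move=> mf; apply: (measurableT_comp _ mf); apply: continuous_measurable_fun.
    exact: sqrt_continuous.
  have mcos (f : T -> R) : measurable_fun setT f -> measurable_fun setT (fun t : T => cos (f t)).
    by move=> mf; apply: (measurableT_comp _ mf); apply: continuous_measurable_fun; exact: continuous_cos.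
  have msin (f : T -> R) : measurable_fun setT f -> measurable_fun setT (fun t : T => sin (f t)).
    by move=> mf; apply: (measurableT_comp _ mf); apply: continuous_measurable_fun; exact: continuous_sin.
  have mt j : measurable_fun setT (tt^~ j).
    rewrite /tt; case: unliftP => [k _|_]; first exact: ma.
    by apply: measurable_funB => //; apply: measurable_sum.
  have mh j : measurable_fun setT (hh^~ j) by rewrite /hh; case: unliftP.
  apply: measurable_rvec_cont => // j; apply: measurable_funM; by
    [apply: measurable_funM => //; exact: msqrt|exact: mcos|exact: msin].
- exact: measurable_cst.
Qed.

(** For small dl the coordinate z_0 takes at least half of the total squared radius. *)
Lemma rest_t_ge l dl : n%:R * (2 * dl) <= 1 / 2 -> size l = (n * 2)%N -> in_box dl l ->
  1 / 2 <= rest_t l.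
Proof.
move=> ndl sl hb; rewrite /rest_t.
have : \sum_(k < n) nth 0 l (k * 2) <= \sum_(k < n) 2 * dl.
  by apply: ler_sum => k _; have [/andP[_ /ltW]] := in_box_nth sl hb (ltn_ord k).
by rewrite sumr_const card_ord -[_ *+ n]mulr_natl; lra.
Qed.

(** The average over the sphere controls u at points of a smaller polydisc: on
    the box where t_1, ..., t_n stay in (dl, 2 dl) all the radii r sqrt t_j
    are at least 3 |w_j|, so the sub-mean value inequality applies in each angle.
    The angle of z_0 is integrated first, since its radius depends on all t_j. *)
Lemma sphere_lower u r dl (c : R) (w : V) : sep_subharmonic u -> 0 < r -> 0 < c -> 0 < dl ->
  dl <= 1 / 2 -> n%:R * (2 * dl) <= 1 / 2 ->
  (forall j, 3 * modc (w 0 j) <= r * Num.sqrt dl) ->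
  ((c * pi * (pi * dl) ^+ n * u w)%:E <=
   iter_seq (1 + n * 2) (fun l => if seq_dom l then (u (seq_point r l) * c)%:E else 0%E))%E.
Proof.
move=> su r0 c0 dl0 dl1 ndl hw.
have u0 := submean_ge0 su; have uc := submean_cont su.
have pi0 := pi_gt0 R.
have S0 th l : (0 <= slice_fun u r dl c th l)%E.
  by rewrite /slice_fun; case: ifP => // _; rewrite lee_fin mulr_ge0 // ltW.
apply: (@le_trans _ _ (\int[leb]_th iter_seq (n * 2) (slice_fun u r dl c th))%E); last first.
  apply: (@le_integralT R) => th; first exact: iter_seq_ge0.
  apply: le_iter_seq => // l sl; rewrite /slice_fun; case: ifP => [/andP[hth hb]|_]; last first.
    by case: ifP => // _; rewrite lee_fin mulr_ge0 // ltW.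
  rewrite seq_point_cons // ifT; first by rewrite mulrC.
  apply/forallP => j; rewrite /seq_theta /seq_t.
  case: (unliftP ord0 j) => [k ->|->].
    have [/andP[h1 h2] h3] := in_box_nth sl hb (ltn_ord k).
    by rewrite -val_eqE /= h3 (lt_trans dl0 h1).
  by rewrite eqxx /= hth /=; have := rest_t_ge ndl sl hb; rewrite /rest_t; lra.
rewrite (iter_seq_swap S0 (slice_fun_measurable _ _ _ uc)).
pose w0 := w 0 ord0; pose ws := [seq w 0 (lift ord0 k) | k <- enum 'I_n].
have wE : w = vec ([:: w0] ++ ws).
  apply/rowP => j; rewrite mxE; case: (unliftP ord0 j) => [k ->|->] //.
  by rewrite [RHS](_ : _ = nth 0 ws k) // /ws (nth_map k) ?size_enum_ord // nth_ord_enum.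
have K0 : 0 <= c * pi by rewrite mulr_ge0 // ltW.
have := @box_lower R n u su r dl n [:: w0] ws (c * pi) r0 dl0 K0 (add1n n).
rewrite size_map size_enum_ord -wE => /(_ erefl).
have hws v : v \in ws -> 3 * modc v <= r * Num.sqrt dl by move=> /mapP[k _ ->].
move=> /(_ hws) /le_trans; apply.
apply: le_iter_seq => l; first by case: ifP => // _; rewrite lee_fin mulr_ge0.
move=> sl; case: ifP => hb; last by apply: integral_ge0.
have rt := rest_t_ge ndl sl hb.
have rr : r * Num.sqrt dl <= r * Num.sqrt (rest_t l).
  by rewrite ler_pM2l // ler_wsqrtr //; lra.
have rd : 0 < r * Num.sqrt dl by rewrite mulr_gt0 // sqrtr_gt0.
have [sm cont] := @subharmonic_polar R n u su [::] w0 (polar_pairs r l) r (rest_t l) isT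
  (lt_le_trans rd rr) (le_trans (hw ord0) rr).
have pi2 : 0 <= 2 * pi :> R by rewrite mulr_ge0 // ltW.
apply: (@le_trans _ _ (\int[leb]_th (if (0 < th < 2 * pi)%R then (c * u (vec ([::] ++ polar r (rest_t l) th :: polar_pairs r l)))%:E else 0))%E).
  rewrite (@integral_open R (fun th => c * u (vec ([::] ++ polar r (rest_t l) th :: polar_pairs r l)))) //; last first.
    by move=> th; apply: cvgM; [exact: cvg_cst|exact: cont].
  by rewrite integZ // lee_fin -mulrA ler_pM2l // mulrC.
rewrite le_eqVlt; apply/orP; left; apply/eqP; apply: eq_integral => th _.
by rewrite /slice_fun hb andbT.
Qed.

End SphereIntegral.

(** * Wedge products of alternating forms *)

Section WedgeAlgebra.
Context {R : realType} {m : nat}.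
Local Notation V := 'rV[R[i]]_m.
Local Notation form := (@Defs.form R m).
Implicit Types (z : V).

Definition set_slot k (v : 'I_k -> V) i (x : V) : 'I_k -> V := fun j => if j == i then x else v j.

Definition slot_additive k (a : form k) z : Prop := forall v i x y,
  a z (set_slot v i (x + y)) = a z (set_slot v i x) + a z (set_slot v i y).

Lemma set_slot_same k (v : 'I_k -> V) i x : set_slot v i x i = x.
Proof. by rewrite /set_slot eqxx. Qed.

Lemma set_slot_id k (v : 'I_k -> V) i : set_slot v i (v i) = v.
Proof. by apply/funext => j; rewrite /set_slot; case: eqVneq => [->|]. Qed.

Lemma set_slot_comp k l (v : 'I_k -> V) (g : 'I_l -> 'I_k) i x : injective g ->
  (fun j => set_slot v (g i) x (g j)) = set_slot (fun j => v (g j)) i x.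
Proof. by move=> gi; apply/funext => j; rewrite /set_slot (inj_eq gi). Qed.

Lemma set_slot_miss k l (v : 'I_k -> V) (g : 'I_l -> 'I_k) i x : (forall j, g j != i) ->
  (fun j => set_slot v i x (g j)) = (fun j => v (g j)).
Proof. by move=> gi; apply/funext => j; rewrite /set_slot (negbTE (gi j)). Qed.

Lemma wedge_slot_additive p q (a : form p) (b : form q) z :
  slot_additive a z -> slot_additive b z -> slot_additive (wedge a b) z.
Proof.
move=> ha hb v i x y; rewrite /wedge -mulrDr -big_split /=; congr (_ * _).
apply: eq_bigr => s _.
have inl : injective (fun j => s (lshift q j)) by move=> ? ? /perm_inj /lshift_inj.
have inr : injective (fun j => s (rshift p j)) by move=> ? ? /perm_inj /rshift_inj.
have -> : i = s ((s^-1)%g i) by rewrite permKV.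
case: (splitP ((s^-1)%g i)) => j E.
  have -> : (s^-1)%g i = lshift q j by apply: val_inj.
  have miss k : s (rshift p k) != s (lshift q j) by rewrite (inj_eq perm_inj) eq_rlshift.
  have L w := @set_slot_comp _ _ v (fun j => s (lshift q j)) j w inl.
  have M w := @set_slot_miss _ _ v (fun j => s (rshift p j)) _ w miss.
  by rewrite (M (x + y)) (M x) (M y) (L (x + y)) (L x) (L y) ha mulrDr mulrDl.
have -> : (s^-1)%g i = rshift p j by apply: val_inj.
have miss k : s (lshift q k) != s (rshift p j) by rewrite (inj_eq perm_inj) eq_lrshift.
have L w := @set_slot_comp _ _ v (fun j => s (rshift p j)) j w inr.
have M w := @set_slot_miss _ _ v (fun j => s (lshift q j)) _ w miss.
by rewrite (M (x + y)) (M x) (M y) (L (x + y)) (L x) (L y) hb mulrDr.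
Qed.

Lemma slot_additive0 k (a : form k) z v i : slot_additive a z -> a z (set_slot v i 0) = 0.
Proof. by move=> /(_ v i 0 0); rewrite addr0 => /eqP; rewrite -subr_eq subrr => /eqP. Qed.

Lemma slot_additive_sum k (a : form k) z v i (I : Type) (r : seq I) (x : I -> V) :
  slot_additive a z -> a z (set_slot v i (\sum_(l <- r) x l)) = \sum_(l <- r) a z (set_slot v i (x l)).
Proof.
move=> ha; elim: r => [|l r IH]; first by rewrite !big_nil slot_additive0.
by rewrite !big_cons ha IH.
Qed.

Lemma wedge_perm p q (a : form p) (b : form q) z v (t : {perm 'I_(p + q)}) :
  wedge a b z (fun i => v (t i)) = (-1) ^+ t * wedge a b z v.
Proof.
rewrite /wedge mulrCA; congr (_ * _); rewrite big_distrr /=.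
rewrite [RHS](reindex_inj (mulIg t)) /=; apply: eq_bigr => s _.
rewrite odd_permM signr_addb !mulrA; congr (_ * _ * _).
- by rewrite [in RHS]mulrAC -[in RHS]expr2 sqrr_sign mul1r.
- by congr (a z _); apply/funext => i; rewrite permM.
- by congr (b z _); apply/funext => i; rewrite permM.
Qed.

(** Antisymmetry under the transposition of the two equal arguments. *)
Lemma wedge_repeat p q (a : form p) (b : form q) z v i j :
  i != j -> v i = v j -> wedge a b z v = 0.
Proof.
move=> ij vij; have := wedge_perm a b z v (tperm i j).
rewrite (_ : (fun k => v (tperm i j k)) = v); last first.
  by apply/funext => k; case: tpermP => [->|->|]//.
by rewrite odd_tperm ij expr1 mulN1r => E; lra.
Qed.

Definition pair_at (b : form 2) z x y : R := b z (fun i => if i == ord0 then x else y).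

(** Every 2-form is a function of its two arguments; this makes the values on pairs
    of vectors the only data on which wedge powers depend. *)
Definition pair_determined (b : form 2) : Prop :=
  forall z v, b z v = pair_at b z (v ord0) (v ord_max).

Lemma wedge_pow_pairs (b : form 2) k z z' (v v' : 'I_(k * 2) -> V) : pair_determined b ->
  (forall i j, pair_at b z (v i) (v j) = pair_at b z' (v' i) (v' j)) ->
  @wedge_pow R m b k z v = @wedge_pow R m b k z' v'.
Proof.
move=> pb; elim: k v v' => [|k IH] v v' H //=.
rewrite /wedge; congr (_ * _); apply: eq_bigr => s _.
by rewrite pb [b z' _]pb H (IH _ (fun i => v' (s (rshift 2 i)))) // => i j; exact: H.
Qed.

Lemma pair_slot_additive (b : form 2) z : pair_determined b ->
  (forall x y w, pair_at b z (x + y) w = pair_at b z x w + pair_at b z y w) ->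
  (forall x y w, pair_at b z w (x + y) = pair_at b z w x + pair_at b z w y) ->
  slot_additive b z.
Proof.
move=> pb h1 h2 v i x y; rewrite !(pb z (set_slot _ _ _)) /set_slot.
have := ltn_ord i; rewrite -!val_eqE /=; case: (val i) => [|[|]] //= _; by rewrite ?h1 ?h2.
Qed.

Lemma wedge_pow_slot_additive (b : form 2) k z : slot_additive b z -> slot_additive (@wedge_pow R m b k) z.
Proof.
move=> hb; elim: k => [|k IH]; first by move=> v [].
exact: wedge_slot_additive.
Qed.

(** A vector in the kernel of b may be replaced by 0 without changing any value of b
    on pairs. *)
Lemma wedge_pow_kernel (b : form 2) k z (v : 'I_(k * 2) -> V) i : pair_determined b -> slot_additive b z ->
  (forall j, pair_at b z (v i) (v j) = 0) -> (forall j, pair_at b z (v j) (v i) = 0) ->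
  @wedge_pow R m b k z v = 0.
Proof.
move=> pb hb h1 h2.
have l0 w : pair_at b z 0 w = 0.
  rewrite /pair_at (_ : (fun i => _) = set_slot (fun=> w) ord0 0) ?slot_additive0 //.
have r0 w : pair_at b z w 0 = 0.
  rewrite /pair_at (_ : (fun i => _) = set_slot (fun=> w) ord_max 0) ?slot_additive0 //.
  apply/funext => j; rewrite /set_slot -!val_eqE /=; have := ltn_ord j.
  by case: (val j) => [|[|]].
rewrite -(slot_additive0 v i (@wedge_pow_slot_additive b k z hb)).
apply: wedge_pow_pairs => // j l; rewrite /set_slot.
case: (eqVneq j i) => [->|_]; first by rewrite l0 h1.
by case: (eqVneq l i) => [->|_]; rewrite ?r0 ?h2.
Qed.

(** When v ord0 lies in the kernel of b, all terms of a wedge b^k vanish except those that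
    put v ord0 into a; so only a (v ord0) and the values of b on pairs matter. *)
Lemma wedge_pow_determined (a : form 1) (b : form 2) k z z' (v v' : 'I_(1 + k * 2) -> V) :
  pair_determined b -> slot_additive b z -> slot_additive b z' ->
  (forall i j, pair_at b z (v i) (v j) = pair_at b z' (v' i) (v' j)) ->
  (forall j, pair_at b z (v ord0) (v j) = 0) -> (forall j, pair_at b z (v j) (v ord0) = 0) ->
  a z (fun=> v ord0) = a z' (fun=> v' ord0) ->
  wedge a (@wedge_pow R m b k) z v = wedge a (@wedge_pow R m b k) z' v'.
Proof.
move=> pb hb hb' H h1 h2 ha; rewrite /wedge; congr (_ * _); apply: eq_bigr => s _.
have W : @wedge_pow R m b k z (fun i => v (s (rshift 1 i))) = @wedge_pow R m b k z' (fun i => v' (s (rshift 1 i))).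
  by apply: wedge_pow_pairs => // i j; exact: H.
rewrite W.
have const (u : 'I_(1 + k * 2) -> V) : (fun i : 'I_1 => u (s (lshift (k * 2) i))) = (fun=> u (s (lshift (k * 2) ord0))).
  by apply/funext => i; rewrite ord1.
rewrite const [in RHS]const.
case: (eqVneq (s (lshift (k * 2) ord0)) ord0) => [->|s0]; first by rewrite ha.
suff -> : @wedge_pow R m b k z' (fun i => v' (s (rshift 1 i))) = 0 by rewrite !mulr0.
case: (splitP ((s^-1)%g ord0)) => j E.
  have E' : (s^-1)%g ord0 = lshift (k * 2) j by apply: val_inj.
  by case/negP: s0; rewrite -[ord0](ord1 j) -E' permKV.
have E' : s (rshift 1 j) = ord0 by rewrite (_ : rshift 1 j = (s^-1)%g ord0) ?permKV //; exact: val_inj.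
by apply: (@wedge_pow_kernel b k z' _ j) => // i; rewrite E' -H ?h1 ?h2.
Qed.

End WedgeAlgebra.

(** * The forms d^c log tau and omega *)

Section LogTauForms.
Context {R : realType} {m : nat}.
Local Notation V := 'rV[R[i]]_m.
Implicit Types (z v w : V) (s d : R).

(** The real inner product, and the standard symplectic form below: with them
    d log tau = 2 rdot z / tau and d^c log tau = rsympl z / (2 pi tau). *)
Definition rdot z v : R :=
  \sum_(j < m) (complex.Re (z 0 j) * complex.Re (v 0 j) + complex.Im (z 0 j) * complex.Im (v 0 j)).
Definition rsympl z v : R :=
  \sum_(j < m) (complex.Re (z 0 j) * complex.Im (v 0 j) - complex.Im (z 0 j) * complex.Re (v 0 j)).

Lemma rderiveE (u : V -> R) z v d :
  is_derive (0 : R) 1 (fun s : R => u (z + s%:C *: v)) d -> rderive u z v = d.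
Proof. by move=> H; rewrite /rderive derive1E; exact: derive_val. Qed.

Lemma Re_line z v s j : complex.Re ((z + s%:C *: v) 0 j) = complex.Re (z 0 j) + s * complex.Re (v 0 j).
Proof. by rewrite !mxE cReD cReM /= mul0r subr0. Qed.

Lemma Im_line z v s j : complex.Im ((z + s%:C *: v) 0 j) = complex.Im (z 0 j) + s * complex.Im (v 0 j).
Proof. by rewrite !mxE cImD cImM /= mul0r addr0. Qed.

Lemma tau_line z v s : tau (z + s%:C *: v) = tau z + s * (2 * rdot z v) + s ^+ 2 * tau v.
Proof.
rewrite /tau /rdot !mulr_sumr -!big_split /=; apply: eq_bigr => j _.
by rewrite Re_line Im_line; ring.
Qed.

Lemma rsympl_line z v w s : rsympl (z + s%:C *: v) w = rsympl z w + s * rsympl v w.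
Proof.
rewrite /rsympl mulr_sumr -big_split /=; apply: eq_bigr => j _.
by rewrite Re_line Im_line; ring.
Qed.

Lemma rderive_log_tau z v : 0 < tau z -> rderive log_tau z v = 2 * rdot z v / tau z.
Proof.
move=> t0; apply: rderiveE.
rewrite (_ : (fun s => _) = (@ln R) \o (fun s => tau z + s * (2 * rdot z v) + s ^+ 2 * tau v)); last first.
  by apply/funext => s; rewrite /log_tau tau_line.
have H : is_derive (0 : R) 1 (fun s : R => tau z + s * (2 * rdot z v) + s ^+ 2 * tau v) (2 * rdot z v).
  by apply: is_derive_eq; rewrite /GRing.scale /=; ring.
have e0 : tau z + 0 * (2 * rdot z v) + 0 ^+ 2 * tau v = tau z by ring.
have L : is_derive (tau z + 0 * (2 * rdot z v) + 0 ^+ 2 * tau v) 1 (@ln R) (tau z)^-1.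
  by rewrite e0; exact: is_derive1_ln.
have := @is_derive1_comp R (@ln R) (fun s => tau z + s * (2 * rdot z v) + s ^+ 2 * tau v) 0 _ _ L H.
by rewrite [(tau z)^-1 * _]mulrC.
Qed.

Lemma dc_log_tau z (v : 'I_1 -> V) : 0 < tau z -> dc log_tau z v = rsympl z (v ord0) / (2 * pi * tau z).
Proof.
move=> t0; rewrite /dc /delbar /del -sumrB.
have pi0 := pi_gt0 R.
have half : (2 : R[i])^-1 = (2^-1)%:C by rewrite fmorphV /= rmorphMn.
have four : ((4 * pi)%:C : R[i])^-1 = ((4 * pi)^-1)%:C by rewrite fmorphV.
rewrite four /rsympl mulr_suml mulr_sumr raddf_sum /=.
apply: eq_bigr => j _.
have rx : rdot z (delta_mx 0 j) = complex.Re (z 0 j).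
  rewrite /rdot (bigD1 j) //= big1 => [|k kj].
    by rewrite !mxE !eqxx /=; ring.
  by rewrite !mxE (negbTE kj) /=; ring.
have ry : rdot z ('i%C *: delta_mx 0 j) = complex.Im (z 0 j).
  rewrite /rdot (bigD1 j) //= big1 => [|k kj].
    by rewrite !mxE !eqxx /=; ring.
  by rewrite !mxE (negbTE kj) /=; ring.
rewrite /wirtinger /wirtinger_bar !rderive_log_tau // rx ry half.
move: (@pi R) pi0 => P P0.
case: (z 0 j) => x y; case: (v ord0 0 j) => a b /=; field.
by rewrite !gt_eqF.
Qed.

Lemma tau_pos_line z v : 0 < tau z -> exists2 dl : R, 0 < dl & forall s, `|s| < dl -> 0 < tau (z + s%:C *: v).
Proof.
move=> t0; pose f (s : R) := tau z + s * (2 * rdot z v) + s ^+ 2 * tau v.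
have H : is_derive (0 : R) 1 f (2 * rdot z v).
  by apply: is_derive_eq; rewrite /GRing.scale /=; ring.
have e2 : 0 < tau z / 2 by rewrite divr_gt0.
have [dl dl0 Hd] := eps_continuous (is_derive_cont H) e2.
exists dl => // s hs; rewrite tau_line -/(f s).
have := Hd s; rewrite subr0 => /(_ hs); rewrite ler_norml => /andP[h _].
have : f 0 = tau z by rewrite /f; ring.
lra.
Qed.

Lemma is_derive_local (f g : R -> R) (x d dl : R) : 0 < dl ->
  (forall h, `|h| < dl -> f (x + h) = g (x + h)) -> is_derive x 1 f d -> is_derive x 1 g d.
Proof.
move=> dl0 fg /is_derive_eps H; apply: eps_is_derive => e e0.
have [b b0 Hb] := H e e0; exists (Num.min dl b); first by rewrite lt_min dl0.
move=> h; rewrite lt_min => /andP[h1 h2]; rewrite -fg //.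
by have := fg 0; rewrite normr0 addr0 => <- //; exact: Hb.
Qed.

Lemma rderive_dc z v w : 0 < tau z ->
  rderive (fun x => dc log_tau x (fun=> w)) z v =
  (rsympl v w / tau z - rsympl z w * (2 * rdot z v) / tau z ^+ 2) / (2 * pi).
Proof.
move=> t0; apply: rderiveE; have [dl dl0 Hd] := tau_pos_line v t0.
have pi0 := pi_gt0 R.
pose f (s : R) := tau z + s * (2 * rdot z v) + s ^+ 2 * tau v.
apply: (@is_derive_local (fun s => (rsympl z w + s * rsympl v w) * (f s)^-1 * (2 * pi)^-1) _ _ _ dl dl0).
  move=> h hd; rewrite add0r dc_log_tau; last exact: Hd.
  by rewrite rsympl_line tau_line -/(f h) [in RHS]invfM [RHS]mulrA [RHS]mulrAC.
have f0 : f 0 = tau z by rewrite /f; ring.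
have fn0 : f 0 != 0 by rewrite f0 gt_eqF.
have H : is_derive (0 : R) 1 f (2 * rdot z v).
  by apply: is_derive_eq; rewrite /GRing.scale /=; ring.
have HV := is_deriveV fn0 H.
have HN : is_derive (0 : R) 1 (fun s : R => rsympl z w + s * rsympl v w) (rsympl v w).
  by apply: is_derive_eq; rewrite /GRing.scale /=; ring.
have K1 : is_derive (0 : R) 1 (fun s : R => (rsympl z w + s * rsympl v w) * (f s)^-1) _ :=
  is_deriveM HN HV.
have K2 : is_derive (0 : R) 1 (fun s : R => (rsympl z w + s * rsympl v w) * (f s)^-1 * (2 * pi)^-1) _ :=
  is_deriveM K1 (is_derive_cst (2 * pi)^-1 (0 : R) 1).
move: K2; set D := (X in is_derive _ _ _ X -> _) => K2.
suff E : D = (rsympl v w / tau z - rsympl z w * (2 * rdot z v) / tau z ^+ 2) / (2 * pi) by rewrite -E.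
rewrite /D.
move: (@pi R) pi0 => P P0; rewrite /GRing.scale /= f0 mul0r addr0; field.
by rewrite !gt_eqF.
Qed.

Definition pair_omega := pair_at (@omega R m).

Lemma omega_pair_determined : pair_determined (@omega R m).
Proof. by []. Qed.

Lemma omegaE z v w : 0 < tau z -> pair_omega z v w =
  (rsympl v w / tau z - rsympl z w * (2 * rdot z v) / tau z ^+ 2) / (2 * pi) -
  (rsympl w v / tau z - rsympl z v * (2 * rdot z w) / tau z ^+ 2) / (2 * pi).
Proof. by move=> t0; rewrite /pair_omega /pair_at /omega /ext_d /= !rderive_dc. Qed.

Lemma rdotDr z v w : rdot z (v + w) = rdot z v + rdot z w.
Proof. by rewrite /rdot -big_split /=; apply: eq_bigr => j _; rewrite !mxE cReD cImD; ring. Qed.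

Lemma rsymplDr z v w : rsympl z (v + w) = rsympl z v + rsympl z w.
Proof. by rewrite /rsympl -big_split /=; apply: eq_bigr => j _; rewrite !mxE cReD cImD; ring. Qed.

Lemma rsymplC v w : rsympl w v = - rsympl v w.
Proof. by rewrite /rsympl -sumrN; apply: eq_bigr => j _; ring. Qed.

Lemma omega_slot_additive z : 0 < tau z -> slot_additive (@omega R m) z.
Proof.
move=> t0; apply: (pair_slot_additive omega_pair_determined) => x y w; rewrite -/pair_omega !omegaE //.
  by rewrite ![rsympl _ w]rsymplC !rsymplDr !rdotDr; ring.
by rewrite ![rsympl _ w]rsymplC !rsymplDr !rdotDr; ring.
Qed.

Lemma dc_slot_additive z : 0 < tau z -> slot_additive (dc (@log_tau R m)) z.
Proof.
move=> t0 v i x y; rewrite !dc_log_tau // /set_slot (ord1 i) eqxx rsymplDr mulrDl //.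
Qed.

(** On tangent vectors of the sphere the terms with d log tau vanish. *)
Lemma omega_tangent z v w : 0 < tau z -> rdot z v = 0 -> rdot z w = 0 ->
  pair_omega z v w = rsympl v w / (pi * tau z).
Proof.
move=> t0 zv zw; rewrite omegaE // zv zw (rsymplC v w); have := pi_gt0 R; move: (@pi R) => P P0; field.
by rewrite !gt_eqF.
Qed.

End LogTauForms.

(** * The density of sigma in the chart *)

Section SphereDensity.
Context {R : realType} {n : nat}.
Local Notation V := 'rV[R[i]]_n.+1.
Local Notation P := 'rV[R]_(1 + n * 2).
Implicit Types (p v : P) (r s : R) (j l : 'I_n.+1) (a b : 'I_n.+1 -> R).

(** The differential of t_j; it does not depend on the point since t_j is affine
    in the parameters. *)
Definition sph_dt v j : R :=
  if j == ord0 then - \sum_(k < n) v 0 (inord (k * 2).+1) else v 0 (inord (j * 2).-1).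

Lemma sph_theta_line p v s j : sph_theta (p + s *: v) j = sph_theta p j + s * sph_theta v j.
Proof. by rewrite /sph_theta !mxE. Qed.

Lemma sph_t_line p v s j : sph_t (p + s *: v) j = sph_t p j + s * sph_dt v j.
Proof.
rewrite /sph_t /sph_dt; case: eqVneq => _; last by rewrite !mxE.
rewrite (eq_bigr (fun k : 'I_n => p 0 (inord (k * 2).+1) + s * v 0 (inord (k * 2).+1))); last first.
  by move=> k _; rewrite !mxE.
by rewrite big_split /= -mulr_sumr; ring.
Qed.

Lemma derive_along_line (f : P -> R) p v (d : R) :
  is_derive (0 : R) 1 (fun s : R => f (p + s *: v)) d -> 'D_v f p = d.
Proof.
move=> [H1 H2].
have E : (fun h : R => h^-1 *: ((f \o shift p) (h *: v) - f p)) =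
    (fun h : R => h^-1 *: (((fun s : R => f (p + s *: v)) \o shift (0 : R)) (h *: (1 : R)) - f (p + (0 : R) *: v))).
  apply/funext => h /=; congr (_ *: (f _ - f _)); last by rewrite scale0r addr0.
  by rewrite addr0 /GRing.scale /= mulr1 addrC.
by rewrite -H2 /derive E.
Qed.

(** The tangent vector with components a_j along d/dt_j and b_j along d/dtheta_j,
    treating all the t_j as independent. *)
Definition polar_tangent r p a b : V := \row_j
  ((r * (a j / (2 * Num.sqrt (sph_t p j)) * cos (sph_theta p j)
         - Num.sqrt (sph_t p j) * sin (sph_theta p j) * b j)) +i*
   (r * (a j / (2 * Num.sqrt (sph_t p j)) * sin (sph_theta p j)
         + Num.sqrt (sph_t p j) * cos (sph_theta p j) * b j))).

Lemma sph_tangentE r p k : sph_dom p ->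
  sph_tangent r p k = polar_tangent r p (sph_dt (delta_mx 0 k)) (sph_theta (delta_mx 0 k)).
Proof.
move=> pd; apply/rowP => j; rewrite !mxE; set v := delta_mx 0 k.
have [_ t0] := pd j.
have Dt : is_derive (0 : R) 1 (fun s : R => Num.sqrt (sph_t p j + s * sph_dt v j))
    ((2 * Num.sqrt (sph_t p j))^-1 * sph_dt v j).
  have d1 : is_derive (0 : R) 1 (fun s : R => sph_t p j + s * sph_dt v j) (sph_dt v j).
    by apply: is_derive_eq; rewrite /GRing.scale /=; ring.
  have d2 : is_derive (sph_t p j + 0 * sph_dt v j) 1 Num.sqrt (2 * Num.sqrt (sph_t p j))^-1.
    by rewrite mul0r addr0; exact: is_derive1_sqrt.
  exact: (@is_derive1_comp R Num.sqrt (fun s => sph_t p j + s * sph_dt v j) 0 _ _ d2 d1).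
have Dth : is_derive (0 : R) 1 (fun s : R => sph_theta p j + s * sph_theta v j) (sph_theta v j).
  by apply: is_derive_eq; rewrite /GRing.scale /=; ring.
have Dc : is_derive (0 : R) 1 (fun s : R => cos (sph_theta p j + s * sph_theta v j))
    (- sin (sph_theta p j) * sph_theta v j).
  have d2 : is_derive (sph_theta p j + 0 * sph_theta v j) 1 cos (- sin (sph_theta p j)).
    by rewrite mul0r addr0; exact: is_derive_cos.
  exact: (@is_derive1_comp R cos (fun s => sph_theta p j + s * sph_theta v j) 0 _ _ d2 Dth).
have Ds : is_derive (0 : R) 1 (fun s : R => sin (sph_theta p j + s * sph_theta v j))
    (cos (sph_theta p j) * sph_theta v j).
  have d2 : is_derive (sph_theta p j + 0 * sph_theta v j) 1 sin (cos (sph_theta p j)).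
    by rewrite mul0r addr0; exact: is_derive_sin.
  exact: (@is_derive1_comp R sin (fun s => sph_theta p j + s * sph_theta v j) 0 _ _ d2 Dth).
congr (_ +i* _); apply: derive_along_line.
  rewrite (_ : (fun s => _) = (fun s => r * (Num.sqrt (sph_t p j + s * sph_dt v j) *
      cos (sph_theta p j + s * sph_theta v j)))); last first.
    by apply/funext => s; rewrite !mxE sph_t_line sph_theta_line /= mulrA.
  apply: is_derive_eq; rewrite /GRing.scale /= !mul0r !addr0; ring.
rewrite (_ : (fun s => _) = (fun s => r * (Num.sqrt (sph_t p j + s * sph_dt v j) *
    sin (sph_theta p j + s * sph_theta v j)))); last first.
  by apply/funext => s; rewrite !mxE sph_t_line sph_theta_line /= mulrA.
apply: is_derive_eq; rewrite /GRing.scale /= !mul0r !addr0; ring.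
Qed.

Lemma sum_sph_dt v : \sum_j sph_dt v j = 0.
Proof.
rewrite big_ord_recl /sph_dt eqxx (eq_bigr (fun k : 'I_n => v 0 (inord (k * 2).+1))) ?addNr //.
Qed.

Lemma sum_sph_t p : \sum_j sph_t p j = 1.
Proof.
rewrite big_ord_recl /sph_t eqxx (eq_bigr (fun k : 'I_n => p 0 (inord (k * 2).+1))) ?subrK //.
Qed.

Section AtPoint.
Variables (r : R) (p : P).
Hypotheses (r0 : 0 < r) (pd : sph_dom p).
Let z := sph_chart r p.

Let q0 j : Num.sqrt (sph_t p j) != 0.
Proof. by rewrite gt_eqF // sqrtr_gt0; have [] := pd j. Qed.
Let q2 j : Num.sqrt (sph_t p j) ^+ 2 = sph_t p j.
Proof. by rewrite sqr_sqrtr // ltW //; have [] := pd j. Qed.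

Lemma tau_chart : tau z = r ^+ 2.
Proof.
rewrite /tau -[RHS]mulr1 -(sum_sph_t p) mulr_sumr; apply: eq_bigr => j _.
rewrite !mxE /= -[in RHS](q2 j) -[RHS]mulr1 -[X in _ = _ * X](cos2Dsin2 (sph_theta p j)); ring.
Qed.

Lemma rdot_chart a b : rdot z (polar_tangent r p a b) = r ^+ 2 / 2 * \sum_j a j.
Proof.
rewrite /rdot mulr_sumr; apply: eq_bigr => j _.
rewrite !mxE /= -[RHS]mulr1 -[X in _ = _ * X](cos2Dsin2 (sph_theta p j)); have := q0 j.
move: (Num.sqrt _) (cos _) (sin _) => q c s hq; field; exact: hq.
Qed.

Lemma rsympl_chart a b : rsympl z (polar_tangent r p a b) = r ^+ 2 * \sum_j sph_t p j * b j.
Proof.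
rewrite /rsympl mulr_sumr; apply: eq_bigr => j _.
rewrite !mxE /= -[in RHS](q2 j) -[RHS]mulr1 -[X in _ = _ * X](cos2Dsin2 (sph_theta p j)); have := q0 j.
move: (Num.sqrt _) (cos _) (sin _) => q c s hq; field; exact: hq.
Qed.

Lemma rsympl_tangent a b a' b' : rsympl (polar_tangent r p a b) (polar_tangent r p a' b') =
  r ^+ 2 / 2 * \sum_j (a j * b' j - b j * a' j).
Proof.
rewrite /rsympl mulr_sumr; apply: eq_bigr => j _.
rewrite !mxE /= -[RHS]mulr1 -[X in _ = _ * X](cos2Dsin2 (sph_theta p j)); have := q0 j.
move: (Num.sqrt _) (cos _) (sin _) => q c s hq; field; exact: hq.
Qed.

Let t0 : 0 < tau z. Proof. by rewrite tau_chart exprn_gt0. Qed.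

Lemma omega_chart a b a' b' : \sum_j a j = 0 -> \sum_j a' j = 0 ->
  pair_omega z (polar_tangent r p a b) (polar_tangent r p a' b') =
  (\sum_j (a j * b' j - b j * a' j)) / (2 * pi).
Proof.
move=> ha ha'; rewrite omega_tangent ?rdot_chart ?ha ?ha' ?mulr0 // rsympl_tangent tau_chart.
have := pi_gt0 R; move: (@pi R) => Pi Pi0; field; by rewrite !gt_eqF.
Qed.

(** The vector i z, generator of the circle action that turns all the angles. *)
Definition reeb := polar_tangent r p (fun=> 0) (fun=> 1).

Lemma reeb_sum : reeb = \sum_(l < n.+1) sph_tangent r p (inord (l * 2)).
Proof.
have ol l : (l * 2 < 1 + n * 2)%N by rewrite add1n ltnS leq_mul2r -ltnS ltn_ord.
have dtl l j : sph_dt (delta_mx 0 (inord (l * 2)) : P) j = 0.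
  have odd_ne k : (k.*2.+1 < 1 + n * 2)%N ->
      (inord k.*2.+1 : 'I_(1 + n * 2)) == inord (l * 2) = false.
    move=> hk; apply/negP => /eqP /(congr1 val); rewrite /= !inordK // => /(congr1 odd).
    by rewrite muln2 /= !odd_double.
  rewrite /sph_dt; case: (unliftP ord0 j) => [k ->|->].
    have -> : (lift ord0 k == ord0) = false by [].
    rewrite mxE eqxx (_ : (lift ord0 k * 2).-1 = k.*2.+1); last by rewrite lift0 muln2.
    rewrite odd_ne //.
    by rewrite add1n !ltnS -muln2 (leq_trans _ (leq_mul (ltn_ord k) (leqnn 2))) // mulSn ltnW.
  rewrite eqxx big1 ?oppr0 // => k _; rewrite mxE eqxx (muln2 k) odd_ne //.
  by rewrite -muln2 add1n !ltnS; have := leq_mul (ltn_ord k) (leqnn 2); rewrite mulSn; exact: ltnW.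
have dthl l j : sph_theta (delta_mx 0 (inord (l * 2)) : P) j = (j == l)%:R.
  rewrite /sph_theta mxE eqxx andTb -val_eqE /= (inordK (ol j)) (inordK (ol l)).
  by rewrite eqn_pmul2r.
apply/rowP => j; rewrite summxE (bigD1 j) //= big1 => [|l lj].
  rewrite addr0 sph_tangentE // !mxE dtl dthl eqxx.
  by apply: complex_eq => /=; ring.
rewrite sph_tangentE // !mxE dtl dthl eq_sym (negbTE lj).
by apply: complex_eq => /=; ring.
Qed.

(** The first tangent vector d/dtheta_0 differs from i z by the other d/dtheta_l,
    which are already among the arguments. *)
Lemma sigma_reeb : sigma z (sph_tangent r p) =
  wedge (dc log_tau) (@wedge_pow R n.+1 omega n) z (set_slot (sph_tangent r p) ord0 reeb).
Proof.
have W : slot_additive (wedge (dc log_tau) (@wedge_pow R n.+1 omega n)) z.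
  apply: wedge_slot_additive; first exact: dc_slot_additive.
  apply: wedge_pow_slot_additive; exact: omega_slot_additive.
rewrite reeb_sum slot_additive_sum // (bigD1 ord0) //= big1 => [|l l0].
  rewrite addr0 (_ : inord (0 * 2) = ord0) ?set_slot_id //.
  by apply: val_inj; rewrite /= inordK.
have ol : (l * 2 < 1 + n * 2)%N by rewrite add1n ltnS leq_mul2r -ltnS ltn_ord.
apply: (@wedge_repeat R n.+1 1 (n * 2) _ _ _ _ ord0 (inord (l * 2))).
  by rewrite -val_eqE /= inordK // eq_sym muln_eq0 orbF.
by rewrite set_slot_same /set_slot; case: ifP.
Qed.

(** The components along d/dt_j and d/dtheta_j of the arguments of sigma once the
    first of them is replaced by i z: none of them depends on the point. *)
Definition slot_a (k : 'I_(1 + n * 2)) : 'I_n.+1 -> R :=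
  if k == ord0 then (fun=> 0) else sph_dt (delta_mx 0 k).
Definition slot_b (k : 'I_(1 + n * 2)) : 'I_n.+1 -> R :=
  if k == ord0 then (fun=> 1) else sph_theta (delta_mx 0 k).

Lemma sum_slot_a k : \sum_j slot_a k j = 0.
Proof. by rewrite /slot_a; case: ifP => _; [rewrite big1|exact: sum_sph_dt]. Qed.

Lemma reeb_slotE k : set_slot (sph_tangent r p) ord0 reeb k = polar_tangent r p (slot_a k) (slot_b k).
Proof. by rewrite /set_slot /slot_a /slot_b; case: ifP => // _; rewrite sph_tangentE. Qed.

Lemma omega_slots (k l : 'I_(1 + n * 2)) : pair_omega z (set_slot (sph_tangent r p) ord0 reeb k)
   (set_slot (sph_tangent r p) ord0 reeb l) =
  (\sum_j (slot_a k j * slot_b l j - slot_b k j * slot_a l j)) / (2 * pi).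
Proof. by rewrite !reeb_slotE omega_chart // sum_slot_a. Qed.

Lemma dc_reeb : dc log_tau z (fun=> reeb) = (2 * pi)^-1.
Proof.
rewrite dc_log_tau // rsympl_chart tau_chart (eq_bigr (sph_t p)) => [|j _]; last by rewrite mulr1.
rewrite sum_sph_t mulr1 [X in _ / X]mulrC invfM mulrA divff ?mul1r //.
by rewrite gt_eqF // exprn_gt0.
Qed.

End AtPoint.

(** On the sphere d^c log tau = (1/2pi) sum t_j dtheta_j and
    omega = (1/2pi) sum dt_j dtheta_j has constant coefficients in the chart; the
    only varying coefficients t_j are removed by exchanging d/dtheta_0 for
    the generator of the circle action, which lies in the kernel of omega. *)
Lemma sigma_chart_const (r r' : R) (p p' : P) : 0 < r -> 0 < r' -> sph_dom p -> sph_dom p' ->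
  sigma (sph_chart r p) (sph_tangent r p) = sigma (sph_chart r' p') (sph_tangent r' p').
Proof.
move=> r0 r'0 pd pd'; rewrite !sigma_reeb //.
have t0 : 0 < tau (sph_chart r p) by rewrite tau_chart // exprn_gt0.
have t0' : 0 < tau (sph_chart r' p') by rewrite tau_chart // exprn_gt0.
apply: wedge_pow_determined.
- exact: omega_pair_determined.
- exact: omega_slot_additive.
- exact: omega_slot_additive.
- by move=> i j; rewrite -!/pair_omega !omega_slots.
- move=> j; rewrite -/pair_omega omega_slots // /slot_a /slot_b eqxx.
  rewrite (eq_bigr (fun l => -1 * slot_a j l)) => [|l _]; last by rewrite /slot_a; ring.
  by rewrite -mulr_sumr sum_slot_a mulr0 mul0r.
- move=> j; rewrite -/pair_omega omega_slots //.
  rewrite (eq_bigr (slot_a j)) ?sum_slot_a ?mul0r // => l _.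
  by rewrite /slot_b /slot_a eqxx; ring.
- by rewrite !set_slot_same !dc_reeb.
Qed.

Lemma sigma_density : exists c : R, forall r p, 0 < r -> sph_dom p ->
  sigma (sph_chart r p) (sph_tangent r p) = c.
Proof.
have [[p0 pd0]|np] := pselect (exists p0 : P, sph_dom p0).
  by exists (sigma (sph_chart 1 p0) (sph_tangent 1 p0)) => r p r0 pd; exact: sigma_chart_const.
by exists 0 => r p _ pd; case: np; exists p.
Qed.

End SphereDensity.

(** * Orders of growth *)

Section GrowthOrder.
Context {R : realType} {n : nat}.
Local Notation V := 'rV[R[i]]_n.+1.
Implicit Types (g : V -> R[i]^o) (a x y : R).

Lemma lne_le_expR (t : \bar R) x : (lne t <= x%:E)%E = (t <= (expR x)%:E)%E.
Proof.
case: t => [t| |] /=; last by rewrite !leNye.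
  case: ifP => t0.
    by rewrite leNye lee_fin (le_trans t0 (expR_ge0 _)).
  by rewrite !lee_fin -[in RHS](@lnK _ t) ?ler_expR // posrE ltNge t0.
by rewrite !leye_eq.
Qed.

Lemma growth_order_ge0 g : (0 <= growth_order g)%E.
Proof.
apply: le_ereal_inf_tmp => _ [W [A [_ WA]] <-].
pose r := Num.max (A + 1) 2.
have r1 : 1 < r by rewrite lt_max; apply/orP; right; lra.
have /WA Wr : A < r by rewrite lt_max ltrDl ltr01.
apply: le_trans (ereal_sup_ubound _); last by exists r => //.
by apply: mule_ge0; rewrite ?le_max ?lexx ?orbT // lee_fin invr_ge0 ln_ge0 // ltW.
Qed.

(** Orders are compared through power bounds r ^ a = exp (a log r). *)
Lemma growth_order_le g a : 0 <= a ->
  (exists A, forall r, A < r -> (nevanlinna_T g r <= (expR (a * ln r))%:E)%E) ->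
  (growth_order g <= a%:E)%E.
Proof.
move=> a0 [A H]; pose W := [set r | Num.max A 1 < r].
apply: (@le_trans _ _ (ereal_sup [set (maxe (lne (nevanlinna_T g r)) 0 * ((ln r)^-1)%:E)%E | r in W])).
  apply: ereal_inf_lbound; exists W => //.
  by exists (Num.max A 1); split => //; exact: num_real.
apply: ge_ereal_sup => _ [r Wr <-]; move: Wr; rewrite /W /= gt_max => /andP[Ar r1].
have l0 : 0 < ln r by rewrite ln_gt0.
rewrite lee_pdivrMr // ge_max -EFinM lne_le_expR H //=.
by rewrite lee_fin mulr_ge0 // ltW.
Qed.

Lemma growth_order_lt g a : (growth_order g < a%:E)%E ->
  exists A, forall r, A < r -> (nevanlinna_T g r <= (expR (a * ln r))%:E)%E.
Proof.
move=> /ereal_inf_lt [_ [W [A [_ WA]] <-] sa].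
exists (Num.max A 1) => r; rewrite gt_max => /andP[/WA Wr r1].
have l0 : 0 < ln r by rewrite ln_gt0.
have : (maxe (lne (nevanlinna_T g r)) 0 * ((ln r)^-1)%:E <= a%:E)%E.
  by apply: le_trans (ltW sa); apply: ereal_sup_ubound; exists r.
by rewrite lee_pdivrMr // ge_max -EFinM lne_le_expR => /andP[].
Qed.

Lemma growth_order_real g : (growth_order g < +oo)%E -> exists2 a, 0 <= a & growth_order g = a%:E.
Proof.
have := growth_order_ge0 g; case: (growth_order g) => // a a0 _.
by exists a; rewrite // -lee_fin.
Qed.

(** A constant factor is absorbed by an arbitrarily small increase of the exponent. *)
Lemma eventually_expR_le (D a d : R) : 0 < d ->
  exists A, forall r, A < r -> D * expR ((a + d) * ln r) <= expR ((a + 2 * d) * ln r).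
Proof.
move=> d0; exists (expR (Num.max D 0 / d)) => r hr.
have r0 : 0 < r by apply: lt_trans hr; exact: expR_gt0.
have : Num.max D 0 / d <= ln r by rewrite -ler_expR lnK ?posrE // ltW.
rewrite ler_pdivrMr // => h.
have -> : (a + 2 * d) * ln r = ln r * d + (a + d) * ln r by ring.
rewrite [in leRHS]expRD ler_pM2r ?expR_gt0 //.
have h1 := expR_ge1Dx (ln r * d).
have : D <= Num.max D 0 by rewrite le_max lexx.
lra.
Qed.

Lemma integral_le0T (f : R -> \bar R) : (forall x, (f x <= 0)%E) ->
  (\int[@lebesgue_measure R]_x f x <= 0)%E.
Proof.
move=> f0; rewrite integralE (_ : f^\+%E = cst 0%E); last first.
  by apply/funext => x; rewrite funeposE; apply/max_idPr.
rewrite integral_cst // mul0e sub0e oppe_le0; apply: integral_ge0 => x _; exact: funeneg_ge0.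
Qed.

Lemma iter_seq_le0 k (Psi : seq R -> \bar R) : (forall l, (Psi l <= 0)%E) -> (iter_seq k Psi <= 0)%E.
Proof. by elim: k Psi => [|k IH] Psi H //=; apply: integral_le0T => x; exact: IH. Qed.

Lemma growth_order_degenerate g : (forall r, 0 < r -> (nevanlinna_T g r <= 0)%E) -> growth_order g = 0%E.
Proof.
move=> H; apply/eqP; rewrite eq_le growth_order_ge0 andbT; apply: growth_order_le => //.
exists 0 => r r0; apply: le_trans (H r r0) _; rewrite lee_fin; exact: expR_ge0.
Qed.

End GrowthOrder.

(** * Comparison of the characteristics *)

Section CompareCharacteristics.
Context {R : realType} {n : nat}.
Local Notation V := 'rV[R[i]]_n.+1.
Implicit Types (f g : V -> R[i]^o) (z : V) (j : 'I_n.+1).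

Section Constants.
Variable c : R.
Hypothesis c0 : 0 < c.
Hypothesis sigmac : forall (r : R) (p : 'rV[R]_(1 + n * 2)), 0 < r -> sph_dom p ->
  sigma (sph_chart r p) (sph_tangent r p) = c.

(* The box dl < t_j < 2 dl for j > 0 leaves t_0 >= 1 / 2, and on the sphere of radius
   K s it keeps |z_j| >= K s sqrt dl = 3 s. *)
Let dl : R := 1 / (4 * n.+1%:R).
Let K : R := 3 / Num.sqrt dl.
Let A1 : R := c * (2 * pi) ^+ (1 + n * 2).
Let A2 : R := c * pi * (pi * dl) ^+ n.

Let dl0 : 0 < dl. Proof. by rewrite divr_gt0 // mulr_gt0. Qed.
Let sdl0 : 0 < Num.sqrt dl. Proof. by rewrite sqrtr_gt0. Qed.
Let K0 : 0 < K. Proof. by rewrite divr_gt0. Qed.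
Let A10 : 0 < A1. Proof. by rewrite mulr_gt0 // exprn_gt0 // mulr_gt0 // pi_gt0. Qed.
Let A20 : 0 < A2. Proof. by rewrite !mulr_gt0 ?pi_gt0 // exprn_gt0 // mulr_gt0 // pi_gt0. Qed.

Lemma nevanlinna_seq g (r : R) : 0 < r -> nevanlinna_T g r =
  iter_seq (1 + n * 2) (fun l => if @seq_dom R n l then (logp (modc (g (seq_point r l))) * c)%:E else 0%E).
Proof.
move=> r0.
exact: (@sph_integral_seq R n r (fun z => logp (modc (g z))) sigma c (fun p => sigmac r0)).
Qed.

Lemma nevanlinna_upper g (r B : R) : 0 < r -> 0 <= B ->
  (forall z, polydisc r z -> logp (modc (g z)) <= B) -> (nevanlinna_T g r <= (A1 * B)%:E)%E.
Proof.
move=> r0 B0 H; rewrite nevanlinna_seq //.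
have := @sphere_upper R n r (fun z => logp (modc (g z))) B c (ltW r0) (ltW c0) B0 (fun z => logp_ge0 _) H.
by rewrite /A1 (mulrC B c) mulrAC.
Qed.

Lemma nevanlinna_lower g (s : R) (w : V) : sep_subharmonic (fun z => logp (modc (g z))) -> 0 < s -> polydisc s w ->
  ((A2 * logp (modc (g w)))%:E <= nevanlinna_T g (K * s))%E.
Proof.
move=> sg s0 ws; rewrite (nevanlinna_seq _ (mulr_gt0 K0 s0)).
apply: (@sphere_lower R n (fun z => logp (modc (g z))) (K * s) dl c w sg) => //.
- exact: mulr_gt0 K0 s0.
- rewrite /dl ler_pdivrMr ?mulr_gt0 //.
  have : 1 <= n.+1%:R :> R by rewrite ler1n.
  lra.
- have : n%:R <= n.+1%:R :> R by rewrite ler_nat.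
  have n0 : 0 < n.+1%:R :> R by [].
  rewrite /dl (_ : n%:R * (2 * (1 / (4 * n.+1%:R))) = n%:R / n.+1%:R * (1 / 2)); last by field; rewrite gt_eqF.
  by move=> h; rewrite -[leRHS]mul1r ler_pM2r // ler_pdivrMr // mul1r.
- move=> j; rewrite /K mulrAC divfK ?gt_eqF // ler_pM2l //; exact: ws.
Qed.

Lemma bound_of_nevanlinna g (s M : R) : sep_subharmonic (fun z => logp (modc (g z))) -> 0 < s ->
  (nevanlinna_T g (K * s) <= M%:E)%E -> forall w : V, polydisc s w -> modc (g w) <= expR (M / A2).
Proof.
move=> sg s0 TM w ws; apply: le_trans (le_expR_logp (modc_ge0 _)) _.
rewrite ler_expR ler_pdivlMr // mulrC -lee_fin.
exact: le_trans (nevanlinna_lower sg s0 ws) TM.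
Qed.

(** The Cauchy estimate on unit discs: the polydisc of radius r + 1 <= 2 r suffices. *)
Lemma partial_upper f j (r M : R) : entire f -> 1 <= r -> 0 <= M ->
  (nevanlinna_T f (K * (2 * r)) <= M%:E)%E ->
  (nevanlinna_T (cpartial j f) r <= (A1 * (M / A2 + 1))%:E)%E.
Proof.
move=> fe r1 M0 TM.
have L0 : 0 <= M / A2 by rewrite divr_ge0 // ltW.
have r2 : 0 < 2 * r by lra.
have fB := bound_of_nevanlinna (sep_holo_subharmonic (entire_sep_holo fe)) r2 TM.
apply: nevanlinna_upper => [||z zr]; [lra|lra|].
apply: logp_le; first lra.
have [_ fh] := entire_sep_holo fe.
have := @cauchy_estimate R (fun w : R[i] => f (z + w *: delta_mx 0 j)) 0 (cpartial j f z) (expR (M / A2)).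
have lineF (w : R[i]) : cdiff (fun w : R[i] => f (z + w *: delta_mx 0 j)) w (cpartial j f (z + w *: delta_mx 0 j)).
  exact: entire_line.
move=> /(_ (fun w => ex_intro _ _ (lineF w))).
have := lineF 0; rewrite scale0r addr0 => l0 /(_ l0) H.
apply: le_trans (H _) _ => [w|]; last first.
  rewrite expRD mulrC ler_pM2l ?expR_gt0 //; exact: expR_ge1Dx.
rewrite subr0 => w1; apply: fB => k; rewrite !mxE eqxx /=.
apply: le_trans (modcD _ _) _; have := zr k.
rewrite modcM; case: (k == j); rewrite ?modc1 ?modc0; lra.
Qed.

(** The derivative of f in the direction z is the sum of the z_j d_j f. *)
Lemma entire_increment f z (r B : R) : entire f -> 0 <= r -> 0 <= B -> polydisc r z ->
  (forall j (w : V), polydisc r w -> modc (cpartial j f w) <= B) ->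
  modc (f z - f 0) <= n.+1%:R * r * B.
Proof.
move=> fe r0 B0 zr H.
have := @mean_value_bound R (fun w : R[i] => f (0 + w *: z)) (fun w : R[i] => 'D_z f (0 + w *: z)) 1 (n.+1%:R * r * B).
rewrite scale1r scale0r !add0r modc1 mulr1; apply => s /andP[s0 s1].
split; first exact: entire_line.
rewrite mulr1 add0r; set a := s%:C *: z.
have ar : polydisc r a.
  move=> k; rewrite mxE modcM modc_real ger0_norm //; apply: le_trans (zr k).
  by rewrite ler_piMl // modc_ge0.
rewrite (deriveE _ (fe a)) {1}[z]row_sum_delta linear_sum /=.
rewrite (eq_bigr (fun j => z 0 j * cpartial j f a)) => [|j _]; last first.
  by rewrite linearZ /= /cpartial (deriveE _ (fe a)).
apply: (@le_trans _ _ (\sum_(j < n.+1) r * B)).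
  elim/big_ind2: _ => [|x x' y y' hx hy|j _]; first by rewrite modc0.
    by apply: le_trans (modcD _ _) _; exact: lerD.
  by rewrite modcM; apply: ler_pM; rewrite ?modc_ge0 //; exact: H.
by rewrite sumr_const card_ord -[_ *+ n.+1]mulr_natl mulrA.
Qed.

(** From |f z| <= |f 0| + m r e^(M / A2) <= e^(M / A2) (1 + |f 0|) (1 + m r), with m
    the number of variables. *)
Lemma function_upper f (r M : R) : entire f -> 1 <= r -> 0 <= M ->
  (forall j, (nevanlinna_T (cpartial j f) (K * r) <= M%:E)%E) ->
  (nevanlinna_T f r <= (A1 * (M / A2 + ln (1 + modc (f 0)) + ln (1 + n.+1%:R * r)))%:E)%E.
Proof.
move=> fe r1 M0 TM.
have L0 : 0 <= M / A2 by rewrite divr_ge0 // ltW.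
have r0 : 0 < r by lra.
have f0 := modc_ge0 (f 0).
have nr : 0 <= n.+1%:R * r by rewrite mulr_ge0 // ltW.
have l1 : 0 <= ln (1 + modc (f 0)) by rewrite ln_ge0 // lerDl.
have l2 : 0 <= ln (1 + n.+1%:R * r) by rewrite ln_ge0 // lerDl.
apply: nevanlinna_upper => [||z zr]; [lra|lra|].
apply: logp_le; first lra.
have dB j (w : V) : polydisc r w -> modc (cpartial j f w) <= expR (M / A2).
  exact: bound_of_nevanlinna (partial_subharmonic j fe) r0 (TM j) w.
have h := entire_increment fe (ltW r0) (expR_ge0 _) zr dB.
rewrite !expRD !lnK ?posrE; try lra.
have h2 := modc_sub (f z) (f 0).
have e1 : 1 <= expR (M / A2) by rewrite -expR0 ler_expR.
have : modc (f 0) * 1 <= modc (f 0) * expR (M / A2) by rewrite ler_wpM2l.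
have : 0 <= expR (M / A2) * (1 + modc (f 0) * (n.+1%:R * r)).
  by rewrite mulr_ge0 ?expR_ge0 // addr_ge0 // mulr_ge0.
move: h h2; set e := expR (M / A2); set a := modc (f 0); set b := n.+1%:R * r.
move=> h h2 k1 k2; have -> : e * (1 + a) * (1 + b) = e * (1 + a * b) + a * e + b * e by ring.
lra.
Qed.

(** With exponents a, a + d, a + 2 d: the first step absorbs additive terms, the
    second one constant factors. *)
Lemma partial_power_bound f j (a d : R) : entire f -> 0 <= a -> 0 < d ->
  (exists A, forall r, A < r -> (nevanlinna_T f r <= (expR (a * ln r))%:E)%E) ->
  exists A, forall r, A < r -> (nevanlinna_T (cpartial j f) r <= (expR ((a + 2 * d) * ln r))%:E)%E.
Proof.
move=> fe a0 d0 [A H].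
have K20 : 0 < K * 2 by rewrite mulr_gt0.
pose D := A1 * (expR (a * ln (K * 2)) / A2 + 1).
have [A' HA'] := eventually_expR_le D a d0.
exists (Num.max (Num.max A' 1) (A / (K * 2))) => r; rewrite !gt_max => /andP[/andP[r1 r2] r3].
have r0 : 0 < r by lra.
have Kr : A < K * (2 * r) by move: r3; rewrite ltr_pdivrMr // mulrC mulrA.
apply: le_trans (partial_upper j fe (ltW r2) (expR_ge0 _) (H _ Kr)) _.
rewrite lee_fin; apply: le_trans (HA' r r1); rewrite /D -mulrA ler_pM2l //.
have l0 : 0 < ln r by rewrite ln_gt0.
rewrite mulrA lnM ?posrE // mulrDr expRD mulrDl mul1r.
have e1 : expR (a * ln r) <= expR ((a + d) * ln r) by rewrite ler_expR ler_pM2r //; lra.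
apply: lerD; last by rewrite -expR0 ler_expR mulr_ge0 // ?ltW //; lra.
by rewrite mulrAC ler_wpM2l // divr_ge0 ?expR_ge0 // ltW.
Qed.

(** The term log r is absorbed through log r <= r^d / d. *)
Lemma function_power_bound f (a d : R) : entire f -> 0 <= a -> 0 < d ->
  (forall j, exists A, forall r, A < r -> (nevanlinna_T (cpartial j f) r <= (expR (a * ln r))%:E)%E) ->
  exists A, forall r, A < r -> (nevanlinna_T f r <= (expR ((a + 2 * d) * ln r))%:E)%E.
Proof.
move=> fe a0 d0 /choice [As HA].
pose A := \sum_j `|As j|.
have AsA j : As j <= A.
  apply: le_trans (ler_norm _) _; rewrite /A (bigD1 j) //= lerDl.
  by apply: sumr_ge0.
have n2 : 0 < n.+2%:R :> R by [].
have f0 := modc_ge0 (f 0).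
pose D := A1 * (expR (a * ln K) / A2 + (ln (1 + modc (f 0)) + ln n.+2%:R) + 1 / d).
have [A' HA'] := eventually_expR_le D a d0.
exists (Num.max (Num.max A' 1) (A / K)) => r; rewrite !gt_max => /andP[/andP[r1 r2] r3].
have r0 : 0 < r by lra.
have Kr : A < K * r by move: r3; rewrite ltr_pdivrMr // mulrC.
apply: le_trans (function_upper fe (ltW r2) (expR_ge0 _) (fun j => HA j _ (le_lt_trans (AsA j) Kr))) _.
rewrite lee_fin; apply: le_trans (HA' r r1); rewrite /D -mulrA ler_pM2l //.
have l0 : 0 < ln r by rewrite ln_gt0.
rewrite lnM ?posrE // mulrDr expRD.
have e1 : expR (a * ln r) <= expR ((a + d) * ln r) by rewrite ler_expR ler_pM2r //; lra.
have e2 : expR (d * ln r) <= expR ((a + d) * ln r) by rewrite ler_expR ler_pM2r //; lra.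
have e3 : 1 <= expR ((a + d) * ln r) by rewrite -expR0 ler_expR mulr_ge0 // ?ltW //; lra.
have q1 : expR (a * ln K) * expR (a * ln r) / A2 <= expR (a * ln K) / A2 * expR ((a + d) * ln r).
  by rewrite mulrAC ler_wpM2l // divr_ge0 ?expR_ge0 // ltW.
have p1 : 0 <= ln (1 + modc (f 0)) by rewrite ln_ge0 // lerDl.
have p2 : 0 <= ln (n.+2%:R : R) by rewrite ln_ge0 // ler1n.
have q2 : (ln (1 + modc (f 0)) + ln n.+2%:R) * 1 <= (ln (1 + modc (f 0)) + ln n.+2%:R) * expR ((a + d) * ln r).
  by rewrite ler_wpM2l // addr_ge0.
have q3 : ln (1 + n.+1%:R * r) <= ln n.+2%:R + ln r.
  have nr : 0 <= n.+1%:R * r by rewrite mulr_ge0 // ltW.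
  rewrite -lnM ?posrE // ler_ln ?posrE ?mulr_gt0 //; last by lra.
  by rewrite -[n.+2%:R]natr1 mulrDl mul1r; lra.
have q4 : ln r <= 1 / d * expR ((a + d) * ln r).
  rewrite mulrAC mul1r ler_pdivlMr //.
  have := expR_ge1Dx (d * ln r); rewrite (mulrC (ln r)); lra.
move: q1 q2 q3 q4; set E := expR ((a + d) * ln r); set X := expR (a * ln K) * _ / _.
set Y := expR (a * ln K) / A2; set p := ln (1 + modc _); set q := ln n.+2%:R.
move=> q1 q2 q3 q4; rewrite !mulrDl in q2 *; lra.
Qed.

End Constants.

End CompareCharacteristics.

Theorem lemma2p9 (R : realType) (n : nat) (f : 'rV[R[i]]_n.+1 -> R[i]^o)
  (f_entire : entire f)
  (f_nonconst : ~ exists c : R[i], forall z, f z = c)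
  (df_neq0 : forall i : 'I_n.+1, exists z, cpartial i f z <> 0) :
  \big[maxe/-oo%E]_(i < n.+1) growth_order (cpartial i f) = growth_order f.
Proof.
have [c Hc] := @sigma_density R n.
have [c0|c0] := leP c 0.
  have T0 (g : 'rV[R[i]]_n.+1 -> R[i]^o) (r : R) : 0 < r -> (nevanlinna_T g r <= 0)%E.
    move=> r0; rewrite (nevanlinna_seq Hc) //; apply: iter_seq_le0 => l.
    by case: ifP => // _; rewrite lee_fin mulr_ge0_le0 // logp_ge0.
  have O (g : 'rV[R[i]]_n.+1 -> R[i]^o) : growth_order g = 0%E by apply: growth_order_degenerate => r; exact: T0.
  have -> := O f; apply/eqP; rewrite eq_le; apply/andP; split.
    by apply: bigmax_le => [|i _]; [exact: leNye|rewrite (O (cpartial i f))].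
  apply: le_trans (growth_order_ge0 (cpartial ord0 f)) _.
  exact: (le_bigmax _ (fun i => growth_order (cpartial i f)) ord0).
apply/eqP; rewrite eq_le; apply/andP; split.
  apply: bigmax_le => [|j _]; first exact: leNye.
  have [->|finf] := eqVneq (growth_order f) +oo%E; first exact: leey.
  have fin : (growth_order f < +oo)%E by rewrite ltey.
  have [L L0 EL] := growth_order_real fin.
  rewrite EL; apply/lee_addgt0Pr => e e0; rewrite -EFinD.
  have e3 : 0 < e / 3 by rewrite divr_gt0.
  have LT : (growth_order f < (L + e / 3)%:E)%E by rewrite EL lte_fin ltrDl.
  have := partial_power_bound c0 Hc j f_entire _ e3 (growth_order_lt LT).
  rewrite (_ : L + e / 3 + 2 * (e / 3) = L + e); last by field.
  by move=> H; apply: growth_order_le; [lra|apply: H; lra].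
set M := \big[maxe/-oo%E]_(i < n.+1) growth_order (cpartial i f).
have leM j : (growth_order (cpartial j f) <= M)%E.
  exact: (le_bigmax _ (fun i => growth_order (cpartial i f)) j).
have M0 : (0 <= M)%E by apply: le_trans (growth_order_ge0 _) (leM ord0).
case EM : M => [L| |]; [|exact: leey|by rewrite EM in M0].
have L0 : 0 <= L by rewrite -lee_fin -EM.
apply/lee_addgt0Pr => e e0; rewrite -EFinD.
have e3 : 0 < e / 3 by rewrite divr_gt0.
have LT j : (growth_order (cpartial j f) < (L + e / 3)%:E)%E.
  by apply: le_lt_trans (leM j) _; rewrite EM lte_fin ltrDl.
have := function_power_bound c0 Hc f_entire _ e3 (fun j => growth_order_lt (LT j)).
rewrite (_ : L + e / 3 + 2 * (e / 3) = L + e); last by field.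
by move=> H; apply: growth_order_le; [lra|apply: H; lra].
Qed.
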